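(* Let $0\le\alpha\le\beta\le 1$, $\lambda:=\alpha+\beta$, and $K(x,y)=x^\alpha y^\beta+x^\beta y^\alpha$ for $(x,y)\in(0,\infty)^2$. Let $b$ be a daughter distribution function satisfying the following conditions for all $(x,y)\in(0,\infty)^2$: (i) $\int_0^{x+y} z\,b(z,x,y)\,dz=x+y$ and $b(z,x,y)=0$ for $z>x+y$; (ii) there is a non-negative function $\bar b$ such that $b(z,x,y)=\bar b(z,x,y)\mathbf 1_{(0,x)}(z)+\bar b(z,y,x)\mathbf 1_{(0,y)}(z)$ for $z\in(0,\infty)$, $\int_0^x z\,\bar b(z,x,y)\,dz=x$, and $\bar b(z,x,y)=0$ for $z>x$; (iii) $\int_0^{x+y} b(z,x,y)\,dz\le\beta_0$ for some constant $\beta_0>2$ independent of $(x,y)$; (iv) $\int_0^x \bar b(z,x,y)^p\,dz\le \frac{B_p}{2}x^{1-p}$ for some constants $p\in(1,2)$ and $B_p>0$ independent of $(x,y)$. Let $f^{in}\in X_0\cap X_{1+\beta}^+$ with $M_1(f^{in})>0$. Set $T_*:=\infty$ if $\lambda\ge 1$ and $$T_*:=T_0(f^{in}):=\frac{M_0(f^{in})^{\lambda-1}}{(1-\lambda)(\beta_0-2)M_1(f^{in})^\lambda}\quad\text{if }\lambda\in[0,1).$$ Then there is a unique mass-conserving weak solution $f$ on $[0,T_* )$ to the collision-induced breakage equation with initial condition $f^{in}$ which is locally bounded in $X_{1+\beta}$, i.e. $f\in L^\infty((0,t),X_{1+\beta})$ for every $t\in(0,T_* )$.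
   Context: Functions are measurable. For $m\in\mathbb R$, $X_m:=L^1((0,\infty),x^m dx)$ with norm $\|h\|_{X_m}=\int_0^\infty x^m|h(x)|\,dx$, $M_m(h):=\int_0^\infty x^m h(x)\,dx$, and $X_m^+$ is the cone of (a.e.) non-negative elements of $X_m$; $X_{0,w}$ is $X_0=L^1(0,\infty)$ with its weak topology. A daughter distribution function is a non-negative measurable function $b$ on $(0,\infty)^3$. The collision-induced breakage equation with collision kernel $K$, daughter distribution function $b$ and initial condition $f^{in}$ is $\partial_t f=\mathcal Bf$, $f(0)=f^{in}$, with $$\mathcal B f(x)=\frac12\int_x^\infty\int_0^y b(x,y-z,z)K(y-z,z)f(y-z)f(z)\,dz\,dy-\int_0^\infty K(x,y)f(x)f(y)\,dy.$$ Weak solution: for $T\in(0,\infty]$, a weak solution on $[0,T)$ is a non-negative $f\in C([0,T),X_{0,w})\cap L^\infty((0,T),X_1^+)$ such that $(s,x,y)\mapsto K(x,y)f(s,x)f(s,y)\in L^1((0,t)\times(0,\infty)^2)$ and $$\int_0^\infty\phi(x)(f(t,x)-f^{in}(x))\,dx=\frac12\int_0^t\int_0^\infty\int_0^\infty\zeta_\phi(x,y)K(x,y)f(s,x)f(s,y)\,dy\,dx\,ds$$ for all $t\in(0,T)$ and $\phi\in L^\infty(0,\infty)$, where $\zeta_\phi(x,y):=\int_0^{x+y}\phi(z)b(z,x,y)\,dz-\phi(x)-\phi(y)$. It is mass-conserving on $[0,T)$ if moreover $M_1(f(t))=M_1(f^{in})$ for all $t\in[0,T)$. *)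

(* Defs.v *)
From HB Require Import structures.
From mathcomp Require Import all_boot all_order all_algebra.
From mathcomp Require Import all_classical all_reals all_analysis.

Set Implicit Arguments.
Unset Strict Implicit.
Unset Printing Implicit Defensive.

Import Order.TTheory GRing.Theory Num.Theory.
Import numFieldNormedType.Exports.

Local Open Scope classical_set_scope.
Local Open Scope ring_scope.

(** Measurability is Borel measurability, and an element of a Lebesgue space is
    given by a representative: a function [h : R -> R] of which only the values
    on the half-line matter, up to a Lebesgue-null set. *)

Section CollisionInducedBreakage.
Context {R : realType}.
Implicit Types (h phi : R -> R) (T : \bar R).

Local Notation mu := (@lebesgue_measure R).

Definition halfline : set R := `]0, +oo[.

Definition X (m : R) : set (R -> R) :=
  [set h | mu.-integrable halfline (EFin \o (fun x => x `^ m * h x))].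

Definition Xplus (m : R) : set (R -> R) :=
  [set h | X m h /\ {ae mu, forall x, 0 < x -> 0 <= h x}].

Definition Xnorm (m : R) h : R := \int[mu]_(x in halfline) (x `^ m * `|h x|).

Definition moment (m : R) h : R := \int[mu]_(x in halfline) (x `^ m * h x).

Definition Linfty : set (R -> R) :=
  [set phi : R -> R | measurable_fun halfline phi /\
     exists C : R, {ae mu, forall x, 0 < x -> `|phi x| <= C}].

(** Continuous linear functionals on [X 0]. The bound forces [l] to be
    compatible with almost everywhere equality. *)
Definition X0_dual : set ((R -> R) -> R) :=
  [set l | (forall (a : R) h1 h2, X 0 h1 -> X 0 h2 ->
              l (fun x => a * h1 x + h2 x) = a * l h1 + l h2) /\
     exists C : R, forall h, X 0 h -> `|l h| <= C * Xnorm 0 h].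

Definition time_co T : set R := [set t | 0 <= t /\ (t%:E < T)%E].
Definition time_oo T : set R := [set t | 0 < t /\ (t%:E < T)%E].

(** Continuity into [X 0] with its weak topology, the initial topology of the
    functionals in [X0_dual]. *)
Definition weakly_continuous T (f : R -> R -> R) : Prop :=
  (forall t, time_co T t -> X 0 (f t)) /\
  forall l, X0_dual l -> {within time_co T, continuous (fun t => l (f t))}.

(** [f] is essentially bounded on [(0, T)] with values in the subset [E] of
    [X m]. Measurability in time is not part of this definition: it comes from
    the joint measurability required in [weak_solution]. *)
Definition Linfty_time T (m : R) (E : set (R -> R)) (f : R -> R -> R) : Prop :=
  exists C : R,
    {ae mu, forall t, time_oo T t -> E (f t) /\ Xnorm m (f t) <= C}.

Definition daughter_distribution (b : R -> R -> R -> R) : Prop :=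
  measurable_fun (halfline `*` halfline `*` halfline)
    (fun q : R * R * R => b q.1.1 q.1.2 q.2) /\
  forall z x y, 0 < z -> 0 < x -> 0 < y -> 0 <= b z x y.

Definition zeta (b : R -> R -> R -> R) phi (x y : R) : R :=
  \int[mu]_(z in `]0, x + y[) (phi z * b z x y) - phi x - phi y.

(** A continuous curve in [X 0] with its weak topology always has a jointly
    measurable representative [f], with the prescribed class at every time, so
    the first clause only selects a representative. *)
Definition weak_solution (K : R -> R -> R) (b : R -> R -> R -> R)
    (fin : R -> R) T (f : R -> R -> R) : Prop :=
  [/\ measurable_fun (time_co T `*` halfline) (fun q : R * R => f q.1 q.2),
      weakly_continuous T f /\ (forall t, time_co T t -> Xplus 0 (f t)),
      Linfty_time T 1 (Xplus 1) f,
      forall t, time_oo T t ->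
        ((mu \x mu) \x mu)%E.-integrable (`]0, t[ `*` halfline `*` halfline)
          (fun q : R * R * R =>
             (K q.1.2 q.2 * f q.1.1 q.1.2 * f q.1.1 q.2)%:E) &
      forall t phi, time_oo T t -> Linfty phi ->
        \int[mu]_(x in halfline) (phi x * (f t x - fin x)) =
        2^-1 * \int[mu]_(s in `]0, t[) \int[mu]_(x in halfline)
                 \int[mu]_(y in halfline)
                   (zeta b phi x y * K x y * f s x * f s y)].

Definition mass_conserving (fin : R -> R) T (f : R -> R -> R) : Prop :=
  forall t, time_co T t -> X 1 (f t) /\ moment 1 (f t) = moment 1 fin.

Definition collision_kernel (alpha beta x y : R) : R :=
  x `^ alpha * y `^ beta + x `^ beta * y `^ alpha.

Definition T0 (lambda beta0 : R) (fin : R -> R) : R :=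
  moment 0 fin `^ (lambda - 1) /
  ((1 - lambda) * (beta0 - 2) * moment 1 fin `^ lambda).

Definition Tstar (lambda beta0 : R) (fin : R -> R) : \bar R :=
  if 1 <= lambda then +oo%E else (T0 lambda beta0 fin)%:E.

End CollisionInducedBreakage.

(* Main.v *)
Require Import Defs.
From HB Require Import structures.
From mathcomp Require Import all_boot all_order all_algebra.
From mathcomp Require Import all_classical all_reals all_analysis.
From mathcomp Require Import measurable_realfun.
From mathcomp Require Import ring lra.

Set Implicit Arguments.
Unset Strict Implicit.
Unset Printing Implicit Defensive.

Import Order.TTheory GRing.Theory Num.Theory.
Import numFieldNormedType.Exports.

Local Open Scope classical_set_scope.
Local Open Scope ring_scope.

(** Breakage equations of this kind are ordinary differential equations for
    the distance [\int (1 + x) |f - g|], once the moments of the solutions are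
    under control; the theorem follows from that remark and from the way in
    which breakage acts on superlinear weights.

    _The one-sided estimate_ (lemma [Q_dissip]). Put [E = f - g] and test the
    difference of two equations with [(1 + x) sgn E]. A collision of [x] with
    [y], weighted by [E y], creates fragments of total weight at most
    [beta0 + x + y], since there are at most [beta0] of them and they carry
    the mass [x + y]; the loss of the particle [y] removes [1 + y]. The factor
    [y] cancels, and what remains is at most [(beta0 + 1) (1 + x) |E y|], where
    the weight sits on the other particle. As [(1 + x) K(x, y)] is at most a
    multiple of [(1 + x^(1 + beta)) (1 + y)], the distance grows at most
    exponentially as long as the moments of orders [0] and [1 + beta] of both
    solutions are bounded. The test has to be cut at a size [r] to be bounded,
    and this costs the tail beyond [r] of the moment of order [1 + beta].

    _The moments_ (lemmas [step_conv] and [step_num]). Each colliding particle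
    breaks separately, into pieces that are smaller than itself and that carry
    its mass. Therefore a weight [x * th x] with [th] nondecreasing cannot be
    increased by a collision. For [th = 1] this is the conservation of mass,
    for [th = x^beta] it bounds the moment of order [1 + beta], and cutting
    [th] below a size [r] bounds the tail of that moment by the tail of the
    initial datum. The number of particles [m] satisfies
    [m' <= (beta0 - 2) M1^lambda m^(2 - lambda)] by interpolation between the
    number and the mass [M1], and the solution of the corresponding
    differential equation stays finite exactly up to [Tstar] (lemma
    [majorant_exists]).

    _Existence_ (theorem [model_existence]). Explicit Euler polygons started
    from the truncated datum are non-negative for small steps and inherit all
    these bounds. They solve the equation up to a defect that is quadratic in
    the length of the time interval, so that the one-sided estimate and a
    Gronwall argument make them a Cauchy sequence for the weighted distance
    (lemma [approximant_cauchy]). Their limit satisfies the integrated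
    equation, because a quadratic defect vanishes when the interval is divided.

    _Uniqueness_ (theorem [model_uniqueness]). The moments of a weak solution
    are bounded at almost every time only. Testing the equation with
    superlinear weights, cut at a size which is then sent to infinity, bounds
    them at every time, with the same tails as above (lemma
    [conv_transport]). A weak solution is then a Lipschitz curve for the
    weighted distance, with a quadratic defect, and the stability estimate
    compares it with the solution already constructed. *)

(** * Integrals of real-valued functions *)

Notation mf f := (measurable_fun setT f).
Notation ig mu f := (mu.-integrable setT (EFin \o f)).

Section RealIntegral.
Context d (T : measurableType d) (R : realType).
Variable mu : {measure set T -> \bar R}.
Implicit Types f g : T -> R.

Lemma ig_mf f : ig mu f -> mf f.
Proof. by move=> /integrableP[+ _] => /measurable_EFinP. Qed.

Lemma ig_le f g : mf f -> ig mu g -> (forall x, `|f x| <= g x) -> ig mu f.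
Proof.
move=> mfF ig_g fg; apply: (le_integrable measurableT _ _ ig_g).
  exact/measurable_EFinP.
by move=> x _ /=; rewrite lee_fin (le_trans (fg x))// ler_norm.
Qed.

Lemma igD f g : ig mu f -> ig mu g -> ig mu (fun x => f x + g x).
Proof.
move=> hf hg; have := integrableD measurableT hf hg.
by apply: eq_integrable => // x _.
Qed.

Lemma igB f g : ig mu f -> ig mu g -> ig mu (fun x => f x - g x).
Proof.
move=> hf hg; have := integrableB measurableT hf hg.
by apply: eq_integrable => // x _.
Qed.

Lemma igZ (c : R) f : ig mu f -> ig mu (fun x => c * f x).
Proof.
move=> hf; have := integrableZl measurableT c hf.
by apply: eq_integrable => // x _.
Qed.

Lemma ig0 : ig mu (fun=> 0 : R).
Proof. exact: integrable0. Qed.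

Lemma ig_abs f : ig mu f -> ig mu (fun x => `|f x|).
Proof. by move=> hf; have := integrable_norm hf. Qed.

Lemma I_EFin f : ig mu f -> (\int[mu]_x f x)%:E = (\int[mu]_x (f x)%:E)%E.
Proof.
move=> hf; rewrite /Rintegral fineK//.
exact: integrable_fin_num.
Qed.

Lemma I_eq f g : (forall x, f x = g x) -> \int[mu]_x f x = \int[mu]_x g x.
Proof. by move=> fg; congr Rintegral; apply/funext. Qed.

Lemma I_D f g : ig mu f -> ig mu g ->
  \int[mu]_x (f x + g x) = \int[mu]_x f x + \int[mu]_x g x.
Proof. exact: RintegralD. Qed.

Lemma I_B f g : ig mu f -> ig mu g ->
  \int[mu]_x (f x - g x) = \int[mu]_x f x - \int[mu]_x g x.
Proof. exact: RintegralB. Qed.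

Lemma I_Z (c : R) f : ig mu f -> \int[mu]_x (c * f x) = c * \int[mu]_x f x.
Proof. by move=> hf; rewrite RintegralZl. Qed.

Lemma I_le f g : ig mu f -> ig mu g -> (forall x, f x <= g x) ->
  \int[mu]_x f x <= \int[mu]_x g x.
Proof. by move=> hf hg fg; apply: le_Rintegral. Qed.

Lemma I_ge0 f : (forall x, 0 <= f x) -> 0 <= \int[mu]_x f x.
Proof. by move=> f0; apply: Rintegral_ge0. Qed.

Lemma I_0 : \int[mu]_x (0 : R) = 0.
Proof. by rewrite /Rintegral integral0. Qed.

Lemma I_abs f : ig mu f -> `|\int[mu]_x f x| <= \int[mu]_x `|f x|.
Proof. by move=> hf; apply: le_normr_Rintegral. Qed.

Lemma I_abs_le f g : ig mu f -> ig mu g -> (forall x, `|f x| <= g x) ->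
  `|\int[mu]_x f x| <= \int[mu]_x g x.
Proof.
move=> hf hg fg; apply: le_trans (I_abs hf) _.
by apply: I_le => //; exact: ig_abs.
Qed.

Lemma ig_bound f (C : R) : mf f -> (forall x, 0 <= f x) ->
  (\int[mu]_x (f x)%:E <= C%:E)%E -> ig mu f /\ \int[mu]_x f x <= C.
Proof.
move=> hf f0 hC.
have hi : ig mu f.
  apply/integrableP; split; first exact/measurable_EFinP.
  under eq_integral do rewrite /= ger0_norm//.
  by apply: le_lt_trans hC _; rewrite ltry.
by split=> //; rewrite -lee_fin I_EFin.
Qed.

Lemma I_ae_eq f g : mf f -> mf g -> {ae mu, forall x, f x = g x} ->
  \int[mu]_x f x = \int[mu]_x g x.
Proof.
move=> hf hg fg; rewrite /Rintegral; congr fine.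
apply: ae_eq_integral => //; try exact/measurable_EFinP.
by apply: filterS fg => x /= -> _.
Qed.

Lemma ig_ae_eq f g : mf g -> ig mu f -> {ae mu, forall x, f x = g x} -> ig mu g.
Proof.
move=> hg hf fg; apply/integrableP; split; first exact/measurable_EFinP.
have /integrableP[_] := hf; congr (_ < _)%E.
apply: ae_eq_integral => //.
- by apply: measurableT_comp => //; exact/measurable_EFinP/ig_mf.
- by apply: measurableT_comp => //; exact/measurable_EFinP.
- by apply: filterS fg => x /= -> _.
Qed.

Lemma I_eq0_ae f : ig mu f -> (forall x, 0 <= f x) -> \int[mu]_x f x <= 0 ->
  {ae mu, forall x, f x = 0}.
Proof.
move=> hf f0 If0.
have e0 : (\int[mu]_x `|(EFin \o f) x| = 0)%E.
  transitivity (\int[mu]_x f x)%:E.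
    rewrite I_EFin//; apply: eq_integral => x _ /=; by rewrite ger0_norm.
  by congr EFin; apply/eqP; rewrite eq_le If0/= I_ge0.
have := (ae_eq_integral_abs mu measurableT (measurable_int _ hf)).1 e0.
by apply: filterS => x /= h; have [] := h I.
Qed.

Lemma ae_imp (A B : T -> Prop) : (forall x, A x -> B x) ->
  {ae mu, forall x, A x} -> {ae mu, forall x, B x}.
Proof. by move=> AB; apply: filterS. Qed.

(** Integrability is usually known on an exhausting sequence of sets only; monotone
    convergence then gives it on the whole space, with the same bound. *)
Lemma ig_exhaust f (P : nat -> T -> bool) (C : R) : mf f ->
  (forall x, 0 <= f x) ->
  (forall x m n, (m <= n)%N -> P m x -> P n x) ->
  (forall x, exists n, P n x) ->
  (forall n, ig mu (fun x => if P n x then f x else 0) /\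
     \int[mu]_x (if P n x then f x else 0) <= C) ->
  ig mu f /\ \int[mu]_x f x <= C.
Proof.
move=> hf f0 Pm Pe hn; apply: ig_bound => //.
pose g n x := (if P n x then f x else 0)%:E.
have cg x : (g ^~ x @ \oo --> (f x)%:E)%E.
  have [n Pn] := Pe x.
  apply: cvg_near_cst; near=> m.
  rewrite /g ifT//; apply: Pm Pn; near: m; exact: nbhs_infty_ge.
rewrite (_ : \int[mu]_x (f x)%:E = limn (fun n => \int[mu]_x g n x))%E; last first.
  have -> : (\int[mu]_x (f x)%:E = \int[mu]_x limn (g ^~ x))%E.
    by apply: eq_integral => x _; apply/esym/cvg_lim => //; exact: cg.
  apply: monotone_convergence => //.
  - by move=> n; apply/measurable_EFinP; exact: (ig_mf (hn n).1).
  - by move=> n x _; rewrite /g lee_fin; case: ifP.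
  - move=> x _ m n mn; rewrite /g lee_fin.
    by case: ifP => [/(Pm _ _ _ mn) -> //|_]; case: ifP.
apply: lime_le; last first.
  by near=> n; rewrite -I_EFin ?lee_fin; [apply: (hn n).2|apply: (hn n).1].
apply: ereal_nondecreasing_is_cvgn => m n mn; apply: ge0_le_integral => //.
- by move=> x _; rewrite /g lee_fin; case: ifP.
- by apply/measurable_EFinP; exact: (ig_mf (hn m).1).
- by apply/measurable_EFinP; exact: (ig_mf (hn n).1).
- move=> x _; rewrite /g lee_fin.
  by case: ifP => [/(Pm _ _ _ mn) -> //|_]; case: ifP.
Unshelve. all: by end_near. Qed.

Lemma I_dct (F : nat -> T -> R) f g : (forall n, mf (F n)) -> mf f -> ig mu g ->
  {ae mu, forall x, F n x @[n --> \oo] --> f x} ->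
  {ae mu, forall x, forall n, `|F n x| <= g x} ->
  \int[mu]_x F n x @[n --> \oo] --> \int[mu]_x f x.
Proof.
move=> mF hf hg cF bF.
have mF' n : measurable_fun setT (fun x => (F n x)%:E).
  exact/measurable_EFinP.
have mf' : measurable_fun setT (EFin \o f) by exact/measurable_EFinP.
have c' : {ae mu, forall x, setT x -> (F n x)%:E @[n --> \oo] --> (EFin \o f) x}.
  by apply: filterS cF => x h _; apply: cvg_EFin => //; near=> n.
have b' : {ae mu, forall x n, setT x -> (`|(F n x)%:E| <= (EFin \o g) x)%E}.
  by apply: filterS bF => x h n _ /=; rewrite lee_fin.
have [h1 h2 h3] := dominated_convergence measurableT mF' mf' c' hg b'.
have hF n : ig mu (F n).
    apply: (@ig_ae_eq (fun x => if `|F n x| <= g x then F n x else 0)).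
    + exact: mF.
    + apply: (@ig_le _ (fun x => `|g x|)); last first.
      * by move=> x; case: ifP => h; rewrite ?normr0// (le_trans h)// ler_norm.
      * exact: ig_abs.
      * apply: measurable_fun_ifT => //.
        apply: measurable_fun_ler; last exact: (ig_mf hg).
        by apply: measurableT_comp.
    + by apply: filterS bF => x h; rewrite h.
  have h : (fun n => (\int[mu]_x F n x)%:E) @ \oo --> (\int[mu]_x f x)%:E.
    rewrite I_EFin//; apply: cvg_trans h3; apply: near_eq_cvg.
    by near=> n; rewrite I_EFin.
  exact: fine_cvg h.
Unshelve. all: by end_near. Qed.

End RealIntegral.

(** * Product measures *)

Section ProductIntegral.
Context d1 d2 (T1 : measurableType d1) (T2 : measurableType d2) (R : realType).
Variable m1 : {sigma_finite_measure set T1 -> \bar R}.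
Variable m2 : {sigma_finite_measure set T2 -> \bar R}.
Implicit Types F : T1 * T2 -> R.

Lemma mf_sec1 F x : mf F -> mf (fun y => F (x, y)).
Proof. by move=> mF; apply: measurableT_comp => //; exact: pair1_measurable. Qed.

Lemma mf_sec2 F y : mf F -> mf (fun x => F (x, y)).
Proof. by move=> mF; apply: measurableT_comp => //; exact: pair2_measurable. Qed.

Lemma mf_int2 F : mf F -> mf (fun x => \int[m2]_y F (x, y)).
Proof.
move=> mF; rewrite /Rintegral; apply: measurableT_comp => //.
have e x : (\int[m2]_y (F (x, y))%:E = \int[m2]_y (EFin \o F)^\+ (x, y)
     - \int[m2]_y (EFin \o F)^\- (x, y))%E.
  by rewrite integralE funepos.unlock funeneg.unlock.
under eq_fun do rewrite e.
apply: emeasurable_funB.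
- apply: measurable_fun_fubini_tonelli_F => //.
  exact/measurable_funepos/measurable_EFinP.
- apply: measurable_fun_fubini_tonelli_F => //.
  exact/measurable_funeneg/measurable_EFinP.
Qed.

Lemma mf_int1 F : mf F -> mf (fun y => \int[m1]_x F (x, y)).
Proof.
move=> mF; rewrite /Rintegral; apply: measurableT_comp => //.
have e y : (\int[m1]_x (F (x, y))%:E = \int[m1]_x (EFin \o F)^\+ (x, y)
     - \int[m1]_x (EFin \o F)^\- (x, y))%E.
  by rewrite integralE funepos.unlock funeneg.unlock.
under eq_fun do rewrite e.
apply: emeasurable_funB.
- apply: measurable_fun_fubini_tonelli_G => //.
  exact/measurable_funepos/measurable_EFinP.
- apply: measurable_fun_fubini_tonelli_G => //.
  exact/measurable_funeneg/measurable_EFinP.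
Qed.

Lemma ig_prod12 F (h : T1 -> R) : mf F -> (forall x, ig m2 (fun y => F (x, y))) ->
  ig m1 h -> (forall x, \int[m2]_y `|F (x, y)| <= h x) ->
  ig (m1 \x m2)%E F.
Proof.
move=> mF F2 h1 Fh; apply/integrable12ltyP; first exact/measurable_EFinP.
apply: (@le_lt_trans _ _ (\int[m1]_x (h x)%:E)%E); last first.
  by rewrite -I_EFin// ltry.
apply: ge0_le_integral => //.
- by move=> x _; exact: integral_ge0.
- apply: (measurable_fun_fubini_tonelli_F (abse \o (EFin \o F))) => //=.
  by apply: measurableT_comp => //; exact/measurable_EFinP.
- exact: (measurable_int _ h1).
- move=> x _; rewrite (_ : integral _ _ _ = (\int[m2]_y `|F (x, y)|)%:E).
    by rewrite lee_fin.
  by rewrite I_EFin//; exact: ig_abs.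
Qed.

Lemma ig_prod21 F (h : T2 -> R) : mf F -> (forall y, ig m1 (fun x => F (x, y))) ->
  ig m2 h -> (forall y, \int[m1]_x `|F (x, y)| <= h y) ->
  ig (m1 \x m2)%E F.
Proof.
move=> mF F2 h1 Fh; apply/integrable21ltyP; first exact/measurable_EFinP.
apply: (@le_lt_trans _ _ (\int[m2]_x (h x)%:E)%E); last first.
  by rewrite -I_EFin// ltry.
apply: ge0_le_integral => //.
- by move=> x _; exact: integral_ge0.
- apply: (measurable_fun_fubini_tonelli_G (abse \o (EFin \o F))) => //=.
  by apply: measurableT_comp => //; exact/measurable_EFinP.
- exact: (measurable_int _ h1).
- move=> y _; rewrite (_ : integral _ _ _ = (\int[m1]_x `|F (x, y)|)%:E).
    by rewrite lee_fin.
  by rewrite I_EFin//; exact: ig_abs.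
Qed.

Lemma ig_int2 F : ig (m1 \x m2)%E F -> ig m1 (fun x => \int[m2]_y F (x, y)).
Proof.
move=> iF; have mF := ig_mf iF.
have h := integrable_fubini_F iF.
apply/integrableP; split; first exact/measurable_EFinP/mf_int2.
have /integrableP[_] := h; congr (_ < _)%E.
apply: ae_eq_integral => //.
- by apply: measurableT_comp => //; exact: (measurable_int _ h).
- apply: measurableT_comp => //; exact/measurable_EFinP/mf_int2.
- have := ae_integrable1 iF; apply: filterS => x hx _ /=.
  by rewrite -[RHS]/(`|(_%:E)|)%E I_EFin.
Qed.

Lemma I_prod12 F : ig (m1 \x m2)%E F ->
  \int[(m1 \x m2)%E]_q F q = \int[m1]_x \int[m2]_y F (x, y).
Proof.
move=> iF; have mF := ig_mf iF.
rewrite /Rintegral -(integral12_prod_meas1 iF); congr fine.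
apply: ae_eq_integral => //.
- exact: (measurable_fubini_F iF).
- exact/measurable_EFinP/mf_int2.
- by have := ae_integrable1 iF; apply: filterS => x hx _; rewrite -[RHS]/((Rintegral _ _ _)%:E) I_EFin.
Qed.

Lemma I_prod21 F : ig (m1 \x m2)%E F ->
  \int[(m1 \x m2)%E]_q F q = \int[m2]_y \int[m1]_x F (x, y).
Proof.
move=> iF; have mF := ig_mf iF.
rewrite /Rintegral -(integral21_prod_meas1 iF); congr fine.
apply: ae_eq_integral => //.
- exact: (measurable_fubini_G iF).
- exact/measurable_EFinP/mf_int1.
- by have := ae_integrable2 iF; apply: filterS => x hx _; rewrite -[RHS]/((Rintegral _ _ _)%:E) I_EFin.
Qed.

Lemma ig_tensor (f : T1 -> R) (g : T2 -> R) : ig m1 f -> ig m2 g ->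
  ig (m1 \x m2)%E (fun q => f q.1 * g q.2).
Proof.
move=> hf hg.
apply: (@ig_prod12 _ (fun x => (\int[m2]_y `|g y|) * `|f x|)).
- apply: measurable_funM.
    by apply: measurableT_comp; [exact: (ig_mf hf)|exact: measurable_fst].
  by apply: measurableT_comp; [exact: (ig_mf hg)|exact: measurable_snd].
- by move=> x /=; exact: igZ.
- by apply: igZ; exact: ig_abs.
- move=> x /=; rewrite mulrC -I_Z; last exact: ig_abs.
  by rewrite le_eqVlt; apply/orP; left; apply/eqP/I_eq => y; rewrite normrM.
Qed.

Lemma I_tensor (f : T1 -> R) (g : T2 -> R) : ig m1 f -> ig m2 g ->
  \int[(m1 \x m2)%E]_q (f q.1 * g q.2) = \int[m1]_x f x * \int[m2]_y g y.
Proof.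
move=> hf hg; rewrite I_prod12; last exact: ig_tensor.
transitivity (\int[m1]_x ((\int[m2]_y g y) * f x)).
  by apply: I_eq => x /=; rewrite I_Z// mulrC.
by rewrite I_Z// mulrC.
Qed.

End ProductIntegral.

Section ProductSwap.
Context d1 d2 (T1 : measurableType d1) (T2 : measurableType d2) (R : realType).
Variable m1 : {sigma_finite_measure set T1 -> \bar R}.
Variable m2 : {sigma_finite_measure set T2 -> \bar R}.
Implicit Types F : T1 * T2 -> R.

Lemma ig_prod_swap F : ig (m1 \x m2)%E F ->
  ig (m2 \x m1)%E (fun q => F (q.2, q.1)).
Proof.
move=> iF; have mF := ig_mf iF.
have mS : mf (fun q : T2 * T1 => F (q.2, q.1)).
  by apply: measurableT_comp => //; exact: measurable_swap.
apply/integrable12ltyP; first exact/measurable_EFinP.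
by have /integrable21ltyP := iF; apply; exact/measurable_EFinP.
Qed.

End ProductSwap.

Section Swap.
Context d (T : measurableType d) (R : realType).
Variable m : {sigma_finite_measure set T -> \bar R}.
Implicit Types F : T * T -> R.

Lemma I_swap F : ig (m \x m)%E F ->
  \int[(m \x m)%E]_q F (q.2, q.1) = \int[(m \x m)%E]_q F q.
Proof. by move=> iF; rewrite I_prod12 ?I_prod21//; exact: ig_prod_swap. Qed.

End Swap.

Section Triple.
Context d1 d2 d3 (T1 : measurableType d1) (T2 : measurableType d2)
  (T3 : measurableType d3) (R : realType).
Variable m1 : {sigma_finite_measure set T1 -> \bar R}.
Variable m2 : {sigma_finite_measure set T2 -> \bar R}.
Variable m3 : {sigma_finite_measure set T3 -> \bar R}.

Lemma prod_sigma_finite : sigma_finite setT (m2 \x m3)%E.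
Proof.
have /sigma_finiteP[F [TF ndF Foo]] := sigma_finiteT m2.
have /sigma_finiteP[G [TG ndG Goo]] := sigma_finiteT m3.
exists (fun n => F n `*` G n) => [|n].
  apply/seteqP; split => // -[x y] _.
  have [n _ xn] : (\bigcup_n F n) x by rewrite -TF.
  have [m _ ym] : (\bigcup_n G n) y by rewrite -TG.
  exists (maxn n m) => //; split => /=.
    by have /subsetPset := ndF _ _ (leq_maxl n m); apply.
  by have /subsetPset := ndG _ _ (leq_maxr n m); apply.
have [mF oF] := Foo n; have [mG oG] := Goo n.
split; first exact: measurableX.
by rewrite product_measure1E// lte_mul_pinfty// ge0_fin_numE.
Qed.

Definition prod_sfin_ := Measure_isSigmaFinite.Build _ _ _ (m2 \x m3)%E
  prod_sigma_finite.

(** The product of two sigma-finite measures as a sigma-finite measure, which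
    allows the product lemmas to be iterated. *)
Definition prod_sfin : {sigma_finite_measure set (T2 * T3)%type -> \bar R} :=
  HB.pack (m2 \x m3)%E prod_sfin_.

Lemma mf_int23 (F : T1 * (T2 * T3) -> R) : mf F ->
  mf (fun x => \int[(m2 \x m3)%E]_q F (x, q)).
Proof. by move=> mF; exact: (@mf_int2 _ _ _ _ _ prod_sfin F mF). Qed.

Lemma fubini3 (F : T1 * (T2 * T3) -> R) (h : T2 * T3 -> R) : mf F ->
  (forall q, ig m1 (fun x => F (x, q))) -> ig (m2 \x m3)%E h ->
  (forall q, \int[m1]_x `|F (x, q)| <= h q) ->
  [/\ {ae m1, forall x, ig (m2 \x m3)%E (fun q => F (x, q))},
     ig m1 (fun x => \int[(m2 \x m3)%E]_q F (x, q)) &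
     \int[m1]_x \int[(m2 \x m3)%E]_q F (x, q) =
     \int[(m2 \x m3)%E]_q \int[m1]_x F (x, q)].
Proof.
move=> mF F1 hh Fh.
have iF : ig (m1 \x prod_sfin)%E F by exact: (@ig_prod21 _ _ _ _ _ m1 prod_sfin F h mF F1 hh Fh).
split; first exact: (ae_integrable1 iF).
  exact: (ig_int2 iF).
by have := I_prod12 iF; rewrite (I_prod21 iF).
Qed.

End Triple.

(** * Weights, breakage models and their functionals *)

Section Comp.
Context d1 d2 d3 (T1 : measurableType d1) (T2 : measurableType d2)
  (T3 : measurableType d3).
Lemma mf_fst (f : T1 -> T3) : mf f -> mf (fun q : T1 * T2 => f q.1).
Proof. by move=> hf; exact: (measurableT_comp hf measurable_fst). Qed.
Lemma mf_snd (f : T2 -> T3) : mf f -> mf (fun q : T1 * T2 => f q.2).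
Proof. by move=> hf; exact: (measurableT_comp hf measurable_snd). Qed.
End Comp.

Notation mf1 f := (@measurable_fun _ _ (measurableTypeR _) _ setT f).
Notation mf2 F := (@measurable_fun _ _ (measurableTypeR _ * measurableTypeR _)%type _ setT F).
Notation mf3 F := (@measurable_fun _ _ (measurableTypeR _ * (measurableTypeR _ * measurableTypeR _))%type _ setT F).

Section Weights.
Context {R : realType}.
Variable beta : R.
Hypothesis beta0 : 0 <= beta.
Hypothesis beta1 : beta <= 1.

Definition kap (x : R) : R := 1 + `|x| `^ beta.
Definition wt (x : R) : R := 1 + `|x|.
Definition Wt (x : R) : R := 1 + `|x| `^ (1 + beta).

Lemma kap_ge1 x : 1 <= kap x.
Proof. by rewrite /kap lerDl powR_ge0. Qed.

Lemma wt_ge1 x : 1 <= wt x.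
Proof. by rewrite /wt lerDl. Qed.

Lemma Wt_ge1 x : 1 <= Wt x.
Proof. by rewrite /Wt lerDl powR_ge0. Qed.

Lemma powR_le1D (a r : R) : 0 <= a -> 0 <= r <= 1 -> a `^ r <= 1 + a.
Proof.
move=> a0 /andP[r0 r1]; have [a1|a1] := leP a 1.
  apply: (@le_trans _ _ 1); last by rewrite lerDl.
  have <- : (1 : R) `^ r = 1 by rewrite powR1.
  by rewrite ge0_ler_powR// nnegrE.
apply: (@le_trans _ _ a); last by rewrite lerDr.
by rewrite -[leRHS]powRr1// ler_powR// ltW.
Qed.

Lemma powR_le_mid (a r s : R) : 0 <= a -> 0 <= r <= s -> a `^ r <= 1 + a `^ s.
Proof.
move=> a0 /andP[r0 rs]; have [a1|a1] := leP a 1.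
  apply: (@le_trans _ _ 1); last by rewrite lerDl powR_ge0.
  have <- : (1 : R) `^ r = 1 by rewrite powR1.
  by rewrite ge0_ler_powR// nnegrE.
apply: (@le_trans _ _ (a `^ s)); last by rewrite lerDr.
by rewrite ler_powR// ltW.
Qed.

Lemma kap_le_wt x : kap x <= 2 * wt x.
Proof.
have := @powR_le1D `|x| beta (normr_ge0 x); rewrite beta0 beta1 => /(_ isT).
have := normr_ge0 x; rewrite /kap /wt; lra.
Qed.

Lemma powRD1 (a r : R) : 0 <= a -> 0 <= r -> a `^ (1 + r) = a * a `^ r.
Proof.
move=> a0 r0; rewrite powRD ?powRr1//.
by apply/implyP => /eqP; lra.
Qed.

(** This is why moments of order [1 + beta] suffice: the kernel grows like [kap]
    in each variable, and the estimates multiply it by the weight [wt] of one of them. *)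
Lemma kapwt_le_Wt x : kap x * wt x <= 4 * Wt x.
Proof.
have h1 := @powR_le_mid `|x| 1 (1 + beta) (normr_ge0 x).
have h2 := @powR_le_mid `|x| beta (1 + beta) (normr_ge0 x).
have {h1} := h1 _; rewrite ler01 lerDl beta0 powRr1// => /(_ isT) h1.
have {h2} := h2 _; rewrite beta0 lerDr ler01 => /(_ isT) h2.
move: h1 h2; rewrite /kap /wt /Wt powRD1//.
by move: (`|x|) (`|x| `^ beta) => a c h1 h2; nra.
Qed.

Lemma mf_absR : mf1 (fun x : R => `|x|).
Proof. exact: normr_measurable. Qed.

Lemma mf_powabs r : mf1 (fun x : R => `|x| `^ r).
Proof. by apply: (measurableT_comp (measurable_powR r)); exact: mf_absR. Qed.

Lemma mf_kap : mf1 kap.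
Proof. by apply: measurable_funD => //; exact: mf_powabs. Qed.

Lemma mf_wt : mf1 wt.
Proof. by apply: measurable_funD => //; exact: mf_absR. Qed.

Lemma mf_Wt : mf1 Wt.
Proof. by apply: measurable_funD => //; exact: mf_powabs. Qed.

End Weights.

Section Model.
Context {R : realType}.
Local Notation mu := (@lebesgue_measure R).
Local Notation P := (mu \x mu)%E.

(** The kernel and the daughter distribution extended by zero, so that all
    integrals are over the whole line. The field [bet_conv] is the form in which
    the separate breakage of the two colliding particles enters the proof: the
    pieces of [x] are smaller than [x], where [th] is smaller than [th x]. *)
Record breakage_model (beta beta0 : R) (k : R * R -> R) (bet : R * (R * R) -> R)
    : Prop := BreakageModel {
  beta_ge0 : 0 <= beta;
  beta_le1 : beta <= 1;
  beta0_gt2 : 2 < beta0;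
  k_mf : mf2 k;
  k_ge0 : forall q, 0 <= k q;
  k_supp : forall q, ~~ ((0 < q.1) && (0 < q.2)) -> k q = 0;
  k_sym : forall x y, k (x, y) = k (y, x);
  k_le : forall q, k q <= 2 * kap beta q.1 * kap beta q.2;
  bet_mf : mf3 bet;
  bet_ge0 : forall p, 0 <= bet p;
  bet_supp : forall z q, ~~ ((0 < q.1) && (0 < q.2)) -> bet (z, q) = 0;
  bet_sym : forall z x y, bet (z, (x, y)) = bet (z, (y, x));
  bet_pos : forall z q, z <= 0 -> bet (z, q) = 0;
  bet_max : forall z q, Num.max q.1 q.2 <= z -> bet (z, q) = 0;
  bet_num_ig : forall q, ig mu (fun z => bet (z, q));
  bet_num : forall q, \int[mu]_z bet (z, q) <= beta0;
  bet_mass : forall q, 0 < q.1 -> 0 < q.2 ->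
    \int[mu]_z (z * bet (z, q)) = q.1 + q.2;
  bet_conv : forall (th : R -> R) q, mf1 th -> (forall z, 0 <= th z) ->
    (forall z z', 0 < z -> z <= z' -> th z <= th z') -> 0 < q.1 -> 0 < q.2 ->
    \int[mu]_z (z * th z * bet (z, q)) <= q.1 * th q.1 + q.2 * th q.2 }.

Variables (beta beta0 : R) (k : R * R -> R) (bet : R * (R * R) -> R).
Hypothesis M : breakage_model beta beta0 k bet.

Let b0 := beta_ge0 M.
Let b1 := beta_le1 M.
Let b2 := beta0_gt2 M.

Local Notation kap := (kap beta).
Local Notation wt := (@wt R).
Local Notation Wt := (Wt beta).

Implicit Types (f g u v phi : R -> R) (rho c A : R) (q : R * R).

Definition state (f : R -> R) : Prop :=
  [/\ mf1 f, forall x, 0 <= f x, forall x, x <= 0 -> f x = 0 &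
      ig mu (fun x => Wt x * f x)].

Definition gainw (phi : R -> R) (q : R * R) : R :=
  \int[mu]_z (phi z * bet (z, q)).

(** Net change, in one collision, of the sum of [phi] over all particles. *)
Definition zet (phi : R -> R) (q : R * R) : R :=
  gainw phi q - phi q.1 - phi q.2.

(** The right-hand side of the weak formulation; bounded tests and finite weighted
    moments make it absolutely convergent. *)
Definition Q (phi f : R -> R) : R :=
  2^-1 * \int[P]_q (zet phi q * k q * f q.1 * f q.2).

Lemma ig_Wt_le (f v : R -> R) (c : R) : mf1 f -> mf1 v ->
  ig mu (fun x => Wt x * `|f x|) -> (forall x, `|v x| <= c * Wt x) ->
  ig mu (fun x => v x * f x).
Proof.
move=> hf hv hi hle; apply: (ig_le _ (igZ c hi)); first exact: measurable_funM.
by move=> x; rewrite normrM mulrA ler_wpM2r.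
Qed.

Lemma kap_le4 x : `|kap x| <= 4 * Wt x.
Proof.
have := kapwt_le_Wt b0 x; have := kap_ge1 beta x; have := wt_ge1 x.
rewrite ger0_norm; last by rewrite (le_trans _ (kap_ge1 beta x)).
by move=> h1 h2 h3; nra.
Qed.

Lemma wt_le4 x : `|wt x| <= 4 * Wt x.
Proof.
have := kapwt_le_Wt b0 x; have := kap_ge1 beta x; have := wt_ge1 x.
rewrite ger0_norm; last by rewrite (le_trans _ (wt_ge1 x)).
by move=> h1 h2 h3; nra.
Qed.

Lemma kapwt_le4 x : `|kap x * wt x| <= 4 * Wt x.
Proof.
rewrite ger0_norm; first exact: kapwt_le_Wt.
by rewrite mulr_ge0// (le_trans _ (kap_ge1 beta x), le_trans _ (wt_ge1 x)).
Qed.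

(** Differences of states: they obey the same integrability but lose the sign. *)
Definition sstate (f : R -> R) : Prop :=
  [/\ mf1 f, forall x, x <= 0 -> f x = 0 & ig mu (fun x => Wt x * `|f x|)].

Lemma state_sstate f : state f -> sstate f.
Proof.
move=> [h1 h2 h3 h4]; split=> //.
by under eq_fun do rewrite ger0_norm//.
Qed.

Lemma sstate_abs f : sstate f -> sstate (fun x => `|f x|).
Proof.
move=> [h1 h2 h3]; split.
- by apply: measurableT_comp.
- by move=> x /h2 ->; rewrite normr0.
- by under eq_fun do rewrite normr_id.
Qed.

Lemma sstateD f g : sstate f -> sstate g -> sstate (fun x => f x + g x).
Proof.
move=> [f1 f2 f3] [g1 g2 g3]; split.
- exact: measurable_funD.
- by move=> x x0; rewrite f2// g2// addr0.
- apply: (ig_le _ (igD f3 g3)).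
    apply: measurable_funM; first exact: mf_Wt.
    by apply: measurableT_comp => //; exact: measurable_funD.
  move=> x; rewrite normrM normr_id ger0_norm.
    rewrite -mulrDr ler_wpM2l ?ler_normD//.
    by rewrite (le_trans _ (Wt_ge1 beta x)).
  by rewrite (le_trans _ (Wt_ge1 beta x)).
Qed.

Lemma sstateZ c f : sstate f -> sstate (fun x => c * f x).
Proof.
move=> [f1 f2 f3]; split.
- exact: measurable_funM.
- by move=> x x0; rewrite f2// mulr0.
- apply: (ig_le _ (igZ `|c| f3)).
    apply: measurable_funM; first exact: mf_Wt.
    by apply: measurableT_comp => //; exact: measurable_funM.
  move=> x; rewrite normrM normr_id normrM ger0_norm.
    by rewrite mulrCA.
  by rewrite (le_trans _ (Wt_ge1 beta x)).
Qed.

Lemma sstateB f g : sstate f -> sstate g -> sstate (fun x => f x - g x).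
Proof.
move=> hf /(sstateZ (-1)) /(sstateD hf).
by under eq_fun do rewrite mulN1r.
Qed.

Lemma sstate_ig f v c : sstate f -> mf1 v -> (forall x, `|v x| <= c * Wt x) ->
  ig mu (fun x => v x * f x).
Proof. by move=> [h1 h2 h3] hv; exact: ig_Wt_le. Qed.

Lemma sstate_bd f phi rho : sstate f -> mf1 phi -> (forall x, `|phi x| <= rho) ->
  ig mu (fun x => phi x * f x).
Proof.
move=> hf hphi hrho; apply: (@sstate_ig _ _ `|rho|) => // x.
apply: (le_trans (hrho x)); apply: (le_trans (ler_norm _)).
by rewrite ler_peMr// Wt_ge1.
Qed.

Lemma sstate_1 f : sstate f -> ig mu f.
Proof.
move=> hf; have := @sstate_bd f (cst 1) 1 hf.
under eq_fun do rewrite mul1r; apply=> //.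
by move=> x; rewrite /= normr1.
Qed.

Lemma sstate_kap f : sstate f -> ig mu (fun x => kap x * f x).
Proof. by move=> hf; exact: (sstate_ig hf (mf_kap _) kap_le4). Qed.

Lemma sstate_wt f : sstate f -> ig mu (fun x => wt x * f x).
Proof. by move=> hf; exact: (sstate_ig hf (mf_wt) wt_le4). Qed.

Lemma sstate_kapwt f : sstate f -> ig mu (fun x => kap x * wt x * f x).
Proof.
move=> hf; apply: (sstate_ig hf _ kapwt_le4).
by apply: measurable_funM; [exact: mf_kap|exact: mf_wt].
Qed.

Lemma sstate_Wt f : sstate f -> ig mu (fun x => Wt x * f x).
Proof.
move=> hf; apply: (sstate_ig hf (mf_Wt _) (c := 1)) => x; rewrite mul1r ger0_norm//.
by rewrite (le_trans _ (Wt_ge1 beta x)).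
Qed.

Lemma state_I_le4 f v A : state f -> mf1 v -> (forall x, `|v x| <= 4 * Wt x) ->
  \int[mu]_x (Wt x * f x) <= A -> \int[mu]_x (v x * f x) <= 4 * A.
Proof.
move=> hf hv hle hA; have hs := state_sstate hf; have [_ f0 _ _] := hf.
apply: (@le_trans _ _ (\int[mu]_x (4 * (Wt x * f x)))).
  apply: I_le; first exact: (sstate_ig hs hv hle).
    exact/igZ/sstate_Wt.
  move=> x; rewrite mulrA ler_wpM2r//; exact: le_trans (ler_norm _) (hle x).
by rewrite I_Z; [lra|exact: sstate_Wt].
Qed.

(** A tensor-product majorant reduces a double collision integral to the product of
    two moments. *)
Lemma coll_dom (F : R * R -> R) (a c : R -> R) : mf2 F ->
  ig mu a -> ig mu c -> (forall q, `|F q| <= a q.1 * c q.2) ->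
  ig P F /\ `|\int[P]_q F q| <= \int[mu]_x a x * \int[mu]_y c y.
Proof.
move=> mF ha hc hF; have hi := ig_tensor ha hc.
have iF : ig P F by apply: (ig_le mF hi).
by split=> //; rewrite -I_tensor//; apply: I_abs_le.
Qed.

Lemma mf_gainw phi : mf1 phi -> mf2 (gainw phi).
Proof.
move=> hphi; rewrite /gainw.
apply: (@mf_int1 _ _ _ _ R mu (fun p : measurableTypeR R * (measurableTypeR R * measurableTypeR R) => phi p.1 * bet p)).
by apply: measurable_funM; [exact: mf_fst|exact: bet_mf M].
Qed.

Lemma mf_zet phi : mf1 phi -> mf2 (zet phi).
Proof.
move=> hphi; apply: measurable_funB; last exact: mf_snd.
by apply: measurable_funB; [exact: mf_gainw|exact: mf_fst].
Qed.

Lemma bet_sec_mf q : mf1 (fun z => bet (z, q)).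
Proof. exact: ig_mf (bet_num_ig M q). Qed.

Lemma gain_ig phi rho q : mf1 phi -> (forall x, `|phi x| <= rho) ->
  ig mu (fun z => phi z * bet (z, q)).
Proof.
move=> hphi hrho; apply: (ig_le _ (igZ rho (bet_num_ig M q))).
  by apply: measurable_funM => //; exact: bet_sec_mf.
by move=> x; rewrite normrM [`|bet _|]ger0_norm ?(bet_ge0 M)// ler_wpM2r// (bet_ge0 M).
Qed.

Lemma gainw_le_rho phi rho q : mf1 phi -> (forall x, `|phi x| <= rho) ->
  `|gainw phi q| <= rho * beta0.
Proof.
move=> hphi hrho.
have r0 : 0 <= rho by rewrite (le_trans _ (hrho 0)).
apply: (@le_trans _ _ (\int[mu]_z (rho * bet (z, q)))).
  apply: I_abs_le; first exact: gain_ig hrho.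
    exact/igZ/(bet_num_ig M).
  by move=> x; rewrite normrM [`|bet _|]ger0_norm ?(bet_ge0 M)// ler_wpM2r// (bet_ge0 M).
rewrite I_Z; last exact: (bet_num_ig M).
by rewrite ler_wpM2l// (bet_num M).
Qed.

Lemma zet_le_rho phi rho q : mf1 phi -> (forall x, `|phi x| <= rho) ->
  `|zet phi q| <= rho * (beta0 + 2).
Proof.
move=> hphi hrho; have := gainw_le_rho q hphi hrho.
have := hrho q.1; have := hrho q.2; rewrite /zet.
move=> h1 h2 h3; apply: (le_trans (ler_normB _ _)).
have := ler_normB (gainw phi q) (phi q.1); lra.
Qed.

Lemma zmass_ig q : ig mu (fun z => z * bet (z, q)).
Proof.
set m := `|Num.max q.1 q.2|.
apply: (ig_le _ (igZ m (bet_num_ig M q))).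
  by apply: measurable_funM => //; exact: bet_sec_mf.
move=> z; rewrite normrM [`|bet _|]ger0_norm ?(bet_ge0 M)//.
have [z0|z0] := leP z 0; first by rewrite (bet_pos M)// !mulr0.
have [zm|zm] := leP (Num.max q.1 q.2) z; first by rewrite (bet_max M)// !mulr0.
rewrite ler_wpM2r ?(bet_ge0 M)// (gtr0_norm z0).
by rewrite (le_trans (ltW zm))// /m ler_norm.
Qed.

Lemma gainw_le_wt phi q : mf1 phi -> (forall x, `|phi x| <= wt x) ->
  0 < q.1 -> 0 < q.2 -> `|gainw phi q| <= beta0 + q.1 + q.2.
Proof.
move=> hphi hw q1 q2.
have hi : ig mu (fun z => bet (z, q) + z * bet (z, q)).
  by apply: igD; [exact: (bet_num_ig M)|exact: zmass_ig].
have hle z : `|phi z * bet (z, q)| <= bet (z, q) + z * bet (z, q).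
  have [z0|z0] := leP z 0; first by rewrite (bet_pos M)// !mulr0 normr0 addr0.
  rewrite normrM [`|bet _|]ger0_norm ?(bet_ge0 M)// -{2}[bet _]mul1r -mulrDl.
  rewrite ler_wpM2r ?(bet_ge0 M)//.
  by rewrite (le_trans (hw z))// /wt ger0_norm// ltW.
apply: (@le_trans _ _ (\int[mu]_z (bet (z, q) + z * bet (z, q)))).
  apply: I_abs_le => //; apply: (ig_le _ hi hle).
  by apply: measurable_funM => //; exact: bet_sec_mf.
rewrite I_D; [|exact: (bet_num_ig M)|exact: zmass_ig].
by rewrite (bet_mass M)//; have := bet_num M q; lra.
Qed.

Lemma zet_le_wt phi q : mf1 phi -> (forall x, `|phi x| <= wt x) ->
  0 < q.1 -> 0 < q.2 -> `|zet phi q| <= (beta0 + 2) * (wt q.1 * wt q.2).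
Proof.
move=> hphi hw q1 q2; have h0 := gainw_le_wt hphi hw q1 q2.
have h1 := hw q.1; have h2 := hw q.2; move: h1 h2.
rewrite /wt (ger0_norm (ltW q1)) (ger0_norm (ltW q2)) => h1 h2.
have h3 := ler_normB (gainw phi q - phi q.1) (phi q.2).
have h4 := ler_normB (gainw phi q) (phi q.1).
rewrite /zet; have h5 : 0 <= q.1 * q.2 by rewrite mulr_ge0 ?ltW.
apply: (@le_trans _ _ (beta0 + 2 + 2 * q.1 + 2 * q.2)); first lra.
have := b2; nra.
Qed.

(** Bounds on the test are needed on the positive quadrant only, as the kernel
    vanishes elsewhere. *)
Lemma coll_bound (Z : R * R -> R) (u v a c : R -> R) :
  (forall q, 0 < q.1 -> 0 < q.2 -> `|Z q| <= a q.1 * c q.2) ->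
  (forall x, 0 <= a x) -> (forall x, 0 <= c x) ->
  forall q, `|Z q * k q * u q.1 * v q.2| <=
    (2 * (a q.1 * (kap q.1 * `|u q.1|))) * (c q.2 * (kap q.2 * `|v q.2|)).
Proof.
move=> hZ a0 c0 q; rewrite !normrM (ger0_norm (k_ge0 M q)).
have kp x : 0 <= kap x by rewrite (le_trans _ (kap_ge1 beta x)).
have [/andP[q1 q2]|/(k_supp M) ->] := boolP ((0 < q.1) && (0 < q.2)).
  have := hZ q q1 q2; have := k_le M q => h1 h2.
  rewrite [leRHS](_ : _ = (a q.1 * c q.2) * (2 * kap q.1 * kap q.2) * `|u q.1| * `|v q.2|).
    rewrite ler_wpM2r// ler_wpM2r// ler_pM// (k_ge0 M)//.
  by ring.
rewrite mulr0 !mul0r !mulr_ge0//.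
Qed.

Lemma mf_coll (Z : R * R -> R) (u v : R -> R) : mf2 Z -> mf1 u -> mf1 v ->
  mf2 (fun q => Z q * k q * u q.1 * v q.2).
Proof.
move=> hZ hu hv; apply: measurable_funM; last exact: mf_snd.
apply: measurable_funM; last exact: mf_fst.
by apply: measurable_funM => //; exact: k_mf M.
Qed.

Lemma coll_ig_rho (Z : R * R -> R) (u v : R -> R) rho : mf2 Z ->
  (forall q, `|Z q| <= rho) -> sstate u -> sstate v ->
  ig P (fun q => Z q * k q * u q.1 * v q.2) /\
  `|\int[P]_q (Z q * k q * u q.1 * v q.2)| <=
    2 * rho * \int[mu]_x (kap x * `|u x|) * \int[mu]_x (kap x * `|v x|).
Proof.
move=> hZ hrho hu hv.
have r0 : 0 <= rho by rewrite (le_trans _ (hrho (0, 0))).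
have hb := @coll_bound Z u v (fun=> rho) (fun=> 1) _ (fun=> r0) (fun=> ler01).
have {}hrho q : 0 < q.1 -> 0 < q.2 -> `|Z q| <= rho * 1 by rewrite mulr1.
have [mu1 _ _] := hu; have [mv1 _ _] := hv.
have iu := sstate_kap (sstate_abs hu); have iv := sstate_kap (sstate_abs hv).
have [||h1 h2] := @coll_dom _ (fun x => 2 * (rho * (kap x * `|u x|)))
  (fun x => 1 * (kap x * `|v x|)) (mf_coll hZ mu1 mv1) _ _ (hb hrho).
- exact/igZ/igZ.
- exact/igZ.
split=> //; apply: (le_trans h2); rewrite !I_Z//=; last exact: igZ.
by rewrite mul1r !mulrA.
Qed.

Lemma Q_ig phi rho f : mf1 phi -> (forall x, `|phi x| <= rho) -> sstate f ->
  ig P (fun q => zet phi q * k q * f q.1 * f q.2).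
Proof.
move=> hphi hrho hf.
have [] := coll_ig_rho (mf_zet hphi) (fun q => zet_le_rho q hphi hrho) hf hf.
by [].
Qed.

Lemma zet_sym phi x y : zet phi (x, y) = zet phi (y, x).
Proof.
rewrite /zet /= (_ : gainw phi (x, y) = gainw phi (y, x)); first by ring.
by apply: I_eq => z; rewrite (bet_sym M).
Qed.

(** Polarisation of the quadratic functional. By the symmetry of the collision
    integrand every difference can be moved into the second variable, which is
    where the sign of the test is exploited. *)
Lemma Q_diff phi rho f g : mf1 phi -> (forall x, `|phi x| <= rho) ->
  sstate f -> sstate g ->
  Q phi f - Q phi g =
  2^-1 * \int[P]_q (zet phi q * k q * (f q.1 + g q.1) * (f q.2 - g q.2)).
Proof.
move=> hphi hrho hf hg.
have hz := fun q => zet_le_rho q hphi hrho; have mz := mf_zet hphi.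
have ff := Q_ig hphi hrho hf; have gg := Q_ig hphi hrho hg.
have [fg _] := coll_ig_rho mz hz hf hg.
have [gf _] := coll_ig_rho mz hz hg hf.
have e : \int[P]_q (zet phi q * k q * f q.1 * g q.2) =
         \int[P]_q (zet phi q * k q * g q.1 * f q.2).
  rewrite -(I_swap fg); apply: I_eq => -[x y] /=.
  by rewrite (zet_sym phi y x) (k_sym M y x); ring.
rewrite /Q -mulrBr; congr (_ * _).
transitivity (\int[P]_q (
    (zet phi q * k q * f q.1 * f q.2 - zet phi q * k q * g q.1 * g q.2)
    + (zet phi q * k q * g q.1 * f q.2 - zet phi q * k q * f q.1 * g q.2))).
  rewrite I_D ?I_B//; [by rewrite e subrr addr0|exact: igB|exact: igB].
by apply: I_eq => q; ring.
Qed.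

End Model.

(** * Lipschitz and one-sided estimates *)

Lemma add_le8 (R : realFieldType) (a b A : R) : a <= 4 * A -> b <= 4 * A -> a + b <= 8 * A.
Proof. lra. Qed.

Section Estimates.
Context {R : realType}.
Local Notation mu := (@lebesgue_measure R).
Local Notation P := (mu \x mu)%E.
Variables (beta beta0 : R) (k : R * R -> R) (bet : R * (R * R) -> R).
Hypothesis M : breakage_model beta beta0 k bet.

Let b0 := beta_ge0 M.
Let b1 := beta_le1 M.
Let b2 := beta0_gt2 M.

Local Notation kap := (kap beta).
Local Notation wt := (@wt R).
Local Notation Wt := (Wt beta).
Local Notation state := (state beta).
Local Notation sstate := (sstate beta).
Local Notation zet := (zet bet).
Local Notation gainw := (gainw bet).
Local Notation Q := (Q k bet).
Implicit Types (f g u v phi : R -> R) (rho c A : R) (q : R * R).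

Lemma normr_half : `|2^-1 : R| = 2^-1.
Proof. by rewrite gtr0_norm// invr_gt0. Qed.

Definition cut (r : R) v (x : R) : R := if `|x| <= r then v x else 0.
Definition out (r : R) v (x : R) : R := if `|x| <= r then 0 else v x.
Definition sgnf f (x : R) : R := if 0 <= f x then 1 else -1.

Lemma cut_out r v x : v x = cut r v x + out r v x.
Proof. by rewrite /cut /out; case: ifP; rewrite ?addr0 ?add0r. Qed.

Lemma mf_ball (r : R) : measurable_fun setT (fun x : measurableTypeR R => `|x| <= r).
Proof. by apply: measurable_fun_ler => //; exact: mf_absR. Qed.

Lemma mf_cut r v : mf1 v -> mf1 (cut r v).
Proof. by move=> hv; apply: measurable_fun_ifT => //; exact: mf_ball. Qed.

Lemma mf_out r v : mf1 v -> mf1 (out r v).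
Proof. by move=> hv; apply: measurable_fun_ifT => //; exact: mf_ball. Qed.

Lemma mf_sgnf f : mf1 f -> mf1 (sgnf f).
Proof.
move=> hf; apply: measurable_fun_ifT => //.
by apply: measurable_fun_ler.
Qed.

Lemma sgnfM f x : sgnf f x * f x = `|f x|.
Proof.
rewrite /sgnf; case: leP => h; first by rewrite mul1r ger0_norm.
by rewrite mulN1r ltr0_norm.
Qed.

Lemma sgnf_norm f x : `|sgnf f x| = 1.
Proof. by rewrite /sgnf; case: ifP; rewrite ?normrN normr1. Qed.

Lemma wt_ge0 x : 0 <= wt x.
Proof. by rewrite (le_trans _ (wt_ge1 x)). Qed.

Lemma kap_ge0 x : 0 <= kap x.
Proof. by rewrite (le_trans _ (kap_ge1 beta x)). Qed.

Lemma Wt_ge0 x : 0 <= Wt x.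
Proof. by rewrite (le_trans _ (Wt_ge1 beta x)). Qed.

Lemma cut_ge0 r v x : 0 <= v x -> 0 <= cut r v x.
Proof. by rewrite /cut; case: ifP. Qed.

Lemma out_ge0 r v x : 0 <= v x -> 0 <= out r v x.
Proof. by rewrite /out; case: ifP. Qed.

Lemma cut_le r v x : 0 <= v x -> cut r v x <= v x.
Proof. by rewrite /cut; case: ifP. Qed.

Lemma out_le r v x : 0 <= v x -> out r v x <= v x.
Proof. by rewrite /out; case: ifP. Qed.

(** The bounded test that sees a weighted distance. *)
Definition dtest r f (x : R) : R := cut r wt x * sgnf f x.

Lemma mf_dtest r f : mf1 f -> mf1 (dtest r f).
Proof.
move=> hf; apply: measurable_funM; first by apply: mf_cut; exact: mf_wt.
exact: mf_sgnf.
Qed.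

Lemma dtestM r f x : dtest r f x * f x = cut r wt x * `|f x|.
Proof. by rewrite /dtest -mulrA sgnfM. Qed.

Lemma dtest_norm r f x : `|dtest r f x| = cut r wt x.
Proof. by rewrite /dtest normrM sgnf_norm mulr1 ger0_norm// cut_ge0// wt_ge0. Qed.

Lemma dtest_le_wt r f x : `|dtest r f x| <= wt x.
Proof. by rewrite dtest_norm cut_le// wt_ge0. Qed.

Lemma dtest_le_rho r f x : 0 <= r -> `|dtest r f x| <= 1 + r.
Proof.
move=> r0; rewrite dtest_norm /cut /wt; case: ifP => [h|_].
  by rewrite lerD2l.
by rewrite addr_ge0.
Qed.

Lemma state_kap_le f A : state f -> \int[mu]_x (Wt x * f x) <= A ->
  \int[mu]_x (kap x * f x) <= 4 * A.
Proof. by move=> hf; apply: (state_I_le4 hf (mf_kap _)) => x; exact: (kap_le4 M). Qed.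

Lemma I_kap_wt f : sstate f ->
  \int[mu]_x (kap x * `|f x|) <= 2 * \int[mu]_x (wt x * `|f x|).
Proof.
move=> /sstate_abs hf; rewrite -I_Z; last exact: (sstate_wt M hf).
apply: I_le; [exact: (sstate_kap M hf)|exact/igZ/(sstate_wt M hf)|] => x.
by rewrite mulrA ler_wpM2r// (kap_le_wt b0 b1).
Qed.

Lemma I_kap_sum f g A : state f -> state g ->
  \int[mu]_x (Wt x * f x) <= A -> \int[mu]_x (Wt x * g x) <= A ->
  \int[mu]_x (kap x * `|f x + g x|) <= 8 * A.
Proof.
move=> hf hg hA hB; have [_ f0 _ _] := hf; have [_ g0 _ _] := hg.
have sf := state_sstate hf; have sg := state_sstate hg.
rewrite (_ : \int[mu]_x _ = \int[mu]_x (kap x * f x + kap x * g x)).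
  rewrite I_D; [|exact: (sstate_kap M sf)|exact: (sstate_kap M sg)].
  exact: (add_le8 (state_kap_le hf hA) (state_kap_le hg hB)).
by apply: I_eq => x; rewrite ger0_norm ?addr_ge0// mulrDr.
Qed.

(** Bounded tests need no cancellation: [kap <= 2 wt] and the weighted distance
    controls the difference. *)
Lemma Q_lip phi rho f g A : mf1 phi -> (forall x, `|phi x| <= rho) ->
  state f -> state g ->
  \int[mu]_x (Wt x * f x) <= A -> \int[mu]_x (Wt x * g x) <= A ->
  `|Q phi f - Q phi g| <=
    rho * (16 * (beta0 + 2)) * A * \int[mu]_x (wt x * `|f x - g x|).
Proof.
move=> hphi hrho hf hg hA hB.
have sf := state_sstate hf; have sg := state_sstate hg.
have r0 : 0 <= rho by rewrite (le_trans _ (hrho 0)).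
rewrite (Q_diff M hphi hrho sf sg) normrM normr_half.
have [_ h] := coll_ig_rho M (mf_zet M hphi) (fun q => zet_le_rho M q hphi hrho)
  (sstateD sf sg) (sstateB sf sg).
have h1 := I_kap_sum hf hg hA hB; have h2 := I_kap_wt (sstateB sf sg).
have h3 : 0 <= \int[mu]_x (kap x * `|f x + g x|).
  by apply: I_ge0 => x; rewrite mulr_ge0// kap_ge0.
have h4 : 0 <= \int[mu]_x (kap x * `|f x - g x|).
  by apply: I_ge0 => x; rewrite mulr_ge0// kap_ge0.
have h5 := ler_pM h3 h4 h1 h2.
have h6 : 0 <= rho * (beta0 + 2).
  by apply: mulr_ge0 => //; rewrite addr_ge0// ltW// (lt_trans _ b2).
have h7 := ler_wpM2l h6 h5.
apply: le_trans (ler_wpM2l _ h) _; first by rewrite invr_ge0.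
move: h7; rewrite !mulrA; lra.
Qed.

(** A bound that depends on [phi] only through [wt]; it gives the Lipschitz
    continuity in time of solutions for the weighted distance, uniformly in the cut. *)
Lemma Q_bound phi rho f A : mf1 phi -> (forall x, `|phi x| <= rho) ->
  (forall x, `|phi x| <= wt x) -> state f -> \int[mu]_x (Wt x * f x) <= A ->
  `|Q phi f| <= 16 * (beta0 + 2) * (A * A).
Proof.
move=> hphi hrho hw hf hA; have sf := state_sstate hf; have [f1 f0 _ _] := hf.
have hb := @coll_bound _ _ _ _ _ M (zet phi) f f (fun x => (beta0 + 2) * wt x) wt.
have c0 : 0 <= beta0 + 2 by have := b2; lra.
have {}hb : forall q : R * R, `|zet phi q * k q * f q.1 * f q.2| <=
    2 * ((beta0 + 2) * wt q.1 * (kap q.1 * `|f q.1|)) *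
    (wt q.2 * (kap q.2 * `|f q.2|)).
  apply: hb; last exact: wt_ge0.
    by move=> q q1 q2; rewrite -mulrA; apply: (zet_le_wt M).
  by move=> x; rewrite mulr_ge0// wt_ge0.
have e x : (beta0 + 2) * wt x * (kap x * `|f x|) =
    (beta0 + 2) * (kap x * wt x * f x) by rewrite ger0_norm//; ring.
have e' x : wt x * (kap x * `|f x|) = kap x * wt x * f x.
  by rewrite ger0_norm//; ring.
have iw := sstate_kapwt M sf.
have [|||_ h] := coll_dom (F := fun q => zet phi q * k q * f q.1 * f q.2)
   (a := fun x => 2 * ((beta0 + 2) * (kap x * wt x * f x)))
   (c := fun x => kap x * wt x * f x) (mf_coll M (mf_zet M hphi) f1 f1) _ _.
- exact/igZ/igZ.
- exact: iw.
- by move=> q; rewrite -e -e'.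
have w4 : \int[mu]_x (kap x * wt x * f x) <= 4 * A.
  apply: (state_I_le4 hf _ _ hA).
    by apply: measurable_funM; [exact: mf_kap|exact: mf_wt].
  exact: (kapwt_le4 M).
have w0 : 0 <= \int[mu]_x (kap x * wt x * f x).
  by apply: I_ge0 => x; rewrite mulr_ge0// mulr_ge0 ?kap_ge0 ?wt_ge0.
move: h; rewrite !I_Z//; last exact: igZ.
rewrite /Q normrM normr_half.
have := ler_wpM2l c0 (ler_pM w0 w0 w4 w4).
move: (\int[mu]_x _) (`| _ |) => a t H1 H2; lra.
Qed.

(** The cancellation behind uniqueness: the fragments carry the mass [q.1 + q.2],
    and the mass [q.2] is lost, with the right sign, by the second particle. Beyond
    the cut the test misses this loss, whence the second term. *)
Lemma dtest_gain phi f (q : R * R) r : mf1 f -> 0 <= r ->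
  phi = dtest r f -> 0 < q.1 -> 0 < q.2 ->
  zet phi q * f q.2 <=
    ((beta0 + 1) * wt q.1 + out r wt q.2) * `|f q.2|.
Proof.
move=> hf r0 -> q1 q2.
have hw := dtest_le_wt r f.
have h0 := gainw_le_wt M (mf_dtest r hf) hw q1 q2.
have h1 : gainw (dtest r f) q * f q.2 <= (beta0 + q.1 + q.2) * `|f q.2|.
  by apply: le_trans (ler_norm _) _; rewrite normrM ler_wpM2r.
have h2 : - (dtest r f q.1 * f q.2) <= wt q.1 * `|f q.2|.
  by apply: le_trans (ler_norm _) _; rewrite normrN normrM ler_wpM2r.
have h3 := dtestM r f q.2.
have e2 := cut_out r wt q.2.
rewrite /zet !mulrBl h3; move: h1 h2 e2.
rewrite /wt (ger0_norm (ltW q1)) (ger0_norm (ltW q2)) => h1 h2 e2.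
have h4 : 0 <= `|f q.2| by [].
have h5 : 0 <= q.1 * `|f q.2| by rewrite mulr_ge0// ltW.
have := b2 => b2'.
have : 0 <= (beta0 - 2) * (q.1 * `|f q.2|) by rewrite mulr_ge0//; lra.
have : (1 + q.2) * `|f q.2| = cut r wt q.2 * `|f q.2| + out r wt q.2 * `|f q.2|.
  by rewrite -mulrDl -e2.
rewrite /wt; nra.
Qed.

Lemma I_out_wt (h : R -> R) f g r tau : state f -> state g ->
  \int[mu]_x (out r Wt x * f x) <= tau -> \int[mu]_x (out r Wt x * g x) <= tau ->
  mf1 h -> (forall x, 0 <= h x <= 4 * Wt x) ->
  ig mu (fun x => out r h x * `|f x - g x|) /\
  \int[mu]_x (out r h x * `|f x - g x|) <= 8 * tau.
Proof.
move=> hf hg hA hB mh h4; have sf := state_sstate hf; have sg := state_sstate hg.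
have [f1 f0 _ _] := hf; have [g1 g0 _ _] := hg.
have iWf : ig mu (fun x => out r Wt x * f x).
  apply: (sstate_ig sf (c := 1)); first by apply: mf_out; exact: mf_Wt.
  by move=> x; rewrite mul1r ger0_norm ?out_le ?out_ge0 ?Wt_ge0.
have iWg : ig mu (fun x => out r Wt x * g x).
  apply: (sstate_ig sg (c := 1)); first by apply: mf_out; exact: mf_Wt.
  by move=> x; rewrite mul1r ger0_norm ?out_le ?out_ge0 ?Wt_ge0.
have iS := igZ 4 (igD iWf iWg).
have hle x : out r h x * `|f x - g x| <= 4 * (out r Wt x * f x + out r Wt x * g x).
  rewrite /out; case: ifP => _; first by rewrite !mul0r addr0 mulr0.
  rewrite -mulrDr mulrA; have /andP[h1 h2] := h4 x.
  apply: ler_pM => //.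
  have := f0 x; have := g0 x; rewrite ler_norml => h3 h5; lra.
have hi : ig mu (fun x => out r h x * `|f x - g x|).
  apply: (ig_le _ iS).
    apply: measurable_funM; first exact: mf_out.
    by apply: measurableT_comp => //; exact: measurable_funB.
  move=> x; rewrite ger0_norm// mulr_ge0// out_ge0//.
  by have /andP[] := h4 x.
split=> //; apply: le_trans (I_le hi iS hle) _.
rewrite I_Z ?I_D//; last exact: igD.
lra.
Qed.

(** One-sided estimate for the weighted distance, cut at [r]. The growth rate is
    a multiple of the moment bound [A], and the error a multiple of the tail [tau]. *)
Lemma Q_dissip r f g A tau : 0 <= r -> state f -> state g ->
  \int[mu]_x (Wt x * f x) <= A -> \int[mu]_x (Wt x * g x) <= A ->
  \int[mu]_x (out r Wt x * f x) <= tau -> \int[mu]_x (out r Wt x * g x) <= tau ->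
  Q (dtest r (fun x => f x - g x)) f - Q (dtest r (fun x => f x - g x)) g <= 16 * (beta0 + 1) * A *
    (\int[mu]_x (cut r wt x * `|f x - g x|) + 10 * tau).
Proof.
move=> r0 hf hg hA hB hA' hB'; set phi := dtest r _.
have sf := state_sstate hf; have sg := state_sstate hg.
have [f1 f0 _ _] := hf; have [g1 g0 _ _] := hg.
have mE : mf1 (fun x => f x - g x) by exact: measurable_funB.
have mF : mf1 (fun x => f x + g x) by exact: measurable_funD.
have mphi : mf1 phi by exact: mf_dtest.
have hrho x : `|phi x| <= 1 + r by exact: dtest_le_rho.
rewrite (Q_diff M mphi hrho sf sg).
set E := fun x => f x - g x; set F := fun x => f x + g x.
have F0 x : 0 <= F x by rewrite /F addr_ge0.
have sF : sstate F := sstateD sf sg.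
have sE : sstate E := sstateB sf sg.
have saE := sstate_abs sE; have [maE _ _] := saE.
have [iL _] := coll_ig_rho M (mf_zet M mphi) (fun q => zet_le_rho M q mphi hrho) sF sE.
have kw x : 0 <= kap x * wt x <= 4 * Wt x.
  by rewrite (kapwt_le_Wt b0) mulr_ge0// ?kap_ge0 ?wt_ge0.
have k1 x : 0 <= kap x <= 4 * Wt x.
  by rewrite kap_ge0 (le_trans (ler_norm _) (kap_le4 M x)).
have w1 x : 0 <= wt x <= 4 * Wt x.
  by rewrite wt_ge0 (le_trans (ler_norm _) (wt_le4 M x)).
have [iok ok] := I_out_wt hf hg hA' hB' (mf_kap beta) k1.
have [iow ow] := I_out_wt hf hg hA' hB' (@mf_wt R) w1.
have mkw : mf1 (fun x => kap x * wt x).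
  by apply: measurable_funM; [exact: mf_kap|exact: mf_wt].
have [iokw okw] := I_out_wt hf hg hA' hB' mkw kw.
have c0 : 0 <= beta0 + 1 by rewrite addr_ge0// ltW// (lt_trans _ b2).
(* the weight carried by the partner of the particle where [E] is evaluated *)
have m1 : mf2 (fun q : R * R => (beta0 + 1) * wt q.1).
  have mw : mf1 (fun x => (beta0 + 1) * wt x).
    by apply: measurable_funM => //; exact: mf_wt.
  exact: (mf_fst mw).
have [||| i1 l1] := coll_dom
  (F := fun q : R * R => (beta0 + 1) * wt q.1 * k q * F q.1 * `|E q.2|)
  (a := fun x => 2 * ((beta0 + 1) * (kap x * wt x * F x)))
  (c := fun x => kap x * `|E x|) (mf_coll M m1 mF maE) _ _ _.
- exact/igZ/igZ/(sstate_kapwt M sF).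
- exact: (sstate_kap M saE).
- have hb := @coll_bound _ _ _ _ _ M (fun q => (beta0 + 1) * wt q.1) F
    (fun x => `|E x|) (fun x => (beta0 + 1) * wt x) (fun=> 1).
  move=> q; apply: le_trans (hb _ _ _ q) _ => //.
  + by move=> q' _ _; rewrite mulr1 ger0_norm// mulr_ge0// wt_ge0.
  + by move=> x; rewrite mulr_ge0// wt_ge0.
  + rewrite normr_id (ger0_norm (F0 _)) mul1r le_eqVlt; apply/orP; left.
    by apply/eqP; ring.
(* the weight that the cut test fails to remove beyond [r] *)
have m2 : mf2 (fun q : R * R => out r wt q.2).
  exact: (mf_snd (mf_out r (@mf_wt R))).
have [||| i2 l2] := coll_dom
  (F := fun q : R * R => out r wt q.2 * k q * F q.1 * `|E q.2|)
  (a := fun x => 2 * (kap x * F x))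
  (c := fun x => out r (fun y => kap y * wt y) x * `|E x|) (mf_coll M m2 mF maE) _ _ _.
- exact/igZ/(sstate_kap M sF).
- exact: iokw.
- have hb := @coll_bound _ _ _ _ _ M (fun q => out r wt q.2) F
    (fun x => `|E x|) (fun=> 1) (out r wt).
  move=> q; apply: le_trans (hb _ _ _ q) _ => //.
  + by move=> q' _ _; rewrite mul1r ger0_norm// out_ge0// wt_ge0.
  + by move=> x; rewrite out_ge0// wt_ge0.
  + rewrite normr_id (ger0_norm (F0 _)) mul1r le_eqVlt; apply/orP; left.
    by apply/eqP; rewrite /out; case: ifP => _; ring.
have hle : \int[P]_q (zet phi q * k q * F q.1 * E q.2) <=
    \int[P]_q ((beta0 + 1) * wt q.1 * k q * F q.1 * `|E q.2| +
      out r wt q.2 * k q * F q.1 * `|E q.2|).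
  apply: I_le => //; first exact: igD.
  move=> q; have [/andP[q1 q2]|/(k_supp M) ->] := boolP ((0 < q.1) && (0 < q.2)).
    have h := dtest_gain mE r0 (erefl phi) q1 q2.
    have kF : 0 <= k q * F q.1 by rewrite mulr_ge0// (k_ge0 M).
    rewrite [leLHS](_ : _ = k q * F q.1 * (zet phi q * E q.2)); last by ring.
    apply: le_trans (ler_wpM2l kF h) _; rewrite le_eqVlt; apply/orP; left.
    by apply/eqP; rewrite /E; ring.
  by rewrite !(mulr0, mul0r) addr0.
rewrite I_D// in hle.
have D0 : \int[mu]_x (wt x * `|E x|) <= \int[mu]_x (cut r wt x * `|E x|) + 8 * tau.
  apply: (@le_trans _ _ (\int[mu]_x (cut r wt x * `|E x| + out r wt x * `|E x|))).
    rewrite le_eqVlt; apply/orP; left; apply/eqP/I_eq => x.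
    by rewrite -mulrDl -cut_out.
  rewrite I_D//; first by rewrite lerD2l.
  apply: (sstate_ig saE (c := 4)); first by apply: mf_cut; exact: mf_wt.
  move=> x; rewrite ger0_norm ?cut_ge0 ?wt_ge0//.
  by rewrite (le_trans (cut_le _ (wt_ge0 _)))//; have /andP[] := w1 x.
have kE := I_kap_wt sE.
have kF : \int[mu]_x (kap x * F x) <= 8 * A.
  apply: le_trans (I_kap_sum hf hg hA hB); rewrite le_eqVlt; apply/orP; left.
  by apply/eqP/I_eq => x; rewrite (ger0_norm (F0 x)).
have kwF : \int[mu]_x (kap x * wt x * F x) <= 8 * A.
  have hh h A' : state h -> \int[mu]_x (Wt x * h x) <= A' ->
      \int[mu]_x (kap x * wt x * h x) <= 4 * A'.
    by move=> sh; apply: (state_I_le4 sh mkw (kapwt_le4 M)).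
  have hhf := hh _ _ hf hA; have hhg := hh _ _ hg hB.
  rewrite (_ : \int[mu]_x (kap x * wt x * F x) =
     \int[mu]_x (kap x * wt x * f x + kap x * wt x * g x)).
    rewrite I_D; [exact: add_le8|exact: (sstate_kapwt M sf)|exact: (sstate_kapwt M sg)].
  by apply: I_eq => x; rewrite mulrDr.
have l1' := le_trans (ler_norm _) l1; have l2' := le_trans (ler_norm _) l2.
move: hle l1' l2'; rewrite !I_Z//;
  [|exact: (sstate_kap M sF)|exact: (sstate_kapwt M sF)|exact/igZ/(sstate_kapwt M sF)].
have p1 : 0 <= \int[mu]_x (kap x * wt x * F x).
  by apply: I_ge0 => x; rewrite mulr_ge0//; have /andP[] := kw x.
have p2 : 0 <= \int[mu]_x (kap x * `|E x|).
  by apply: I_ge0 => x; rewrite mulr_ge0// kap_ge0.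
have p3 : 0 <= \int[mu]_x (kap x * F x).
  by apply: I_ge0 => x; rewrite mulr_ge0// kap_ge0.
have p4 : 0 <= \int[mu]_x (out r (fun y => kap y * wt y) x * `|E x|).
  by apply: I_ge0 => x; rewrite mulr_ge0// out_ge0//; have /andP[] := kw x.
have t0 : 0 <= tau.
  by apply: le_trans hA'; apply: I_ge0 => x; rewrite mulr_ge0// out_ge0// Wt_ge0.
have A0 : 0 <= A.
  by apply: le_trans hA; apply: I_ge0 => x; rewrite mulr_ge0// Wt_ge0.
have kE' : \int[mu]_x (kap x * `|E x|) <=
   2 * (\int[mu]_x (cut r wt x * `|E x|) + 8 * tau).
  by apply: le_trans kE _; rewrite ler_pM2l.
have e1 := ler_wpM2l c0 (ler_pM p1 p2 kwF kE').
have e2 := ler_pM p3 p4 kF okw.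
have e3 : 0 <= (beta0 - 2) * (A * tau).
  by apply: mulr_ge0; [rewrite subr_ge0 ltW|exact: mulr_ge0].
have e4 : 0 <= A * tau by rewrite mulr_ge0.
have e5 : \int[mu]_x (cut r wt x * `|f x - g x|) =
   \int[mu]_x (cut r wt x * `|E x|) by [].
rewrite e5; move: e1 e2; clear -e3 e4.
move: (\int[mu]_x (cut r wt x * `|E x|)) => d.
move: (\int[mu]_x (kap x * wt x * F x)) => a1.
move: (\int[mu]_x (kap x * `|E x|)) => a2.
move: (\int[mu]_x (kap x * F x)) => a3.
move: (\int[mu]_x (out r (fun y => kap y * wt y) x * `|E x|)) => a4.
move: (\int[P]_q (zet phi q * k q * F q.1 * E q.2)) => z.
move: (\int[P]_q ((beta0 + 1) * wt q.1 * k q * F q.1 * `|E q.2|)) => y1.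
move: (\int[P]_q (out r wt q.2 * k q * F q.1 * `|E q.2|)) => y2.
move=> H1 H2 H3 H4 H5; lra.
Qed.

End Estimates.

(** * The collision operator *)

Section Operator.
Context {R : realType}.
Local Notation mu := (@lebesgue_measure R).
Local Notation P := (mu \x mu)%E.
Variables (beta beta0 : R) (k : R * R -> R) (bet : R * (R * R) -> R).
Hypothesis M : breakage_model beta beta0 k bet.

Let b0 := beta_ge0 M.
Let b1 := beta_le1 M.
Let b2 := beta0_gt2 M.

Local Notation kap := (kap beta).
Local Notation state := (state beta).
Local Notation zet := (zet bet).
Local Notation gainw := (gainw bet).
Local Notation Q := (Q k bet).
Implicit Types (f g u v phi : R -> R) (rho c A : R) (q : R * R).

Local Notation mR := (measurableTypeR R).

Definition gain f (z : R) : R :=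
  2^-1 * \int[P]_q (bet (z, q) * k q * f q.1 * f q.2).

Definition rate f (x : R) : R := \int[mu]_y (k (x, y) * f y).

(** The collision operator in its strong form, used to define the Euler scheme. *)
Definition B f (x : R) : R := gain f x - f x * rate f x.

Definition step (s : R) f (x : R) : R := f x + s * B f x.

Lemma mf_intP (F : mR * (mR * mR) -> R) : mf3 F -> mf1 (fun x => \int[P]_q F (x, q)).
Proof. by move=> hF; exact: (mf_int23 mu mu hF). Qed.

Lemma mf_intR (F : mR * mR -> R) : mf2 F -> mf1 (fun x => \int[mu]_y F (x, y)).
Proof. by move=> hF; exact: (@mf_int2 _ _ mR mR R mu F hF). Qed.

Lemma mf_gain f : mf1 f -> mf1 (gain f).
Proof.
move=> hf.
have h1 : mf2 (fun q : R * R => f q.1) by exact: (mf_fst hf).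
have h2 : mf2 (fun q : R * R => f q.2) by exact: (mf_snd hf).
have h3 : mf3 (fun p : mR * (mR * mR) => bet p * k p.2 * f p.2.1 * f p.2.2).
  apply: measurable_funM; last exact: (mf_snd h2).
  apply: measurable_funM; last exact: (mf_snd h1).
  by apply: measurable_funM; [exact: bet_mf M|exact: (mf_snd (k_mf M))].
have h4 := mf_intP h3.
by apply: measurable_funM; [exact: measurable_cst|exact: h4].
Qed.

Lemma mf_rate f : mf1 f -> mf1 (rate f).
Proof.
move=> hf.
have h : mf2 (fun p : mR * mR => k p * f p.2).
  by apply: measurable_funM; [exact: k_mf M|exact: (mf_snd hf)].
exact: (mf_intR h).
Qed.

Lemma mf_B f : mf1 f -> mf1 (B f).
Proof.
move=> hf; apply: measurable_funB; first exact: mf_gain.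
by apply: measurable_funM => //; exact: mf_rate.
Qed.

Lemma mf_step s f : mf1 f -> mf1 (step s f).
Proof.
move=> hf; apply: measurable_funD => //.
by apply: measurable_funM => //; exact: mf_B.
Qed.

Lemma coll1_ig (Z : R * R -> R) f rho : mf2 Z -> (forall q, `|Z q| <= rho) ->
  state f -> ig P (fun q => Z q * k q * f q.1 * f q.2).
Proof.
by move=> hZ hr /state_sstate hf; have [] := coll_ig_rho M hZ hr hf hf.
Qed.

(** Fubini's theorem on three variables moves the test from the fragment to the
    pair of colliding particles. *)
Lemma gain_pairing phi rho f : mf1 phi -> (forall x, `|phi x| <= rho) ->
  state f -> ig mu (fun x => phi x * gain f x) /\
  \int[mu]_x (phi x * gain f x) =
    2^-1 * \int[P]_q (gainw phi q * k q * f q.1 * f q.2).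
Proof.
move=> hphi hrho hf; have [f1 f0 _ _] := hf; have sf := state_sstate hf.
have r0 : 0 <= rho by rewrite (le_trans _ (hrho 0)).
pose c (q : R * R) := 1 * k q * f q.1 * f q.2.
have ic : ig P c.
  by apply: (@coll1_ig (fun=> 1) f 1) => // q; rewrite normr1.
have c0 q : 0 <= c q by rewrite /c !mulr_ge0// (k_ge0 M).
have mc : mf2 c := ig_mf ic.
pose G (p : mR * (mR * mR)) := bet p * c p.2.
have mG : mf3 G by apply: measurable_funM; [exact: bet_mf M|exact: (mf_snd mc)].
have igc q : ig mu (fun z => G (z, q)).
  have := igZ (c q) (bet_num_ig M q).
  by under eq_fun do rewrite mulrC.
have iGc q : \int[mu]_z `|G (z, q)| <= beta0 * c q.
  rewrite (_ : \int[mu]_z _ = \int[mu]_z (c q * bet (z, q))).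
    rewrite I_Z; last exact: (bet_num_ig M).
    by rewrite mulrC ler_wpM2r// (bet_num M).
  apply: I_eq => z.
  by rewrite /G normrM (ger0_norm (bet_ge0 M _)) (ger0_norm (c0 _)) mulrC.
have [aeG _ _] := fubini3 mG igc (igZ beta0 ic) iGc.
pose F (p : mR * (mR * mR)) := phi p.1 * G p.
have mF : mf3 F by apply: measurable_funM; [exact: (mf_fst hphi)|].
have ifc q : ig mu (fun z => F (z, q)).
  apply: (ig_le _ (igZ rho (ig_abs (igc q)))).
    exact: (mf_sec2 q mF).
  by move=> z; rewrite normrM ler_wpM2r.
have iFc q : \int[mu]_z `|F (z, q)| <= rho * (beta0 * c q).
  apply: (@le_trans _ _ (\int[mu]_z (rho * `|G (z, q)|))).
    apply: I_le; [exact: ig_abs|by apply: igZ; exact: ig_abs|] => z.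
    by rewrite normrM ler_wpM2r.
  rewrite I_Z; last exact: ig_abs.
  by rewrite ler_wpM2l.
have [_ iF1 eF] := fubini3 mF ifc (igZ rho (igZ beta0 ic)) iFc.
have e1 : \int[P]_q (gainw phi q * k q * f q.1 * f q.2) =
    \int[P]_q \int[mu]_z F (z, q).
  apply: I_eq => q.
  transitivity (c q * gainw phi q); first by rewrite /c; ring.
  rewrite /gainw -I_Z; last exact: (gain_ig M q hphi hrho).
  by apply: I_eq => z; rewrite /F /G /=; ring.
have e2 : {ae mu, forall x, \int[P]_q F (x, q) = 2 * (phi x * gain f x)}.
  apply: filterS aeG => x ix.
  rewrite /F /= I_Z// /gain.
  rewrite (_ : \int[P]_q G _ = \int[P]_q (bet (x, q) * k q * f q.1 * f q.2)).
    by field.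
  by apply: I_eq => q; rewrite /G /c /=; ring.
have mpg : mf1 (fun x => 2 * (phi x * gain f x)).
  apply: measurable_funM; first exact: measurable_cst.
  by apply: measurable_funM => //; exact: mf_gain.
have ipg := ig_ae_eq mpg iF1 e2.
have ipg' : ig mu (fun x => phi x * gain f x).
  have := igZ 2^-1 ipg; congr (_.-integrable _ _).
  by apply/funext => x /=; congr EFin; field.
split=> //; rewrite e1 -eF (I_ae_eq (ig_mf iF1) mpg e2).
by rewrite I_Z//; field.
Qed.

Lemma loss_pairing phi rho f : mf1 phi -> (forall x, `|phi x| <= rho) ->
  state f -> ig mu (fun x => phi x * (f x * rate f x)) /\
  \int[mu]_x (phi x * (f x * rate f x)) =
    \int[P]_q (phi q.1 * k q * f q.1 * f q.2).
Proof.
move=> hphi hrho hf; have [f1 f0 _ _] := hf; have sf := state_sstate hf.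
pose F (q : mR * mR) := phi q.1 * k q * f q.1 * f q.2.
have iF : ig P F by apply: coll1_ig => //; exact: (mf_fst hphi).
have e x : \int[mu]_y F (x, y) = phi x * (f x * rate f x).
  have ik : ig mu (fun y => k (x, y) * f y).
    apply: (ig_le _ (igZ (2 * kap x) (sstate_kap M sf))).
      by apply: measurable_funM => //; exact: (mf_sec1 x (k_mf M)).
    move=> y; rewrite normrM (ger0_norm (k_ge0 M _)) (ger0_norm (f0 y)) mulrA.
    by rewrite ler_wpM2r//; exact: (k_le M (x, y)).
  rewrite mulrA /rate -I_Z//; apply: I_eq => y; rewrite /F /=; ring.
rewrite (I_prod12 iF); have := ig_int2 iF.
by under eq_fun do rewrite e; move=> ->; split=> //; apply: I_eq.
Qed.

(** Strong and weak forms agree; the loss term is symmetrised here. *)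
Lemma B_pairing phi rho f : mf1 phi -> (forall x, `|phi x| <= rho) ->
  state f -> ig mu (fun x => phi x * B f x) /\
  \int[mu]_x (phi x * B f x) = Q phi f.
Proof.
move=> hphi hrho hf.
have [ig1 e1] := gain_pairing hphi hrho hf.
have [il el] := loss_pairing hphi hrho hf.
have e x : phi x * B f x = phi x * gain f x - phi x * (f x * rate f x).
  by rewrite /B mulrBr.
split.
  have := igB ig1 il; congr (_.-integrable _ _).
  by apply/funext => x /=; rewrite -e.
transitivity (\int[mu]_x (phi x * gain f x - phi x * (f x * rate f x))).
  exact: I_eq.
rewrite I_B// e1 el /Q.
have i1 : ig P (fun q => phi q.1 * k q * f q.1 * f q.2).
  by apply: (coll1_ig _ _ hf); [exact: (mf_fst hphi)|move=> q; exact: hrho].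
have i2 : ig P (fun q => phi q.2 * k q * f q.1 * f q.2).
  by apply: (coll1_ig _ _ hf); [exact: (mf_snd hphi)|move=> q; exact: hrho].
have i3 : ig P (fun q => gainw phi q * k q * f q.1 * f q.2).
  apply: (coll1_ig _ _ hf); first exact: (mf_gainw M).
  by move=> q; exact: (gainw_le_rho M).
have es : \int[P]_q (phi q.2 * k q * f q.1 * f q.2) =
          \int[P]_q (phi q.1 * k q * f q.1 * f q.2).
  rewrite -(I_swap i1); apply: I_eq => -[x y] /=.
  by rewrite (k_sym M y x); ring.
have -> : \int[P]_q (zet phi q * k q * f q.1 * f q.2) =
   \int[P]_q (gainw phi q * k q * f q.1 * f q.2) -
   \int[P]_q (phi q.1 * k q * f q.1 * f q.2) -
   \int[P]_q (phi q.2 * k q * f q.1 * f q.2).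
  rewrite -I_B// -I_B//; last exact: igB.
  by apply: I_eq => q; rewrite /zet; ring.
by rewrite es; field.
Qed.

Lemma B_ig f : state f -> ig mu (B f).
Proof.
move=> hf; have [] := @B_pairing (fun=> 1) 1 f _ _ hf => //.
  by move=> x; rewrite normr1.
by under eq_fun do rewrite mul1r.
Qed.

Lemma step_pairing phi rho s f : mf1 phi -> (forall x, `|phi x| <= rho) ->
  state f -> \int[mu]_x (phi x * step s f x) =
    \int[mu]_x (phi x * f x) + s * Q phi f.
Proof.
move=> hphi hrho hf; have [ib <-] := B_pairing hphi hrho hf.
rewrite -I_Z// -I_D//; last exact: igZ.
  by apply: I_eq => x; rewrite /step; ring.
exact: (sstate_bd (state_sstate hf) hphi hrho).
Qed.

End Operator.

(** * One explicit Euler step *)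

(** Tangent line of the concave power at [r]. *)
Lemma powR_young (R : realType) (x r a : R) : 0 <= x -> 0 < r -> 0 <= a <= 1 ->
  x `^ a <= r `^ a * ((1 - a) + a / r * x).
Proof.
move=> x0 r0 /andP[a0 a1].
have [->|xn0] := eqVneq x 0.
  rewrite mulr0 addr0; have [->|an0] := eqVneq a 0.
    by rewrite !powRr0 subr0 mulr1.
  by rewrite powR0// mulr_ge0 ?powR_ge0// subr_ge0.
have xp : 0 < x by rewrite lt_neqAle eq_sym xn0.
pose u := ln x - ln r.
have eu : x / r = expR u by rewrite /u expRB !lnK.
have ex : x `^ a = r `^ a * expR (a * u).
  rewrite /powR !gt_eqF// -expRD; congr expR; rewrite /u; ring.
rewrite ex ler_wpM2l ?powR_ge0//.
have -> : a / r * x = a * expR u by rewrite -eu; ring.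
have h1 : expR (a * u) * (1 + (1 - a) * u) <= expR u.
  rewrite [leRHS](_ : _ = expR (a * u) * expR ((1 - a) * u)); last first.
    by rewrite -expRD; congr expR; ring.
  by rewrite ler_wpM2l ?expR_ge0// expR_ge1Dx.
have h2 : expR (a * u) * (1 - a * u) <= 1.
  rewrite -[leRHS](_ : expR (a * u) * expR (- (a * u)) = 1).
    by rewrite ler_wpM2l ?expR_ge0// expR_ge1Dx.
  by rewrite -expRD subrr expR0.
have h3 := ler_wpM2l a0 h1.
have a1' : 0 <= 1 - a by rewrite subr_ge0.
have h4 := ler_wpM2l a1' h2.
move: h3 h4; move: (expR (a * u)) (expR u) => E F h3 h4; lra.
Qed.

Section EulerStep.
Context {R : realType}.
Local Notation mu := (@lebesgue_measure R).
Local Notation P := (mu \x mu)%E.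
Variables (beta beta0 : R) (k : R * R -> R) (bet : R * (R * R) -> R).
Hypothesis M : breakage_model beta beta0 k bet.

Let b0 := beta_ge0 M.
Let b1 := beta_le1 M.
Let b2 := beta0_gt2 M.

Local Notation kap := (kap beta).
Local Notation wt := (@wt R).
Local Notation Wt := (Wt beta).
Local Notation state := (state beta).
Local Notation zet := (zet bet).
Local Notation gainw := (gainw bet).
Local Notation Q := (Q k bet).
Implicit Types (f g u v phi : R -> R) (rho c A : R) (q : R * R).

Local Notation mR := (measurableTypeR R).
Local Notation gain := (gain k bet).
Local Notation rate := (rate k).
Local Notation B := (B k bet).
Local Notation step := (step k bet).

Variable alpha : R.
Hypothesis a0 : 0 <= alpha.
Hypothesis ab : alpha <= beta.
Hypothesis k_split : forall q, k q <=
  `|q.1| `^ alpha * `|q.2| `^ beta + `|q.1| `^ beta * `|q.2| `^ alpha.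

Definition supp (n : R) f := forall x, n < x -> f x = 0.

Lemma gain_supp n f z : state f -> supp n f -> (z <= 0) || (n < z) -> gain f z = 0.
Proof.
move=> [_ _ fn _] hs hz; rewrite /gain (I_eq _ (g := fun=> 0)) ?I_0 ?mulr0//.
move=> q; have [z0|z0] := leP z 0; first by rewrite (bet_pos M)// !mul0r.
move: hz; rewrite leNgt z0/= => nz.
have [q1|q1] := ltP n q.1; first by rewrite hs// mulr0 mul0r.
have [q2|q2] := ltP n q.2; first by rewrite (hs q.2)// mulr0.
rewrite (bet_max M) ?mul0r// ge_max.
by rewrite (le_trans q1 (ltW nz)) (le_trans q2 (ltW nz)).
Qed.

Lemma gain_ge0 f z : state f -> 0 <= gain f z.
Proof.
move=> [_ f0 _ _]; rewrite mulr_ge0// ?invr_ge0//; apply: I_ge0 => q.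
by rewrite !mulr_ge0// ?(bet_ge0 M)// (k_ge0 M).
Qed.

Lemma rate_le f x A : state f -> \int[mu]_x (Wt x * f x) <= A ->
  0 <= rate f x <= 8 * kap x * A.
Proof.
move=> hf hA; have [f1 f0 _ _] := hf; have sf := state_sstate hf.
apply/andP; split.
  by apply: I_ge0 => y; rewrite mulr_ge0// (k_ge0 M).
have ik := sstate_kap M sf.
have hle y : k (x, y) * f y <= 2 * kap x * (kap y * f y).
  by rewrite mulrA ler_wpM2r//; exact: (k_le M (x, y)).
apply: (@le_trans _ _ (\int[mu]_y (2 * kap x * (kap y * f y)))).
  apply: I_le => //; last exact: igZ.
  apply: (ig_le _ (igZ (2 * kap x) ik)).
    by apply: measurable_funM => //; exact: (mf_sec1 x (k_mf M)).
  by move=> y; rewrite ger0_norm// mulr_ge0// (k_ge0 M).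
rewrite I_Z//.
have h := state_kap_le M hf hA.
rewrite (_ : 8 * kap x * A = 2 * kap x * (4 * A)); last by ring.
by rewrite ler_wpM2l// mulr_ge0// kap_ge0.
Qed.

Lemma kap_mono x y : 0 <= x -> x <= y -> kap x <= kap y.
Proof.
move=> x0 xy; rewrite lerD2l ge0_ler_powR// ?nnegrE//.
by rewrite !ger0_norm// (le_trans x0).
Qed.

(** A step is non-negative if [s] times the loss rate is at most one. The rate is
    bounded on the support, which the step preserves, since pieces are never larger
    than their parents. *)
Lemma step_state (n s : R) f A : 0 <= s -> state f -> supp n f ->
  \int[mu]_x (Wt x * f x) <= A -> s * (8 * kap n * A) <= 1 ->
  state (step s f) /\ supp n (step s f).
Proof.
move=> s0 hf hs hA hsA; have [f1 f0 fn _] := hf; have sf := state_sstate hf.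
have A0 : 0 <= A.
  by apply: le_trans hA; apply: I_ge0 => x; rewrite mulr_ge0// Wt_ge0.
have sp : supp n (step s f).
  move=> x nx; rewrite /step /B (gain_supp hf hs) ?nx ?orbT//.
  by rewrite hs// mul0r subrr mulr0 addr0.
have sn x : x <= 0 -> step s f x = 0.
  move=> x0; rewrite /step /B (gain_supp hf hs) ?x0//.
  by rewrite fn// mul0r subrr mulr0 addr0.
have ms : mf1 (step s f) := mf_step M s f1.
have is' : ig mu (step s f).
  apply: igD; first exact: sstate_1 sf.
  by apply: igZ; exact: (B_ig M hf).
split=> //; split=> //.
- move=> x; have [x0|x0] := leP x 0; first by rewrite sn.
  have [nx|nx] := ltP n x; first by rewrite sp.
  rewrite (_ : step s f x = f x * (1 - s * rate f x) + s * gain f x); last first.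
    by rewrite /step /B; ring.
  rewrite addr_ge0// mulr_ge0 ?gain_ge0// subr_ge0.
  apply: le_trans hsA; rewrite ler_wpM2l//.
  have /andP[_ h] := rate_le x hf hA; apply: le_trans h _.
  by rewrite ler_wpM2r// ler_wpM2l// kap_mono// ltW.
- apply: (ig_le _ (igZ (Wt n) (ig_abs is'))).
    by apply: measurable_funM => //; exact: mf_Wt.
  move=> x; rewrite normrM ger0_norm ?Wt_ge0//.
  have [x0|x0] := leP x 0; first by rewrite sn// normr0 !mulr0.
  have [nx|nx] := ltP n x; first by rewrite sp// normr0 !mulr0.
  rewrite ler_wpM2r// /Wt lerD2l ge0_ler_powR ?nnegrE// ?addr_ge0//.
  by rewrite (gtr0_norm x0) (gtr0_norm (lt_le_trans x0 nx)).
Qed.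

Definition inbox (n z : R) : bool := (0 < z) && (z <= n).

Lemma mf_inbox n : measurable_fun setT (inbox n : mR -> bool).
Proof.
by apply: measurable_and; [exact: measurable_fun_ltr|exact: measurable_fun_ler].
Qed.

Lemma I_inbox n v f : state f -> supp n f ->
  \int[mu]_x (v x * f x) = \int[mu]_x ((if inbox n x then v x else 0) * f x).
Proof.
move=> [_ _ fn _] hs; apply: I_eq => x; rewrite /inbox.
have [x0|x0] := leP x 0; first by rewrite fn// !mulr0.
by have [nx|nx] := ltP n x; first by rewrite hs// !mulr0.
Qed.

Lemma gain_inbox n v (q : R * R) : q.1 <= n -> q.2 <= n ->
  gainw (fun z => if inbox n z then v z else 0) q = \int[mu]_z (v z * bet (z, q)).
Proof.
move=> q1 q2; apply: I_eq => z; rewrite /inbox.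
have [z0|z0] := leP z 0; first by rewrite (bet_pos M)// !mulr0.
have [nz|//] := ltP n z; rewrite (bet_max M) ?mulr0//.
by rewrite ge_max (le_trans q1 (ltW nz)) (le_trans q2 (ltW nz)).
Qed.

(** On a bounded support the weight is a bounded test, and [bet_conv] says that its
    net change is non-positive in each collision. *)
Lemma step_conv (th : R -> R) (n s : R) A f : 0 <= n -> 0 <= s -> state f -> supp n f ->
  \int[mu]_x (Wt x * f x) <= A -> s * (8 * kap n * A) <= 1 ->
  mf1 th -> (forall z, 0 <= th z) ->
  (forall z z', 0 < z -> z <= z' -> th z <= th z') ->
  \int[mu]_x (x * th x * step s f x) <= \int[mu]_x (x * th x * f x).
Proof.
move=> n0 s0 hf hs hA hsA mth th0 thm.
have [st ss] := step_state s0 hf hs hA hsA.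
have [f1 f0 fn _] := hf.
rewrite (I_inbox _ st ss) (I_inbox _ hf hs).
set phi := fun x => if inbox n x then x * th x else 0.
have mphi : mf1 phi.
  apply: measurable_fun_ifT => //; first exact: mf_inbox.
  exact: measurable_funM.
have hrho x : `|phi x| <= n * th n.
  rewrite /phi /inbox; case: ifP => [/andP[x0 xn]|_].
    rewrite ger0_norm ?(mulr_ge0 (ltW x0))//.
    by apply: ler_pM => //; [exact: ltW|exact: thm].
  by rewrite normr0 mulr_ge0.
rewrite (step_pairing M s mphi hrho hf) gerDl mulr_ge0_le0//.
rewrite /Q pmulr_rle0 ?invr_gt0// -oppr_ge0.
have e : (- (\int[P]_q (zet phi q * k q * f q.1 * f q.2))) =
    \int[P]_q (- 1 * (zet phi q * k q * f q.1 * f q.2)).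
  rewrite I_Z ?mulN1r//; apply: (coll1_ig M) => //; first exact: (mf_zet M).
  by move=> q; exact: (zet_le_rho M q mphi hrho).
rewrite e; apply: I_ge0 => q.
have [/andP[q1 q2]|/(k_supp M) ->] := boolP ((0 < q.1) && (0 < q.2)); last first.
  by rewrite !(mulr0, mul0r).
have [q1n|q1n] := ltP n q.1; first by rewrite (hs q.1)// !(mulr0, mul0r).
have [q2n|q2n] := ltP n q.2; first by rewrite (hs q.2)// !(mulr0, mul0r).
rewrite mulN1r -!mulNr !mulr_ge0// ?(k_ge0 M)//.
rewrite oppr_ge0 /zet gain_inbox// /phi /inbox q1 q2 q1n q2n/=.
by have := bet_conv M mth th0 thm q1 q2; lra.
Qed.

Lemma step_mass (n s : R) A f : 0 <= n -> 0 <= s -> state f -> supp n f ->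
  \int[mu]_x (Wt x * f x) <= A -> s * (8 * kap n * A) <= 1 ->
  \int[mu]_x (x * step s f x) = \int[mu]_x (x * f x).
Proof.
move=> n0 s0 hf hs hA hsA.
have [st ss] := step_state s0 hf hs hA hsA.
have [f1 f0 fn _] := hf.
rewrite (I_inbox _ st ss) (I_inbox _ hf hs).
set phi := fun x => if inbox n x then x else 0.
have mphi : mf1 phi by apply: measurable_fun_ifT => //; exact: mf_inbox.
have hrho x : `|phi x| <= n.
  rewrite /phi /inbox; case: ifP => [/andP[x0 xn]|_]; last by rewrite normr0.
  by rewrite gtr0_norm.
rewrite (step_pairing M s mphi hrho hf).
suff -> : Q phi f = 0 by rewrite mulr0 addr0.
rewrite /Q (I_eq _ (g := fun=> 0)) ?I_0 ?mulr0// => q.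
have [/andP[q1 q2]|/(k_supp M) ->] := boolP ((0 < q.1) && (0 < q.2)); last first.
  by rewrite !(mulr0, mul0r).
have [q1n|q1n] := ltP n q.1; first by rewrite (hs q.1)// !(mulr0, mul0r).
have [q2n|q2n] := ltP n q.2; first by rewrite (hs q.2)// !(mulr0, mul0r).
rewrite /zet gain_inbox// (bet_mass M)// /phi /inbox q1 q2 q1n q2n/=.
by rewrite (_ : q.1 + q.2 - q.1 - q.2 = 0) ?mul0r//; ring.
Qed.

(** Interpolation between the number and the mass, written with the mean size [r] to
    avoid Hoelder's inequality. *)
Lemma pow_mom f (a r m M1 : R) : state f -> 0 <= a <= 1 -> 0 < r ->
  \int[mu]_x f x <= m -> \int[mu]_x (x * f x) <= M1 -> M1 = r * m ->
  ig mu (fun x => `|x| `^ a * f x) /\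
  \int[mu]_x (`|x| `^ a * f x) <= r `^ a * m.
Proof.
move=> hf ha r0 hm h1 e; have [f1 f0 fn _] := hf; have sf := state_sstate hf.
have /andP[a0' a1'] := ha.
have ix : ig mu (fun x => x * f x).
  apply: (ig_le _ (sstate_wt M sf)); first exact: measurable_funM.
  move=> x; rewrite normrM (ger0_norm (f0 x)) ler_wpM2r// /wt.
  by rewrite lerDr.
have i1 := sstate_1 sf.
have is' := igZ (r `^ a) (igD (igZ (1 - a) i1) (igZ (a / r) ix)).
have hle x : `|x| `^ a * f x <= r `^ a * ((1 - a) * f x + a / r * (x * f x)).
  have [x0|x0] := leP x 0; first by rewrite fn// !mulr0 addr0 mulr0.
  rewrite [leRHS](_ : _ = r `^ a * ((1 - a) + a / r * x) * f x); last by ring.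
  by rewrite ler_wpM2r// gtr0_norm// powR_young// ltW.
have iL : ig mu (fun x => `|x| `^ a * f x).
  apply: (ig_le _ is'); first by apply: measurable_funM => //; exact: mf_powabs.
  by move=> x; rewrite ger0_norm// mulr_ge0// powR_ge0.
split=> //; apply: (le_trans (I_le iL is' hle)).
rewrite I_Z; last by apply: igD; exact: igZ.
rewrite I_D ?I_Z//; [|exact: igZ|exact: igZ].
rewrite ler_wpM2l ?powR_ge0//.
have h2 : 0 <= a / r by rewrite divr_ge0// ltW.
have h3 := ler_wpM2l h2 h1.
have a1'' : 0 <= 1 - a by rewrite subr_ge0.
have h4 := ler_wpM2l a1'' hm.
have e' : a / r * M1 = a * m by rewrite e; field; rewrite gt_eqF.
lra.
Qed.

Lemma half_double_le (c X Y Z G : R) : X <= c * (Z * Y + Y * Z) ->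
  c * (Z * Y) <= c * G -> 2^-1 * X <= c * G.
Proof. by move=> h1 h2; lra. Qed.

(** At most [beta0 - 2] particles are gained in a collision, and the collision rate
    is bounded by a product of two interpolated moments. *)
Lemma step_num f (s m M1 : R) : 0 <= s -> state f -> 0 < m -> 0 < M1 ->
  \int[mu]_x f x <= m -> \int[mu]_x (x * f x) <= M1 ->
  \int[mu]_x step s f x <=
    m + s * ((beta0 - 2) * M1 `^ (alpha + beta) * m `^ (2 - (alpha + beta))).
Proof.
move=> s0 hf m0 M0 hm h1; have [f1 f0 fn _] := hf; have sf := state_sstate hf.
have one (x : R) : `|(1 : R)| <= 1 by rewrite normr1.
have m1c : mf1 (fun _ : R => 1 : R) by exact: measurable_cst.
have hp := @step_pairing _ _ _ _ _ M (fun=> 1) 1 s f m1c one hf.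
have e1 : \int[mu]_x (1 * step s f x) = \int[mu]_x step s f x.
  by apply: I_eq => x; rewrite mul1r.
have e2 : \int[mu]_x (1 * f x) = \int[mu]_x f x.
  by apply: I_eq => x; rewrite mul1r.
rewrite -e1 hp e2.
apply: lerD => //; apply: ler_wpM2l => //.
(* Young's inequality is used with its equality case at the mean size *)
set r := M1 / m; have r0 : 0 < r by rewrite divr_gt0.
have e : M1 = r * m by rewrite /r; field; rewrite gt_eqF.
have a1 : 0 <= alpha <= 1 by rewrite a0 (le_trans ab b1).
have be1 : 0 <= beta <= 1 by rewrite b0 b1.
have [ia la] := pow_mom hf a1 r0 hm h1 e.
have [ib lb] := pow_mom hf be1 r0 hm h1 e.
have iT := igD (ig_tensor ia ib) (ig_tensor ib ia).
have iz : ig P (fun q => zet (fun=> 1) q * k q * f q.1 * f q.2).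
  apply: (coll1_ig M) => //; first by apply: (mf_zet M m1c).
  by move=> q; exact: (zet_le_rho M q m1c one).
have h : \int[P]_q (zet (fun=> 1) q * k q * f q.1 * f q.2) <=
   \int[P]_q ((beta0 - 2) * (`|q.1| `^ alpha * f q.1 * (`|q.2| `^ beta * f q.2) +
     `|q.1| `^ beta * f q.1 * (`|q.2| `^ alpha * f q.2))).
  apply: I_le => //; first exact: igZ.
  move=> q; have hz : zet (fun=> 1) q <= beta0 - 2.
    have e3 : \int[mu]_z (1 * bet (z, q)) = \int[mu]_z bet (z, q).
      by apply: I_eq => z; rewrite mul1r.
    have e4 (t : R) : t - 1 - 1 = t - 2 by ring.
    by rewrite /zet /gainw e3 e4 lerD2r; exact: bet_num M q.
  have c0 : 0 <= beta0 - 2 by rewrite subr_ge0 ltW.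
  rewrite [leRHS](_ : _ = (beta0 - 2) * (`|q.1| `^ alpha * `|q.2| `^ beta +
     `|q.1| `^ beta * `|q.2| `^ alpha) * f q.1 * f q.2); last by ring.
  rewrite ler_wpM2r// ler_wpM2r//.
  apply: (@le_trans _ _ ((beta0 - 2) * k q)).
    by rewrite ler_wpM2r// (k_ge0 M).
  by rewrite ler_wpM2l.
have := h; rewrite I_Z// I_D//; [|exact: (ig_tensor ia ib)|exact: (ig_tensor ib ia)].
rewrite (I_tensor ia ib) (I_tensor ib ia) => h'.
have pa : 0 <= \int[mu]_x (`|x| `^ alpha * f x).
  by apply: I_ge0 => x; rewrite mulr_ge0// powR_ge0.
have pb : 0 <= \int[mu]_x (`|x| `^ beta * f x).
  by apply: I_ge0 => x; rewrite mulr_ge0// powR_ge0.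
have hab := ler_pM pa pb la lb.
have c0 : 0 <= beta0 - 2 by rewrite subr_ge0 ltW.
have hab' := ler_wpM2l c0 hab.
have ee : (r `^ alpha * m) * (r `^ beta * m) =
    M1 `^ (alpha + beta) * m `^ (2 - (alpha + beta)).
  have pE (x z : R) : 0 < x -> x `^ z = expR (z * ln x).
    by move=> x0; rewrite /powR gt_eqF.
  have mE : m = expR (ln m) by rewrite lnK.
  rewrite !pE// /r ln_div// [X in _ * X * (_ * X)]mE -!expRD; congr expR.
  by ring.
rewrite -mulrA -ee /Q.
exact: (half_double_le h' hab').
Qed.

End EulerStep.

(** * Scalar comparison *)

Section RealLemmas.
Context {R : realType}.
Implicit Types (a b c s t : R).

(** A supersolution of [m' = c m^(2 - lam)] in the discrete sense that suits the
    Euler scheme. For [lam < 1] it is the solution itself, which is convex and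
    finite exactly as long as the strict inequality on [T] holds. *)
Lemma majorant_exists (lam c m0 T : R) : 0 <= lam <= 2 -> 0 < c -> 0 < m0 ->
  0 <= T -> (lam < 1 -> (1 - lam) * c * T < m0 `^ (lam - 1)) ->
  exists m : R -> R, [/\ m0 <= m 0, forall t, 0 <= t <= T -> 0 < m t &
    forall t s, 0 <= t -> 0 <= s -> t + s <= T ->
      m t + s * (c * (m t) `^ (2 - lam)) <= m (t + s)].
Proof.
move=> /andP[l0 l2] c0 m00 T0 hT; have [l1|l1] := leP 1 lam.
  (* this function stays above [1], where [m `^ (2 - lam) <= m] *)
  exists (fun t => (1 + m0) * expR (c * t)).
  have p0 : 0 < 1 + m0 by rewrite addr_gt0.
  split=> [|t _|t s t0 s0 _].
  - by rewrite mulr0 expR0 mulr1 lerDr.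
  - by rewrite mulr_gt0// expR_gt0.
  - set m := _ * _; have m1 : 1 <= m.
      rewrite -[1]mulr1 /m ler_pM// ?lerDl ?(ltW m00)//.
      by rewrite -expR0 ler_expR mulr_ge0// ltW.
    have mp : m `^ (2 - lam) <= m.
      rewrite -[leRHS]powRr1 ?(le_trans ler01)// ler_powR//.
      by rewrite lerBlDr -lerBlDl (_ : 2 - 1 = 1 :> R)//; ring.
    have -> : (1 + m0) * expR (c * (t + s)) = m * expR (c * s).
      by rewrite /m mulrDr expRD; ring.
    apply: (@le_trans _ _ (m * (1 + c * s))); last first.
      by rewrite ler_wpM2l ?expR_ge1Dx// (le_trans ler01).
    rewrite mulrDr mulr1 lerD2l (_ : m * (c * s) = s * (c * m)); last by ring.
    by rewrite ler_wpM2l// ler_wpM2l// ltW.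
have {}hT := hT l1.
set q := 1 - lam in hT *; have q0 : 0 < q by rewrite subr_gt0.
(* [m `^ (lam - 1)] decreases linearly along the solutions of the equation *)
pose y0 := m0 `^ (lam - 1); have y00 : 0 < y0 by exact: powR_gt0.
pose y t := y0 - q * c * t.
have yp t : t <= T -> 0 < y t.
  move=> tT; rewrite subr_gt0 (le_lt_trans _ hT)// ler_wpM2l// mulr_ge0// ltW//.
pose m t := expR (- q^-1 * ln (y t)).
exists m; split=> [|t /andP[_ tT]|t s t0 s0 tsT].
- rewrite /m /y mulr0 subr0 /y0 ln_powR mulrA.
  rewrite (_ : - q^-1 * (lam - 1) = 1); last by rewrite /q; field; rewrite gt_eqF.
  by rewrite mul1r lnK.
- exact: expR_gt0.
- have tT : t <= T by apply: le_trans tsT; rewrite lerDl.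
  have y1 := yp _ tT; have y2 := yp _ tsT.
  have e1 : m t `^ (2 - lam) = m t * (y t)^-1.
    rewrite /powR gt_eqF ?expR_gt0// /m expRK.
    rewrite -[in (y t)^-1](@lnK _ (y t))// -expRN -expRD; congr expR.
    by rewrite /q; field; rewrite gt_eqF.
  pose sg := q * c * s / y t.
  have e2 : y (t + s) = y t * (1 - sg).
    by rewrite /sg /y; field; rewrite gt_eqF.
  have sg1 : 0 < 1 - sg by rewrite -(pmulr_rgt0 _ y1) -e2.
  have e3 : m (t + s) = m t * expR (- q^-1 * ln (1 - sg)).
    by rewrite /m e2 lnM ?posrE// mulrDr expRD.
  have e4 : m t + s * (c * (m t * (y t)^-1)) = m t * (1 + q^-1 * sg).
    by rewrite /sg; field; rewrite !gt_eqF.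
  rewrite e1 e3 e4 ler_wpM2l ?expR_ge0//.
  apply: le_trans (expR_ge1Dx _); rewrite lerD2l mulNr -mulrN ler_wpM2l//.
    by rewrite invr_ge0 ltW.
  by rewrite lerNr; have := le_ln1Dx (x := - sg); apply; rewrite ltrNl opprK -subr_gt0.
Qed.

(** An implicit Gronwall inequality. The term [C * (t' - t)], quadratic after the
    multiplication by the length, disappears from the conclusion because the
    partition can be refined. *)
Lemma gronwall_refine (D : R -> R) (T c e C : R) : 0 <= T -> 0 <= c -> 0 <= e ->
  0 <= C -> (forall t, 0 <= t <= T -> 0 <= D t) ->
  (forall t t', 0 <= t -> t <= t' -> t' <= T ->
     D t' <= D t + (t' - t) * (c * D t' + e + C * (t' - t))) ->
  D T <= expR (2 * c * T) * (D 0 + T * e).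
Proof.
move=> T0 c0 e0 C0 D0 hD.
apply/ler_addgt0Pr => eps eps0.
set E := expR (2 * c * T); have E0 : 0 < E by exact: expR_gt0.
(* so many subintervals that the implicit term can be absorbed and that the
   accumulated quadratic errors are at most [eps] *)
pose K := 2 * c * T + E * T * C * T / eps.
have K0 : 0 <= K.
  by rewrite addr_ge0 ?mulr_ge0 ?invr_ge0// ltW.
pose N := (Num.truncn K).+1.
have KN : K < N%:R by rewrite /N truncnS_gt.
have Np : (0 : R) < N%:R by rewrite ltr0n.
pose d := T / N%:R.
have d0 : 0 <= d by rewrite divr_ge0// ltW.
have Nd : N%:R * d = T by rewrite /d; field; rewrite gt_eqF.
have cd : 2 * (c * d) <= 1.
  rewrite /d !mulrA ler_pdivrMr// mul1r (le_trans _ (ltW KN))//.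
  by rewrite lerDl !mulr_ge0// ?invr_ge0// ltW.
have Ed : E * T * (C * d) <= eps.
  rewrite /d !mulrA ler_pdivrMr// -ler_pdivrMl// mulrC (le_trans _ (ltW KN))//.
  by rewrite lerDr !mulr_ge0.
pose e1 := e + C * d.
have e10 : 0 <= e1 by rewrite addr_ge0// mulr_ge0.
have ind i : (i <= N)%N ->
    D (i%:R * d) <= expR (2 * c * (i%:R * d)) * (D 0 + i%:R * d * e1).
  elim: i => [_|i IH iN]; first by rewrite !mul0r mulr0 expR0 mul1r addr0.
  have {}IH := IH (ltnW iN).
  have i0 : 0 <= i%:R * d by rewrite mulr_ge0.
  have iT : i.+1%:R * d <= T by rewrite -Nd ler_wpM2r// ler_nat.
  have ii : i%:R * d <= i.+1%:R * d by rewrite ler_wpM2r// ler_nat.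
  have := hD _ _ i0 ii iT.
  have ed : i.+1%:R * d - i%:R * d = d by rewrite -natr1; ring.
  have D1 : 0 <= D (i.+1%:R * d) by apply: D0; rewrite iT (le_trans i0 ii).
  have D2 : 0 <= D (i%:R * d) by apply: D0; rewrite i0 (le_trans ii iT).
  rewrite ed; set X := D (i.+1%:R * d) in D1 *; set Y := D (i%:R * d) in D2 IH *.
  rewrite -addrA -/e1 => hX.
  have h1 : X <= (1 + 2 * (c * d)) * (Y + d * e1).
    have h2 : X * (1 - c * d) <= Y + d * e1.
      by move: hX; rewrite (_ : d * (c * X + e1) = X * (c * d) + d * e1); [lra|ring].
    have cd0 : 0 <= c * d by rewrite mulr_ge0.
    have h3 : 0 <= 1 + 2 * (c * d) by rewrite addr_ge0// mulr_ge0.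
    apply: le_trans (ler_wpM2l h3 h2).
    have h4 : 0 <= X * (c * d) by rewrite mulr_ge0.
    have h5 : X * (c * d) * (2 * (c * d)) <= X * (c * d) * 1 by rewrite ler_wpM2l.
    by move: h4 h5; move: (c * d) => u; lra.
  apply: le_trans h1 _.
  rewrite (_ : 2 * c * (i.+1%:R * d) = 2 * (c * d) + 2 * c * (i%:R * d)); last first.
    by rewrite -natr1; ring.
  rewrite expRD -mulrA; apply: ler_pM.
  - by rewrite addr_ge0// !mulr_ge0.
  - by rewrite addr_ge0// mulr_ge0.
  - exact: expR_ge1Dx.
  - have h6 : 1 <= expR (2 * c * (i%:R * d)) by rewrite -expR0 ler_expR !mulr_ge0.
    have h7 : d * e1 <= expR (2 * c * (i%:R * d)) * (d * e1).
      by rewrite ler_peMl// mulr_ge0.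
    have h8 := lerD IH h7; apply: le_trans h8 _.
    by rewrite -mulrDr ler_wpM2l ?expR_ge0// -natr1 mulrDl mul1r mulrDl addrA.
have := ind N (leqnn _); rewrite Nd -/E /e1 => h; apply: le_trans h _.
by rewrite (_ : E * _ = E * (D 0 + T * e) + E * T * (C * d)) ?lerD2l//; ring.
Qed.

End RealLemmas.

(** * Approximate solutions and their stability *)

Lemma abs_diff_bound (R : realFieldType) (I1 I2 q1 q2 d r C h1 h2 Dt Ds e : R) :
  `|I1 - d * q1| <= r * C * (d * (d + h1)) ->
  `|I2 - d * q2| <= r * C * (d * (d + h2)) ->
  Dt - Ds <= I1 - I2 -> q1 - q2 <= e -> 0 <= d ->
  Dt <= Ds + d * e + (r * C * (d * (d + h1)) + r * C * (d * (d + h2))).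
Proof.
move=> /ler_normlP[_ h3] /ler_normlP[h4 _] h5 h6 d0.
have := ler_wpM2l d0 h6; rewrite mulrBr; lra.
Qed.

Section Approximation.
Context {R : realType}.
Local Notation mu := (@lebesgue_measure R).
Variables (beta beta0 : R) (k : R * R -> R) (bet : R * (R * R) -> R).
Hypothesis M : breakage_model beta beta0 k bet.

Let b0 := beta_ge0 M.
Let b1 := beta_le1 M.
Let b2 := beta0_gt2 M.

Local Notation wt := (@wt R).
Local Notation Wt := (Wt beta).
Local Notation state := (state beta).
Local Notation sstate := (sstate beta).
Local Notation Q := (Q k bet).
Implicit Types (f g u v phi : R -> R) (rho c A : R) (q : R * R).

(** A curve whose increments are averages of values of the collision operator taken
    at most [h] earlier. Euler polygons and solutions both satisfy this, with [h]
    the step and [h = 0] respectively. *)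
Definition mean_value (T h : R) (f : R -> R -> R) : Prop :=
  forall (phi : R -> R) (rho s t v e : R), mf1 phi -> (forall x, `|phi x| <= rho) ->
    0 <= s -> s <= t -> t <= T ->
    (forall r, 0 <= r -> s - h <= r -> r <= t -> `|Q phi (f r) - v| <= e) ->
    `|\int[mu]_x (phi x * (f t x - f s x)) - (t - s) * v| <= (t - s) * e.

Definition bounded_states (T A : R) (f : R -> R -> R) : Prop :=
  forall t, 0 <= t <= T -> state (f t) /\ \int[mu]_x (Wt x * f t x) <= A.

(** A quadratic defect, up to the lag [h]. For [h = 0] and bounded moments this is equivalent
    to the integrated equation, but it needs no integral in time and passes to limits. *)
Definition approx_sol (T h C : R) (f : R -> R -> R) : Prop :=
  forall (phi : R -> R) (rho s t : R), mf1 phi -> (forall x, `|phi x| <= rho) ->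
    0 <= s -> s <= t -> t <= T ->
    `|\int[mu]_x (phi x * (f t x - f s x)) - (t - s) * Q phi (f t)| <=
      rho * C * ((t - s) * (t - s + h)).

(** Monotone convergence removes the cut. *)
Lemma dist_cut_le (f : R -> R) c : sstate f ->
  (forall n : nat, \int[mu]_x (cut n%:R wt x * `|f x|) <= c) ->
  \int[mu]_x (wt x * `|f x|) <= c.
Proof.
move=> sf hc; have saf := sstate_abs sf; have [f1 _ _] := saf.
suff [] : ig mu (fun x => wt x * `|f x|) /\ \int[mu]_x (wt x * `|f x|) <= c by [].
apply: (@ig_exhaust _ _ R mu _ (fun n x => `|x| <= n%:R)).
- by apply: measurable_funM => //; exact: mf_wt.
- by move=> x; rewrite mulr_ge0// wt_ge0.
- by move=> x m n mn h; apply: le_trans h _; rewrite ler_nat.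
- by move=> x; exists (Num.truncn `|x|).+1; rewrite ltW// truncnS_gt.
- move=> n.
  have e x : (if `|x| <= n%:R then wt x * `|f x| else 0) = cut n%:R wt x * `|f x|.
    by rewrite /cut; case: ifP; rewrite ?mul0r.
  split; last by apply: le_trans (hc n); rewrite le_eqVlt; apply/orP; left; apply/eqP/I_eq.
  under eq_fun do rewrite e.
  apply: (sstate_ig saf (c := 4)); first by apply: mf_cut; exact: mf_wt.
  move=> x; rewrite ger0_norm ?cut_ge0 ?wt_ge0//.
  by apply: le_trans (cut_le _ (wt_ge0 _)) (le_trans (ler_norm _) (wt_le4 M x)).
Qed.

Lemma state_I_ge0 f A : state f -> \int[mu]_x (Wt x * f x) <= A -> 0 <= A.
Proof.
move=> [_ f0 _ _]; apply: le_trans; apply: I_ge0 => x.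
by rewrite mulr_ge0// Wt_ge0.
Qed.

(** Test the increment with its own sign. *)
Lemma mean_value_lip (T h A s t : R) (f : R -> R -> R) : mean_value T h f -> bounded_states T A f ->
  0 <= s -> s <= t -> t <= T ->
  \int[mu]_x (wt x * `|f t x - f s x|) <= (t - s) * (16 * (beta0 + 2) * (A * A)).
Proof.
move=> hm hb s0 st tT.
have [sf _] := hb s (introT andP (conj s0 (le_trans st tT))).
have [tf _] := hb t (introT andP (conj (le_trans s0 st) tT)).
have sE := sstateB (state_sstate tf) (state_sstate sf); have [mE _ _] := sE.
apply: dist_cut_le => // n.
pose E x := f t x - f s x.
have hm' := hm (dtest n%:R E) (1 + n%:R) s t 0 (16 * (beta0 + 2) * (A * A))
  (mf_dtest n%:R mE) (fun x => dtest_le_rho E x (ler0n _ n)) s0 st tT.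
have {}hm' := hm' _; rewrite mulr0 subr0 in hm'.
have -> : \int[mu]_x (cut n%:R wt x * `|f t x - f s x|) =
    \int[mu]_x (dtest n%:R E x * E x) by apply: I_eq => x; rewrite dtestM.
apply: le_trans (ler_norm _) _; apply: hm' => r r0 _ rt; rewrite subr0.
have [rf rA] : state (f r) /\ \int[mu]_x (Wt x * f r x) <= A.
  by apply: hb; rewrite r0 (le_trans rt).
apply: (Q_bound M (rho := 1 + n%:R) (mf_dtest n%:R mE) _ _ rf rA).
  by move=> x; apply: dtest_le_rho.
by move=> x; exact: dtest_le_wt.
Qed.

(** Lipschitz continuity in time makes the average close to the final value. *)
Lemma mean_value_approx (T h A : R) (f : R -> R -> R) : 0 <= h -> mean_value T h f -> bounded_states T A f ->
  approx_sol T h ((16 * (beta0 + 2)) * A * (16 * (beta0 + 2) * (A * A))) f.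
Proof.
move=> h0 hm hb phi rho s t mphi hrho s0 st tT.
have t0 := le_trans s0 st.
have r0 : 0 <= rho by rewrite (le_trans _ (hrho 0)).
have [tf tA] : state (f t) /\ \int[mu]_x (Wt x * f t x) <= A by apply: hb; rewrite t0.
have A0 := state_I_ge0 tf tA.
set c := 16 * (beta0 + 2); have c0 : 0 <= c by rewrite mulr_ge0// addr_ge0// ltW// (lt_trans _ b2).
pose e := rho * c * A * ((t - s + h) * (c * (A * A))).
rewrite [leRHS](_ : _ = (t - s) * e); last by rewrite /e; ring.
apply: (hm phi rho) => // r rp sr rt.
have [rf rA] : state (f r) /\ \int[mu]_x (Wt x * f r x) <= A.
  by apply: hb; rewrite rp (le_trans rt).
rewrite distrC; apply: le_trans (Q_lip M mphi hrho tf rf tA rA) _.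
rewrite -/c /e; apply: ler_wpM2l; first by rewrite mulr_ge0// mulr_ge0.
apply: le_trans (mean_value_lip hm hb rp rt tT) _.
apply: ler_wpM2r; first by rewrite mulr_ge0// mulr_ge0.
by rewrite -addrA lerD2l lerNl opprD opprK.
Qed.

(** The one-sided estimate holds at the end of each small interval, whence the
    implicit form of the Gronwall inequality that is used. *)
Lemma approx_stab (T h1 h2 C A r tau : R) (f g : R -> R -> R) : 0 <= T -> 0 <= h1 -> 0 <= h2 -> 0 <= C ->
  0 <= r -> approx_sol T h1 C f -> approx_sol T h2 C g ->
  bounded_states T A f -> bounded_states T A g ->
  (forall t, 0 <= t <= T -> \int[mu]_x (out r Wt x * f t x) <= tau /\
     \int[mu]_x (out r Wt x * g t x) <= tau) ->
  let c := 16 * (beta0 + 1) * A in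
  is_true (\int[mu]_x (cut r wt x * `|f T x - g T x|) <= expR (2 * c * T) *
    (\int[mu]_x (cut r wt x * `|f 0 x - g 0 x|) +
     T * (c * (10 * tau) + (1 + r) * C * (h1 + h2)))).
Proof.
move=> T0 h10 h20 C0 r0 hf hg bf bg ht c.
have [f0 f0A] : state (f 0) /\ \int[mu]_x (Wt x * f 0 x) <= A by apply: bf; rewrite lexx.
have A0 := state_I_ge0 f0 f0A.
have c0 : 0 <= c.
  by rewrite !mulr_ge0// addr_ge0// ltW// (lt_trans _ b2).
have tau0 : 0 <= tau.
  have [h _] := ht 0 (introT andP (conj (lexx 0) T0)).
  apply: le_trans h; apply: I_ge0 => x; have [_ p _ _] := f0.
  by rewrite mulr_ge0// out_ge0// Wt_ge0.
pose D t := \int[mu]_x (cut r wt x * `|f t x - g t x|).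
apply: (@gronwall_refine _ D T c _ (2 * ((1 + r) * C))) => //.
- apply: addr_ge0; first by apply: mulr_ge0 => //; apply: mulr_ge0.
  by apply: mulr_ge0; [apply: mulr_ge0 => //|]; apply: addr_ge0.
- by apply: mulr_ge0 => //; apply: mulr_ge0 => //; apply: addr_ge0.
- by move=> t _; apply: I_ge0 => x; rewrite mulr_ge0// cut_ge0// wt_ge0.
move=> s t s0 st tT; have t0 := le_trans s0 st; have sT := le_trans st tT.
have tin : 0 <= t <= T by rewrite t0.
have sin : 0 <= s <= T by rewrite s0.
have [ft ftA] := bf _ tin; have [gt gtA] := bg _ tin.
have [fs fsA] := bf _ sin; have [gs gsA] := bg _ sin.
have [tf tg] := ht _ tin.
pose E := fun x => f t x - g t x.
pose G := fun x => f s x - g s x.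
have sE : sstate E := sstateB (state_sstate ft) (state_sstate gt).
have sG : sstate G := sstateB (state_sstate fs) (state_sstate gs).
have sdf := sstateB (state_sstate ft) (state_sstate fs).
have sdg := sstateB (state_sstate gt) (state_sstate gs).
have [mE _ _] := sE.
pose phi := dtest r E.
have mphi : mf1 phi by exact: mf_dtest.
have hrho x : `|phi x| <= 1 + r by exact: dtest_le_rho.
have af := hf phi _ s t mphi hrho s0 st tT.
have ag := hg phi _ s t mphi hrho s0 st tT.
have dis : Q phi (f t) - Q phi (g t) <= c * (D t + 10 * tau).
  exact: (Q_dissip M r0 ft gt ftA gtA tf tg).
have icut u : sstate u -> ig mu (fun x => cut r wt x * `|u x|).
  move=> su; apply: (sstate_ig (sstate_abs su) (c := 4)).
    by apply: mf_cut; exact: mf_wt.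
  move=> x; rewrite ger0_norm ?cut_ge0 ?wt_ge0//.
  by apply: le_trans (cut_le _ (wt_ge0 _)) (le_trans (ler_norm _) (wt_le4 M x)).
have DD : D t - D s <= \int[mu]_x (phi x * (f t x - f s x)) -
    \int[mu]_x (phi x * (g t x - g s x)).
  have if1 := sstate_bd sdf mphi hrho; have ig1 := sstate_bd sdg mphi hrho.
  rewrite /D -I_B; [|exact: (icut _ sE)|exact: (icut _ sG)].
  rewrite -I_B//; apply: I_le.
  - by apply: igB; [exact: (icut _ sE)|exact: (icut _ sG)].
  - exact: igB.
  - move=> x.
    rewrite (_ : phi x * (f t x - f s x) - phi x * (g t x - g s x) =
                 phi x * E x - phi x * G x); last by rewrite /E /G; ring.
    rewrite /phi dtestM lerD2l lerN2 (le_trans (ler_norm _))// normrM.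
    by rewrite dtest_norm.
have d0 : 0 <= t - s by rewrite subr_ge0.
have ed := abs_diff_bound af ag DD dis d0.
rewrite /D in ed *; apply: le_trans ed _.
rewrite le_eqVlt; apply/orP; left; apply/eqP; ring.
Qed.

End Approximation.

(** * Euler polygons *)

Section NatSelection.
Context d (T : measurableType d) (R : realType).

(** Needed for the joint measurability of a curve that is defined cell by cell. *)
Lemma mf_nat_select (n : T -> nat) (F : nat -> T -> R) :
  mf (fun p => (n p)%:R : R) -> (forall k, mf (F k)) -> mf (fun p => F (n p) p).
Proof.
move=> mn mF.
pose E k := [set p | (n p)%:R == k%:R :> R].
have mE k : measurable (E k).
  have := measurable_fun_eqr mn (measurable_cst (k%:R : R)).
  move=> /(_ measurableT [set true] I); rewrite setTI.
  by congr measurable; apply/seteqP; split => p /=.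
have -> : [set: T] = \bigcup_k E k.
  by apply/seteqP; split => // p _; exists (n p) => //=; rewrite /E /= eqxx.
apply/measurable_fun_bigcup => // k.
apply: (eq_measurable_fun (F k)); last exact: measurable_funTS.
by move=> p; rewrite inE /E /= eqr_nat => /eqP ->.
Qed.

End NatSelection.

Lemma norm_split_le (R : realFieldType) (X Y d1 d2 d3 v e : R) :
  `|X - (d2 - d1) * v| <= (d2 - d1) * e -> `|Y - (d3 - d2) * v| <= (d3 - d2) * e ->
  `|Y + X - (d3 - d1) * v| <= (d3 - d1) * e.
Proof.
move=> /ler_normlP[h1 h2] /ler_normlP[h3 h4]; apply/ler_normlP; split; lra.
Qed.

Section Polygon.
Context {R : realType}.
Local Notation mu := (@lebesgue_measure R).
Variables (beta beta0 : R) (k : R * R -> R) (bet : R * (R * R) -> R).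
Hypothesis M : breakage_model beta beta0 k bet.

Let b0 := beta_ge0 M.
Let b1 := beta_le1 M.
Let b2 := beta0_gt2 M.

Local Notation kap := (kap beta).
Local Notation Wt := (Wt beta).
Local Notation state := (state beta).
Local Notation sstate := (sstate beta).
Local Notation Q := (Q k bet).
Implicit Types (f g u v phi : R -> R) (rho c A : R) (q : R * R).

Local Notation mR := (measurableTypeR R).
Local Notation B := (B k bet).
Local Notation step := (step k bet).

Variable alpha : R.
Hypothesis a0 : 0 <= alpha.
Hypothesis ab : alpha <= beta.
Hypothesis k_split : forall q, k q <=
  `|q.1| `^ alpha * `|q.2| `^ beta + `|q.1| `^ beta * `|q.2| `^ alpha.

Variables (h : R) (u0 : R -> R).
Hypothesis h0 : 0 < h.

Fixpoint euler (i : nat) : R -> R := if i is j.+1 then step h (euler j) else u0.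

(** The state reached in the current cell by a partial step. *)
Definition polygon (t : R) : R -> R :=
  let i := Num.truncn (t / h) in step (t - i%:R * h) (euler i).

Lemma polygon_cell i t x : i%:R * h <= t <= i.+1%:R * h ->
  polygon t x = euler i x + (t - i%:R * h) * B (euler i) x.
Proof.
move=> /andP[it ti]; rewrite /polygon.
have [e|lt] := eqVneq t (i.+1%:R * h).
  have eh : i.+1%:R * h - i%:R * h = h by rewrite -natr1; ring.
  by rewrite e eh mulfK ?gt_eqF// natrK subrr {1}/step mul0r addr0 /= /step.
rewrite (_ : Num.truncn (t / h) = i)//; apply: truncn_def.
by rewrite ler_pdivlMr// it ltr_pdivrMr// lt_neqAle lt.
Qed.

Lemma truncn_cell t : 0 <= t ->
  let i := Num.truncn (t / h) in i%:R * h <= t <= i.+1%:R * h.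
Proof.
move=> t0 /=; have := truncn_itv (divr_ge0 t0 (ltW h0)).
by rewrite ler_pdivlMr// ltr_pdivrMr// => /andP[-> /ltW ->].
Qed.

Hypothesis mu0 : mf1 u0.

Lemma mf_euler i : mf1 (euler i).
Proof. by elim: i => //= i IH; exact: (mf_step M). Qed.

Lemma mf_polygon2 : mf2 (fun p : R * R => polygon p.1 p.2).
Proof.
pose F i (p : mR * mR) := step (p.1 - i%:R * h) (euler i) p.2.
have mF i : mf2 (F i).
  rewrite /F /step; apply: measurable_funD; first exact: (mf_snd (mf_euler i)).
  apply: measurable_funM; last exact: (mf_snd (mf_B M (mf_euler i))).
  by apply: measurable_funB; [exact: measurable_fst|exact: measurable_cst].
have mn : mf1 (fun t => (Num.truncn (t / h))%:R : R).
  apply: nondecreasing_measurable => // s t st.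
  by rewrite ler_nat le_truncn// ler_wpM2r// invr_ge0 ltW.
exact: (mf_nat_select (mf_fst mn) mF).
Qed.

Variables (T n A M1 : R) (m : R -> R).
Hypothesis n0 : 0 <= n.
Hypothesis u0s : state u0.
Hypothesis u0n : supp n u0.
Hypothesis M1_gt0 : 0 < M1.
Hypothesis u0_mass : \int[mu]_x (x * u0 x) <= M1.
Hypothesis m_init : \int[mu]_x u0 x <= m 0.
Hypothesis m_gt0 : forall t, 0 <= t <= T -> 0 < m t.
Hypothesis m_super : forall t s, 0 <= t -> 0 <= s -> t + s <= T ->
  m t + s * ((beta0 - 2) * M1 `^ (alpha + beta) * m t `^ (2 - (alpha + beta)))
   <= m (t + s).
Hypothesis hA : m T + \int[mu]_x (x * `|x| `^ beta * u0 x) <= A.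
Hypothesis hh : h * (8 * kap n * A) <= 1.

(** One inequality for the mass, the moment of order [1 + beta] and its tails. *)
Definition conv_le f : Prop := forall th : R -> R, mf1 th -> (forall z, 0 <= th z) ->
  (forall z z', 0 < z -> z <= z' -> th z <= th z') ->
  \int[mu]_x (x * th x * f x) <= \int[mu]_x (x * th x * u0 x).

Definition euler_inv t f : Prop :=
  [/\ state f, supp n f, \int[mu]_x f x <= m t,
      \int[mu]_x (x * f x) = \int[mu]_x (x * u0 x) & conv_le f].

Lemma m_mono t : 0 <= t <= T -> m t <= m T.
Proof.
move=> /andP[t0 tT]; have Tt : 0 <= T - t by rewrite subr_ge0.
have := @m_super t (T - t) t0 Tt; rewrite addrC subrK lexx => /(_ isT).
apply: le_trans; rewrite lerDl mulr_ge0//.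
by rewrite !mulr_ge0 ?powR_ge0// subr_ge0 ltW.
Qed.

Lemma euler_inv_A t f : 0 <= t <= T -> euler_inv t f -> \int[mu]_x (Wt x * f x) <= A.
Proof.
move=> tT [sf _ nf _ cf]; apply: le_trans hA.
have [f1 f0 fn _] := sf; have ss := state_sstate sf.
have e x : Wt x * f x = f x + x * `|x| `^ beta * f x.
  have [x0|x0] := leP x 0; first by rewrite fn// !mulr0 addr0.
  by rewrite /Wt powRD1// (gtr0_norm x0) mulrDl mul1r.
have i1 := sstate_1 ss.
have i2 : ig mu (fun x => x * `|x| `^ beta * f x).
  have := igB (sstate_Wt ss) i1; congr (_.-integrable _ _).
  by apply/funext => x /=; rewrite e addrC addKr.
rewrite (_ : \int[mu]_x _ = \int[mu]_x (f x + x * `|x| `^ beta * f x)); last first.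
  exact: I_eq.
rewrite I_D//; apply: lerD; first by rewrite (le_trans nf)// m_mono.
apply: cf; first exact: mf_powabs.
  by move=> z; exact: powR_ge0.
move=> z z' z0 zz; rewrite ge0_ler_powR// ?nnegrE//.
by rewrite !gtr0_norm// (lt_le_trans z0).
Qed.

Lemma euler_inv_step t s f : 0 <= t -> 0 <= s <= h -> t + s <= T ->
  euler_inv t f -> euler_inv (t + s) (step s f).
Proof.
move=> t0 /andP[s0 sh] tsT hi.
have tT : 0 <= t <= T by rewrite t0 (le_trans _ tsT)// lerDl.
have fA := euler_inv_A tT hi; have [sf nf If mf cf] := hi.
have A0 := state_I_ge0 sf fA.
have sA : s * (8 * kap n * A) <= 1.
  apply: le_trans hh; apply: ler_wpM2r => //.
  by rewrite !mulr_ge0// kap_ge0.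
have [s1 s2] := step_state M s0 sf nf fA sA.
split=> //.
- apply: le_trans (m_super t0 s0 tsT).
  apply: (step_num M a0 ab k_split) => //; first exact: m_gt0.
  by rewrite mf.
- by rewrite (step_mass M n0 s0 sf nf fA sA).
- move=> th m1 m2 m3; apply: le_trans (cf th m1 m2 m3).
  exact: (step_conv M n0 s0 sf nf fA sA).
Qed.

Lemma euler_inv0 : euler_inv 0 u0.
Proof. by split. Qed.

Lemma euler_inv_cell i : i%:R * h <= T -> euler_inv (i%:R * h) (euler i).
Proof.
elim: i => [_|i IH iT]; first by rewrite mul0r; exact: euler_inv0.
have e : i.+1%:R * h = i%:R * h + h by rewrite -natr1; ring.
rewrite e; apply: euler_inv_step.
- by rewrite mulr_ge0// ltW.
- by rewrite lexx ltW.
- by rewrite -e.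
- by apply: IH; apply: le_trans iT; rewrite e lerDl ltW.
Qed.

Lemma polygon_inv t : 0 <= t <= T -> euler_inv t (polygon t).
Proof.
move=> /andP[t0 tT]; have /andP[h1 h2] := truncn_cell t0.
set i := Num.truncn (t / h) in h1 h2.
have e : t = i%:R * h + (t - i%:R * h) by ring.
rewrite {1}e /polygon -/i; apply: euler_inv_step.
- by rewrite mulr_ge0// ltW.
- rewrite subr_ge0 h1/= lerBlDl; apply: le_trans h2 _.
  by rewrite -natr1 mulrDl mul1r.
- by rewrite -e.
- by apply: euler_inv_cell; exact: le_trans tT.
Qed.

Lemma polygon_bounded : bounded_states beta T A polygon.
Proof.
move=> t tT; have hi := polygon_inv tT; split; first by case: hi.
exact: euler_inv_A hi.
Qed.

(** An increment inside one cell is a multiple of the operator at the left end; the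
    general case is a sum of such increments. *)
Lemma polygon_mean_value : mean_value k bet T h polygon.
Proof.
move=> phi rho s t v e mphi hrho s0 st tT hv.
have st_bd r : 0 <= r -> r <= T -> sstate (polygon r).
  move=> r1 r2; have [] := @polygon_bounded r; first by rewrite r1.
  by move=> /state_sstate.
have cell i r1 r2 : i%:R * h <= r1 -> r1 <= r2 -> r2 <= i.+1%:R * h ->
    r2 <= T -> s <= r1 -> r2 <= t ->
    `|\int[mu]_x (phi x * (polygon r2 x - polygon r1 x)) - (r2 - r1) * v| <=
      (r2 - r1) * e.
  move=> i1 r12 i2 r2T sr r2t.
  have ih0 : 0 <= i%:R * h by rewrite mulr_ge0// ltW.
  have iT : i%:R * h <= T by rewrite (le_trans i1)// (le_trans r12).
  have [sf _ _ _ _] := euler_inv_cell iT.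
  have [iB eB] := B_pairing M mphi hrho sf.
  have -> : \int[mu]_x (phi x * (polygon r2 x - polygon r1 x)) =
      (r2 - r1) * Q phi (euler i).
    rewrite -eB -I_Z//; apply: I_eq => x.
    rewrite !(@polygon_cell i) ?i2 ?i1 ?(le_trans i1 r12) ?(le_trans r12 i2)//.
    by ring.
  have -> : euler i = polygon (i%:R * h).
    apply/funext => x; rewrite (@polygon_cell i) ?subrr ?mul0r ?addr0//.
    by rewrite lexx ler_wpM2r ?(ltW h0)// ler_nat leqnSn.
  rewrite -mulrBr normrM ger0_norm ?subr_ge0// ler_wpM2l ?subr_ge0//.
  apply: hv => //; last by rewrite (le_trans i1)// (le_trans r12).
  rewrite lerBlDr (le_trans sr)// (le_trans r12)// (le_trans i2)//.
  by rewrite -natr1 mulrDl mul1r.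
have glue r1 r2 r3 : s <= r1 -> r1 <= r2 -> r2 <= r3 -> r3 <= t ->
    `|\int[mu]_x (phi x * (polygon r2 x - polygon r1 x)) - (r2 - r1) * v| <=
      (r2 - r1) * e ->
    `|\int[mu]_x (phi x * (polygon r3 x - polygon r2 x)) - (r3 - r2) * v| <=
      (r3 - r2) * e ->
    `|\int[mu]_x (phi x * (polygon r3 x - polygon r1 x)) - (r3 - r1) * v| <=
      (r3 - r1) * e.
  move=> sr1 r12 r23 r3t e1 e2.
  have r3T := le_trans r3t tT.
  have p1 := st_bd r1 (le_trans s0 sr1) (le_trans (le_trans r12 r23) r3T).
  have p2 := st_bd r2 (le_trans s0 (le_trans sr1 r12)) (le_trans r23 r3T).
  have p3 := st_bd r3 (le_trans s0 (le_trans sr1 (le_trans r12 r23))) r3T.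
  have -> : \int[mu]_x (phi x * (polygon r3 x - polygon r1 x)) =
     \int[mu]_x (phi x * (polygon r3 x - polygon r2 x)) +
     \int[mu]_x (phi x * (polygon r2 x - polygon r1 x)).
    have i1 := sstate_bd (sstateB p3 p2) mphi hrho.
    have i2 := sstate_bd (sstateB p2 p1) mphi hrho.
    by rewrite -(I_D i1 i2); apply: I_eq => x; ring.
  exact: norm_split_le e1 e2.
have main i : forall r, s <= r -> r <= t -> r <= i%:R * h ->
    `|\int[mu]_x (phi x * (polygon r x - polygon s x)) - (r - s) * v| <= (r - s) * e.
  elim: i => [|i IH] r sr rt ri.
    rewrite mul0r in ri; have es : s = r.
      by apply/eqP; rewrite eq_le sr (le_trans ri).
    rewrite -es subrr !mul0r subr0.
    suff -> : \int[mu]_x (phi x * (polygon s x - polygon s x)) = 0 by rewrite normr0.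
    by rewrite -[RHS](I_0 mu); apply: I_eq => x; rewrite subrr mulr0.
  have [ri'|ri'] := leP r (i%:R * h); first exact: IH.
  have rT := le_trans rt tT.
  have [is'|is'] := leP (i%:R * h) s; first by apply: (cell i).
  apply: (glue s (i%:R * h) r) => //; try exact: ltW.
    by apply: IH => //; [exact: ltW|exact: ltW (lt_le_trans ri' rt)].
  by apply: (cell i) => //; exact: ltW.
apply: (main (Num.truncn (t / h)).+1) => //.
by have /andP[] := truncn_cell (le_trans s0 st).
Qed.

End Polygon.

(** * Passage to the limit *)

Section FastCauchy.
Context {R : realType}.
Implicit Types (v : nat -> R).

Lemma sum_pow_half (j N : nat) :
  \sum_(i < N) (2^-1 : R) ^+ (j + i) <= 2 * 2^-1 ^+ j.
Proof.
suff -> : \sum_(i < N) (2^-1 : R) ^+ (j + i) = 2 * 2^-1 ^+ j - 2 * 2^-1 ^+ (j + N).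
  by rewrite gerBl mulr_ge0// exprn_ge0// invr_ge0.
elim: N => [|N IH]; first by rewrite big_ord0 addn0 subrr.
by rewrite big_ord_recr/= IH addnS [in RHS]exprS; field.
Qed.

Lemma summable_increments v (G w : R) : 1 <= w ->
  (forall N, \sum_(i < N) w * `|v i.+1 - v i| <= G) ->
  exists l, v @ \oo --> l /\ w * `|v 0%N - l| <= G.
Proof.
move=> w1 hG; have w0 : 0 < w by exact: lt_le_trans w1.
have cn : cvgn [normed series (telescope v)].
  apply: nondecreasing_is_cvgn.
    by apply: nondecreasing_series => i _ _ /=; exact: normr_ge0.
  exists G => _ [N _ <-] /=; apply: le_trans (hG N); rewrite seriesEord /=.
  by apply: ler_sum => i _; rewrite ler_peMl.
have := normed_cvg cn; rewrite telescopeK => /cvg_ex[l hl].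
exists (l + v 0%N).
have hv : v @ \oo --> l + v 0%N.
  suff : (fun n => (v n - v 0%N) + v 0%N) @ \oo --> l + v 0%N.
    by under eq_fun do rewrite subrK.
  by apply: cvgD; [exact: hl|exact: cvg_cst].
split=> //.
have cN : (w * `|v 0%N - v N|) @[N --> \oo] --> w * `|v 0%N - (l + v 0%N)|.
  apply: cvgM; first exact: cvg_cst.
  apply: cvg_norm; apply: cvgB => //; exact: cvg_cst.
have hle N : w * `|v 0%N - v N| <= G.
  apply: le_trans (hG N); rewrite -mulr_sumr ler_pM2l// distrC.
  by rewrite -(telescope_sumr v (leq0n N)) big_mkord ler_norm_sum.
rewrite -(cvg_lim _ cN)//; apply: limr_le; first by apply/cvg_ex; eexists; exact: cN.
by near=> N; exact: hle.
Unshelve. all: by end_near.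
Qed.

End FastCauchy.
Lemma defect_perturb (R : realFieldType) (a b c d q q' D X Y Z : R) :
  `|a - b - D * q| <= X -> `|a - c| <= Y -> `|b - d| <= Y -> `|q - q'| <= Z ->
  0 <= D -> `|c - d - D * q'| <= X + 2 * Y + D * Z.
Proof.
move=> /ler_normlP[h1 h2] /ler_normlP[h3 h4] /ler_normlP[h5 h6].
move=> /ler_normlP[h7 h8] D0.
have := ler_wpM2l D0 h7; have := ler_wpM2l D0 h8; rewrite mulrN !mulrBr => h9 h10.
by apply/ler_normlP; split; lra.
Qed.

Section Limits.
Context {R : realType}.
Local Notation mu := (@lebesgue_measure R).
Variables (beta beta0 : R) (k : R * R -> R) (bet : R * (R * R) -> R).
Hypothesis M : breakage_model beta beta0 k bet.

Let b0 := beta_ge0 M.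
Let b1 := beta_le1 M.
Let b2 := beta0_gt2 M.

Local Notation wt := (@wt R).
Local Notation Wt := (Wt beta).
Local Notation state := (state beta).
Local Notation sstate := (sstate beta).
Implicit Types (f g u v phi : R -> R) (rho c A : R) (q : R * R).

(** A sequence with summable distances converges almost everywhere and in the
    weighted distance. The limit is prescribed pointwise by [v], so that one
    jointly measurable curve can serve at all times. *)
Lemma fast_limit (u : nat -> R -> R) (v : R -> R) (j : nat) :
  (forall i, (j <= i)%N -> sstate (u i)) ->
  (forall i, (j <= i)%N -> \int[mu]_x (wt x * `|u i.+1 x - u i x|) <= 2^-1 ^+ i) ->
  mf1 v -> (forall x l, u ^~ x @ \oo --> l -> v x = l) ->
  ig mu (fun x => wt x * `|u j x - v x|) /\
  \int[mu]_x (wt x * `|u j x - v x|) <= 2 * 2^-1 ^+ j.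
Proof.
move=> su hu mv hv.
pose g i x := wt x * `|u (j + i).+1 x - u (j + i)%N x|.
have sg i : sstate (fun x => u (j + i).+1 x - u (j + i)%N x).
  by apply: sstateB; apply: su; rewrite ?leq_addr// -addnS leq_addr.
have gi i : ig mu (g i) by exact: (sstate_wt M (sstate_abs (sg i))).
have g0 i x : 0 <= g i x by rewrite mulr_ge0// wt_ge0.
have Ig i : \int[mu]_x g i x <= 2^-1 ^+ (j + i) by apply: hu; rewrite leq_addr.
pose G x := (\sum_(i <oo) (g i x)%:E)%E.
have mg i : measurable_fun setT (EFin \o g i).
  by apply/measurable_EFinP; exact: ig_mf (gi i).
have IG : (\int[mu]_x G x <= (2 * 2^-1 ^+ j)%:E)%E.
  rewrite integral_nneseries//; last by move=> n x _; rewrite lee_fin.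
  apply: lime_le.
    by apply: is_cvg_nneseries => n _ _; apply: integral_ge0 => x _; rewrite lee_fin.
  near=> N; rewrite (eq_bigr (fun i => (\int[mu]_x g i x)%:E)).
    rewrite sumEFin lee_fin big_mkord; apply: le_trans (sum_pow_half j N).
    by apply: ler_sum => i _; exact: Ig.
  by move=> i _; rewrite I_EFin.
have mG : measurable_fun setT G.
  apply: (@ge0_emeasurable_sum _ _ _ _ (fun i x => (g i x)%:E) xpredT).
    by move=> i x _ _; rewrite lee_fin.
  by move=> i _; exact: mg.
have G0 x : (0 <= G x)%E by apply: nneseries_ge0 => i _ _; rewrite lee_fin.
have iG : mu.-integrable setT G.
  apply/integrableP; split; first exact: mG.
  have -> : (\int[mu]_x `|G x| = \int[mu]_x G x)%E.
    by apply: eq_integral => x _; rewrite gee0_abs.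
  by apply: le_lt_trans IG _; rewrite ltry.
have hle : {ae mu, forall x, ((wt x * `|u j x - v x|)%:E <= G x)%E}.
  have := integrable_ae measurableT iG; apply: filterS => x /(_ I) fG.
  have hG N : \sum_(i < N) wt x * `|u (j + i).+1 x - u (j + i)%N x| <= fine (G x).
    rewrite -lee_fin fineK// -sumEFin -(big_mkord xpredT (fun i => (g i x)%:E)).
    by apply: nneseries_lim_ge => i _ _; rewrite lee_fin.
  have hG' N : \sum_(i < N) wt x * `|u (j + i.+1)%N x - u (j + i)%N x| <= fine (G x).
    apply: le_trans (hG N); rewrite le_eqVlt; apply/orP; left; apply/eqP.
    by apply: eq_bigr => i _; rewrite addnS.
  have [l [cl lG]] := @summable_increments _ (fun i => u (j + i)%N x) _ _ (wt_ge1 x) hG'.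
  have cu : u ^~ x @ \oo --> l.
    rewrite -(cvg_shiftn j) /=.
    by under eq_fun do rewrite addnC; exact: cl.
  by rewrite (hv _ _ cu) -(fineK fG) lee_fin; move: lG; rewrite addn0.
have muv : mf1 (fun x => wt x * `|u j x - v x|).
  apply: measurable_funM; first exact: mf_wt.
  apply: measurableT_comp => //; apply: measurable_funB => //.
  by have [] := su j (leqnn _).
apply: ig_bound => //; first by move=> x; rewrite mulr_ge0// wt_ge0.
apply: le_trans IG; apply: ae_ge0_le_integral => //.
- by move=> x _; rewrite lee_fin mulr_ge0// wt_ge0.
- exact/measurable_EFinP.
- by apply: ae_imp hle => x hx _.
Unshelve. all: by end_near. Qed.

(** On a bounded set the weight is bounded by a multiple of [wt], so that the bound
    passes to the limit there; then the set is enlarged. *)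
Lemma weight_limit (om v : R -> R) c : mf1 om ->
  (forall x, 0 <= om x <= Wt x) -> mf1 v -> (forall x, 0 <= v x) ->
  (forall d, 0 < d -> exists u, [/\ state u, \int[mu]_x (om x * u x) <= c,
     ig mu (fun x => wt x * `|u x - v x|) &
     \int[mu]_x (wt x * `|u x - v x|) <= d]) ->
  ig mu (fun x => om x * v x) /\ \int[mu]_x (om x * v x) <= c.
Proof.
move=> mom hom mv v0 hlim.
apply: (@ig_exhaust _ _ R mu _ (fun n x => `|x| <= n%:R)).
- exact: measurable_funM.
- by move=> x; rewrite mulr_ge0//; have /andP[] := hom x.
- by move=> x m n mn h; apply: le_trans h _; rewrite ler_nat.
- by move=> x; exists (Num.truncn `|x|).+1; rewrite ltW// truncnS_gt.
move=> n.
have mcv : mf1 (fun x => if `|x| <= n%:R then om x * v x else 0).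
  apply: measurable_fun_ifT => //; first exact: mf_ball.
  exact: measurable_funM.
have Wn0 : 0 < Wt n%:R by exact: lt_le_trans (Wt_ge1 _ _).
have key d : 0 < d ->
    ig mu (fun x => if `|x| <= n%:R then om x * v x else 0) /\
    \int[mu]_x (if `|x| <= n%:R then om x * v x else 0) <= c + d.
  move=> d0; have dW : 0 < d / Wt n%:R by rewrite divr_gt0.
  have [u [su uc iuv uv]] := hlim _ dW; have [u1 u0 un _] := su.
  have i1 : ig mu (fun x => om x * u x).
    apply: (sstate_ig (state_sstate su) mom (c := 1)) => x; rewrite mul1r.
    by have /andP[h1 h2] := hom x; rewrite ger0_norm.
  have i2 := igD i1 (igZ (Wt n%:R) iuv).
  have hle x : (if `|x| <= n%:R then om x * v x else 0) <=
      om x * u x + Wt n%:R * (wt x * `|u x - v x|).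
    have /andP[h1 h2] := hom x.
    case: ifP => hx; last first.
      rewrite addr_ge0 ?mulr_ge0 ?wt_ge0//; exact: ltW.
    rewrite -lerBlDl -mulrBr.
    apply: (@le_trans _ _ (om x * `|u x - v x|)).
      by rewrite ler_wpM2l// distrC ler_norm.
    rewrite mulrA ler_wpM2r//; apply: (@le_trans _ _ (Wt n%:R)).
      apply: le_trans h2 _; rewrite /Wt lerD2l ge0_ler_powR ?nnegrE ?addr_ge0//.
      by rewrite [leRHS]ger0_norm.
    by rewrite ler_peMr ?wt_ge1// ltW.
  have i0 : ig mu (fun x => if `|x| <= n%:R then om x * v x else 0).
    apply: (ig_le mcv i2) => x; rewrite ger0_norm//.
    by case: ifP => // _; rewrite mulr_ge0//; have /andP[] := hom x.
  split=> //; apply: (le_trans (I_le i0 i2 hle)).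
  rewrite I_D//; last exact: igZ.
  apply: lerD => //; rewrite I_Z//.
  by rewrite mulrC -ler_pdivlMr.
split; first by have [] := key 1 ltr01.
by apply/ler_addgt0Pr => d d0; have [] := key d d0.
Qed.

Lemma state_limit (v : R -> R) A : mf1 v -> (forall x, 0 <= v x) ->
  (forall x, x <= 0 -> v x = 0) ->
  (forall d, 0 < d -> exists u, [/\ state u, \int[mu]_x (Wt x * u x) <= A,
     ig mu (fun x => wt x * `|u x - v x|) &
     \int[mu]_x (wt x * `|u x - v x|) <= d]) ->
  state v /\ \int[mu]_x (Wt x * v x) <= A.
Proof.
move=> mv v0 vn hlim.
have hW x : 0 <= Wt x <= Wt x by rewrite Wt_ge0 lexx.
by have [] := weight_limit (mf_Wt beta) hW mv v0 hlim.
Qed.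

Lemma pairing_close phi rho (u v : R -> R) : mf1 phi -> (forall x, `|phi x| <= rho) ->
  state u -> state v ->
  `|\int[mu]_x (phi x * u x) - \int[mu]_x (phi x * v x)| <=
    rho * \int[mu]_x (wt x * `|u x - v x|).
Proof.
move=> mphi hrho su sv; have ssu := state_sstate su; have ssv := state_sstate sv.
have sB := sstateB ssu ssv.
rewrite -I_B; [|exact: (sstate_bd ssu mphi hrho)|exact: (sstate_bd ssv mphi hrho)].
rewrite -I_Z; last exact: (sstate_wt M (sstate_abs sB)).
have e x : phi x * u x - phi x * v x = phi x * (u x - v x) by ring.
rewrite (_ : \int[mu]_x _ = \int[mu]_x (phi x * (u x - v x))); last exact: I_eq.
apply: I_abs_le.
- exact: (sstate_bd sB mphi hrho).
- exact/igZ/(sstate_wt M (sstate_abs sB)).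
- move=> x; rewrite normrM; apply: ler_pM => //.
  by rewrite ler_peMl// wt_ge1.
Qed.

(** Each term of the defect inequality is continuous for the weighted distance. *)
Lemma approx_limit (T C A : R) (f : R -> R -> R) : 0 <= T -> 0 <= C ->
  bounded_states beta T A f ->
  (forall d, 0 < d -> exists (h : R) (u : R -> R -> R), [/\ 0 <= h <= d, approx_sol k bet T h C u,
     bounded_states beta T A u & forall t, 0 <= t <= T ->
       \int[mu]_x (wt x * `|u t x - f t x|) <= d]) ->
  approx_sol k bet T 0 C f.
Proof.
move=> T0 C0 bf hlim phi rho s t mphi hrho s0 st tT; rewrite addr0.
have t0 := le_trans s0 st; have sT := le_trans st tT.
have rho0 : 0 <= rho by rewrite (le_trans _ (hrho 0)).
have tin : 0 <= t <= T by rewrite t0. have sin : 0 <= s <= T by rewrite s0.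
have [ft ftA] := bf _ tin; have [fs fsA] := bf _ sin.
have A0 := state_I_ge0 ft ftA.
have ts0 : 0 <= t - s by rewrite subr_ge0.
pose c := 16 * (beta0 + 2) * A.
have c0 : 0 <= c by rewrite !mulr_ge0// addr_ge0// ltW// (lt_trans _ b2).
pose L := rho * C * (t - s) + 2 * rho + (t - s) * (rho * c).
have rc0 : 0 <= rho * c by exact: mulr_ge0.
have L0 : 0 <= L.
  apply: addr_ge0; last exact: mulr_ge0.
  by apply: addr_ge0; apply: mulr_ge0 => //; apply: mulr_ge0.
apply/ler_addgt0Pr => e e0.
have L1 : 0 < L + 1 by rewrite ltr_wpDl.
have d0 : 0 < e / (L + 1) by rewrite divr_gt0.
set d := e / (L + 1) in d0.
have dL : d * L <= e.
  by rewrite /d mulrAC ler_pdivrMr// ler_pM2l// lerDl.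
have [h [u [/andP[h0 hd] au bu du]]] := hlim d d0.
have [ut utA] := bu _ tin; have [us usA] := bu _ sin.
have sub (g : R -> R -> R) : state (g t) -> state (g s) ->
    \int[mu]_x (phi x * (g t x - g s x)) =
    \int[mu]_x (phi x * g t x) - \int[mu]_x (phi x * g s x).
  move=> /state_sstate g1 /state_sstate g2.
  rewrite -I_B; [by apply: I_eq => x; ring|exact: (sstate_bd g1 mphi hrho)|].
  exact: (sstate_bd g2 mphi hrho).
have h1 := au phi rho s t mphi hrho s0 st tT.
have h2 := le_trans (pairing_close mphi hrho ut ft) (ler_wpM2l rho0 (du t tin)).
have h3 := le_trans (pairing_close mphi hrho us fs) (ler_wpM2l rho0 (du s sin)).
have h4 := Q_lip M mphi hrho ut ft utA ftA.
have rc : 0 <= rho * (16 * (beta0 + 2)) * A.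
  by move: rc0; rewrite /c mulrA.
have h4' := le_trans h4 (ler_wpM2l rc (du t tin)).
rewrite sub// in h1; rewrite sub//.
have h5 : rho * C * ((t - s) * (t - s + h)) <= rho * C * ((t - s) * (t - s + d)).
  by rewrite ler_wpM2l ?mulr_ge0// ler_wpM2l// lerD2l.
apply: le_trans (defect_perturb (le_trans h1 h5) h2 h3 h4' ts0) _.
rewrite [leLHS](_ : _ = rho * C * ((t - s) * (t - s)) + d * L); first by rewrite lerD2l.
by rewrite /L /c; ring.
Qed.

End Limits.

(** * Uniform bounds and tails *)

Section Existence.
Context {R : realType}.
Local Notation mu := (@lebesgue_measure R).
Variables (beta beta0 : R) (k : R * R -> R) (bet : R * (R * R) -> R).
Hypothesis M : breakage_model beta beta0 k bet.

Let b0 := beta_ge0 M.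
Let b1 := beta_le1 M.
Let b2 := beta0_gt2 M.

Local Notation kap := (kap beta).
Local Notation wt := (@wt R).
Local Notation Wt := (Wt beta).
Local Notation state := (state beta).
Implicit Types (f g u v phi : R -> R) (rho c A : R) (q : R * R).

Local Notation polygon := (polygon k bet).
Local Notation bounded_states := (bounded_states beta).
Local Notation approx_sol := (approx_sol k bet).

Lemma approx_solW (T T' h C : R) (f : R -> R -> R) : T' <= T -> approx_sol T h C f -> approx_sol T' h C f.
Proof. by move=> TT hf phi rho s t h1 h2 h3 h4 h5; apply: hf => //; exact: le_trans TT. Qed.

Lemma bounded_statesW (T T' A : R) (f : R -> R -> R) : T' <= T -> bounded_states T A f ->
  bounded_states T' A f.
Proof. by move=> TT hf t /andP[t0 tT]; apply: hf; rewrite t0 (le_trans tT). Qed.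

(** The distance beyond the cut is at most the sum of the tails. *)
Lemma dist_cut_tail f g r tau : state f -> state g ->
  \int[mu]_x (out r Wt x * f x) <= tau -> \int[mu]_x (out r Wt x * g x) <= tau ->
  \int[mu]_x (wt x * `|f x - g x|) <=
    \int[mu]_x (cut r wt x * `|f x - g x|) + 8 * tau.
Proof.
move=> sf sg tf tg.
have w1 x : 0 <= wt x <= 4 * Wt x.
  by rewrite wt_ge0 (le_trans (ler_norm _) (wt_le4 M x)).
have [iow ow] := I_out_wt sf sg tf tg (@mf_wt R) w1.
have sa := sstate_abs (sstateB (state_sstate sf) (state_sstate sg)).
have ic : ig mu (fun x => cut r wt x * `|f x - g x|).
  apply: (sstate_ig sa (c := 4)); first by apply: mf_cut; exact: mf_wt.
  move=> x; rewrite ger0_norm ?cut_ge0 ?wt_ge0//.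
  by rewrite (le_trans (cut_le _ (wt_ge0 _)))//; have /andP[] := w1 x.
apply: (@le_trans _ _ (\int[mu]_x (cut r wt x * `|f x - g x| + out r wt x * `|f x - g x|))).
  rewrite le_eqVlt; apply/orP; left; apply/eqP/I_eq => x.
  by rewrite -mulrDl -cut_out.
by rewrite I_D// lerD2l.
Qed.

Lemma out_ig f r : state f -> ig mu (fun x => out r Wt x * f x).
Proof.
move=> sf; apply: (sstate_ig (state_sstate sf) (c := 1)).
  by apply: mf_out; exact: mf_Wt.
by move=> x; rewrite mul1r ger0_norm ?out_le ?out_ge0 ?Wt_ge0.
Qed.

Lemma out_cvg f : state f ->
  \int[mu]_x (out n.+1%:R Wt x * f x) @[n --> \oo] --> (0 : R).
Proof.
move=> [f1 f0 fn fi].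
have cv : \int[mu]_x (out n.+1%:R Wt x * f x) @[n --> \oo] --> \int[mu]_x (0 : R).
  apply: (@I_dct _ _ R mu (fun n x => out n.+1%:R Wt x * f x) (fun=> 0)
    (fun x => Wt x * f x)) => //.
  - by move=> n; apply: measurable_funM => //; apply: mf_out; exact: mf_Wt.
  - apply: aeW => x; apply: cvg_near_cst; near=> n.
    rewrite /out ifT ?mul0r//; near: n.
    exists (Num.truncn `|x|).+1 => // n /= hn.
    rewrite ltW// (lt_le_trans (truncnS_gt _))// ler_nat.
    exact: leqW.
  - apply: aeW => x n; rewrite ger0_norm ?mulr_ge0 ?out_ge0 ?Wt_ge0//.
    by rewrite ler_wpM2r// out_le// Wt_ge0.
by rewrite I_0 in cv.
Unshelve. all: by end_near. Qed.

Lemma out_tail f (e : R) : state f -> 0 < e ->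
  exists n : nat, \int[mu]_x (out n.+1%:R Wt x * f x) <= e.
Proof.
move=> sf e0; have [f1 f0 fn fi] := sf.
have /cvgrPdist_le/(_ _ e0)[n _ /(_ n (leqnn _)) hn] := out_cvg sf.
exists n; move: hn; rewrite /= sub0r normrN ger0_norm//.
by apply: I_ge0 => x; rewrite mulr_ge0// out_ge0// Wt_ge0.
Qed.

Lemma idpow_le4 x : `|x * `|x| `^ beta| <= 4 * Wt x.
Proof.
rewrite normrM (ger0_norm (powR_ge0 _ _)) /Wt powRD1//.
have := normr_ge0 x; have := powR_ge0 `|x| beta.
move: (`|x| : R) (`|x| `^ beta : R) => a c c0 a0.
have : 0 <= a * c by rewrite mulr_ge0.
by lra.
Qed.

(** Beyond [r >= 1] the full weight is at most twice its superlinear part. *)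
Lemma out_moment f g r : state f -> state g -> 1 <= r ->
  let th := out r (fun x : R => `|x| `^ beta) in
  \int[mu]_x (x * th x * f x) <= \int[mu]_x (x * th x * g x) ->
  \int[mu]_x (out r Wt x * f x) <= 2 * \int[mu]_x (out r Wt x * g x).
Proof.
move=> sf sg r1 th hfg.
have [_ f0 fn _] := sf; have [_ g0 gn _] := sg.
have mth : mf1 th by apply: mf_out; exact: mf_powabs.
have th0 z : 0 <= th z by apply: out_ge0; exact: powR_ge0.
have mxth : mf1 (fun x => x * th x) by exact: measurable_funM.
have xth4 x : `|x * th x| <= 4 * Wt x.
  rewrite /th /out; case: ifP => _; last exact: idpow_le4.
  by rewrite mulr0 normr0 mulr_ge0// Wt_ge0.
have h3 : \int[mu]_x (x * th x * g x) <= \int[mu]_x (out r Wt x * g x).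
  apply: I_le; [exact: (sstate_ig (state_sstate sg) mxth xth4)|exact: out_ig|].
  move=> x; rewrite ler_wpM2r// /th /out; case: ifP => _; first by rewrite mulr0.
  rewrite /Wt powRD1//; apply: (@le_trans _ _ (`|x| * `|x| `^ beta)).
    by rewrite ler_wpM2r ?powR_ge0// ler_norm.
  by rewrite lerDr.
have h4 : \int[mu]_x (out r Wt x * f x) <= 2 * \int[mu]_x (x * th x * f x).
  have ith := sstate_ig (state_sstate sf) mxth xth4.
  rewrite -I_Z//; apply: I_le; [exact: out_ig|exact: igZ|].
  move=> x; have [x0|x0] := leP x 0; first by rewrite (fn _ x0) !mulr0.
  rewrite mulrA ler_wpM2r// /th /out gtr0_norm//; case: ifP => hr.
    by rewrite !mulr0.
  have rx : r < x by rewrite ltNge hr.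
  have x1 : 1 <= x by rewrite (le_trans r1)// ltW.
  rewrite /Wt gtr0_norm// powRD1 ?(ltW x0)//.
  have : 1 <= x * x `^ beta.
    rewrite -[1]mulr1 ler_pM//.
    by have <- : (1 : R) `^ beta = 1 by [rewrite powR1]; rewrite ge0_ler_powR// nnegrE ltW.
  by move=> y1; rewrite mulr_natl mulr2n lerD2r.
by apply: le_trans h4 _; rewrite ler_pM2l// (le_trans hfg).
Qed.

Lemma cut_state f (n : R) : state f -> state (cut n f) /\ supp n (cut n f).
Proof.
move=> [f1 f0 fn fi]; split.
  split.
  - exact: mf_cut.
  - by move=> x; apply: cut_ge0.
  - by move=> x x0; rewrite /cut fn// if_same.
  - apply: (ig_le _ fi); first by apply: measurable_funM; [exact: mf_Wt|exact: mf_cut].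
    move=> x; rewrite ger0_norm ?mulr_ge0 ?Wt_ge0 ?cut_ge0//.
    by rewrite ler_wpM2l ?Wt_ge0// cut_le.
by move=> x nx; rewrite /cut leNgt (lt_le_trans nx (ler_norm x)).
Qed.

Lemma cut_I_le (n : R) v f : state f -> mf1 v -> (forall x, 0 < x -> 0 <= v x) ->
  (forall x, `|v x| <= 4 * Wt x) ->
  \int[mu]_x (v x * cut n f x) <= \int[mu]_x (v x * f x).
Proof.
move=> sf mv v0 vW; have [sc _] := cut_state n sf.
have [_ f0 fn _] := sf.
apply: I_le.
- exact: (sstate_ig (state_sstate sc) mv vW).
- exact: (sstate_ig (state_sstate sf) mv vW).
move=> x; have [x0|x0] := leP x 0; first by rewrite /cut fn// if_same.
by rewrite ler_wpM2l ?v0// cut_le.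
Qed.

Lemma id_le4 (x : R) : `|x| <= 4 * Wt x.
Proof.
by have := wt_le4 M x; rewrite (ger0_norm (wt_ge0 _)) /wt; have := normr_ge0 x; lra.
Qed.

Variable alpha : R.
Hypothesis a0 : 0 <= alpha.
Hypothesis ab : alpha <= beta.
Hypothesis k_split : forall q, k q <=
  `|q.1| `^ alpha * `|q.2| `^ beta + `|q.1| `^ beta * `|q.2| `^ alpha.

Variable fin : R -> R.
Hypothesis sfin : state fin.
Local Notation M1 := (\int[mu]_x (x * fin x)).
Hypothesis M1_gt0 : 0 < M1.

(** A bound on the number of particles that an Euler step cannot overcome. *)
Definition majorant (T : R) (m : R -> R) : Prop :=
  [/\ \int[mu]_x fin x <= m 0, forall t, 0 <= t <= T -> 0 < m t &
   forall t s, 0 <= t -> 0 <= s -> t + s <= T ->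
    m t + s * ((beta0 - 2) * M1 `^ (alpha + beta) * m t `^ (2 - (alpha + beta)))
      <= m (t + s)].

Definition Abound (T : R) (m : R -> R) : R :=
  m T + \int[mu]_x (x * `|x| `^ beta * fin x).

(** The constant of [mean_value_approx]. *)
Definition Cbound (A : R) : R := (16 * (beta0 + 2)) * A * (16 * (beta0 + 2) * (A * A)).

Definition tail_bound (r : R) : R := 2 * \int[mu]_x (out r Wt x * fin x).

(** The bounds shared by all approximations on a time interval; they do not depend
    on the truncation of the datum. *)
Record good (T A h : R) (f : R -> R -> R) : Prop := Good {
  good_bd : bounded_states T A f;
  good_ap : approx_sol T h (Cbound A) f;
  good_tail : forall r t, 1 <= r -> 0 <= t <= T ->
    \int[mu]_x (out r Wt x * f t x) <= tail_bound r }.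

Lemma polygon_good (T n h : R) (m : R -> R) : 0 <= n -> 0 < h ->
  majorant T m -> h * (8 * kap n * Abound T m) <= 1 ->
  let F := polygon h (cut n fin) in
  good T (Abound T m) h F /\ forall t, 0 <= t <= T ->
     \int[mu]_x (x * F t x) = \int[mu]_x (x * cut n fin x).
Proof.
move=> n0 h0 [m1 m2 m3] hh F.
have [sc nc] := cut_state n sfin; have [mc _ _ _] := sc.
have [_ f0 _ _] := sfin.
have mid : mf1 (fun x : R => x) by exact: measurable_id.
have mpow : mf1 (fun x : R => x * `|x| `^ beta).
  by apply: measurable_funM => //; exact: mf_powabs.
have cM : \int[mu]_x (x * cut n fin x) <= M1.
  apply: (@cut_I_le n (fun x => x)) => //; first by move=> x /ltW.
  exact: id_le4.
have cm : \int[mu]_x cut n fin x <= m 0.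
  apply: le_trans m1; apply: I_le; first exact: (sstate_1 (state_sstate sc)).
    exact: (sstate_1 (state_sstate sfin)).
  by move=> x; apply: cut_le.
have cA : m T + \int[mu]_x (x * `|x| `^ beta * cut n fin x) <= Abound T m.
  rewrite /Abound lerD2l; apply: cut_I_le => //.
    by move=> x x0; rewrite mulr_ge0 ?powR_ge0// ltW.
  exact: idpow_le4.
have inv := polygon_inv M a0 ab k_split h0 n0 sc nc M1_gt0 cM cm m2 m3 cA hh.
have bd := polygon_bounded M a0 ab k_split h0 n0 sc nc M1_gt0 cM cm m2 m3 cA hh.
have mv := polygon_mean_value M a0 ab k_split h0 n0 sc nc M1_gt0 cM cm m2 m3 cA hh.
split; last by move=> t /inv[].
split=> //.
  exact: (mean_value_approx M (ltW h0) mv bd).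
move=> r t r1 tT; have [st _ _ _ cv] := inv t tT.
have [t1 t0 tn _] := st.
pose th := out r (fun x : R => `|x| `^ beta).
have mth : mf1 th by apply: mf_out; exact: mf_powabs.
have th0 z : 0 <= th z by apply: out_ge0; exact: powR_ge0.
have thm z z' : 0 < z -> z <= z' -> th z <= th z'.
  move=> z0 zz; have z0' := lt_le_trans z0 zz.
  rewrite /th /out !gtr0_norm//; case: ifP => h1; case: ifP => h2 //.
  - exact: powR_ge0.
  - by move: h1; rewrite (le_trans zz h2).
  - by rewrite ge0_ler_powR// nnegrE ltW.
have hcv := cv th mth th0 thm.
have mxth : mf1 (fun x => x * th x) by exact: measurable_funM.
have xth4 x : `|x * th x| <= 4 * Wt x.
  rewrite /th /out; case: ifP => _; last exact: idpow_le4.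
  by rewrite mulr0 normr0 mulr_ge0// Wt_ge0.
have h2 : \int[mu]_x (x * th x * cut n fin x) <= \int[mu]_x (x * th x * fin x).
  apply: cut_I_le => // x x0; rewrite mulr_ge0//; exact: ltW.
exact: (out_moment st sfin r1 (le_trans hcv h2)).
Qed.

End Existence.

(** * Existence *)

Section ExistenceLimit.
Context {R : realType}.
Local Notation mu := (@lebesgue_measure R).
Variables (beta beta0 : R) (k : R * R -> R) (bet : R * (R * R) -> R).
Hypothesis M : breakage_model beta beta0 k bet.

Let b0 := beta_ge0 M.
Let b1 := beta_le1 M.
Let b2 := beta0_gt2 M.

Local Notation kap := (kap beta).
Local Notation wt := (@wt R).
Local Notation Wt := (Wt beta).
Local Notation state := (state beta).
Implicit Types (f g u v phi : R -> R) (rho c A : R) (q : R * R).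

Local Notation polygon := (polygon k bet).
Local Notation bounded_states := (bounded_states beta).
Local Notation approx_sol := (approx_sol k bet).

Variable alpha : R.
Hypothesis a0 : 0 <= alpha.
Hypothesis ab : alpha <= beta.
Hypothesis k_split : forall q, k q <=
  `|q.1| `^ alpha * `|q.2| `^ beta + `|q.1| `^ beta * `|q.2| `^ alpha.

Variable fin : R -> R.
Hypothesis sfin : state fin.
Local Notation M1 := (\int[mu]_x (x * fin x)).
Hypothesis M1_gt0 : 0 < M1.

Variables (Tn : nat -> R) (m : nat -> R -> R).
Hypothesis Tn0 : forall i, 0 <= Tn i.
Hypothesis Tn_nd : forall i j, (i <= j)%N -> Tn i <= Tn j.
Hypothesis hm : forall i, majorant beta beta0 alpha fin (Tn i) (m i).

Local Notation A := (fun i => Abound beta fin (Tn i) (m i)).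
Local Notation good := (good beta beta0 k bet fin).

(** Small enough for non-negativity on the first [j + 1] time intervals at once. *)
Definition lag (j : nat) : R :=
  (j.+1%:R * (1 + \sum_(i < j.+1) `|8 * kap j%:R * A i|))^-1.

Definition approximant (j : nat) : R -> R -> R := polygon (lag j) (cut j%:R fin).

Lemma lag_den j : 1 <= 1 + \sum_(i < j.+1) `|8 * kap j%:R * A i|.
Proof. by rewrite lerDl sumr_ge0. Qed.

Lemma lag_gt0 j : 0 < lag j.
Proof. by rewrite invr_gt0 mulr_gt0// (lt_le_trans ltr01)// lag_den. Qed.

Lemma lag_le j : lag j <= j.+1%:R^-1.
Proof.
rewrite lef_pV2 ?posrE// ?mulr_gt0// ?(lt_le_trans ltr01)// ?lag_den//.
by rewrite ler_peMr// lag_den.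
Qed.

Lemma lag_bound i j : (i <= j)%N -> lag j * (8 * kap j%:R * A i) <= 1.
Proof.
move=> ij; apply: le_trans (_ : lag j * `|8 * kap j%:R * A i| <= _).
  by rewrite ler_wpM2l ?ler_norm// ltW// lag_gt0.
rewrite /lag mulrC ler_pdivrMr ?mul1r; last first.
  by rewrite mulr_gt0// (lt_le_trans ltr01)// lag_den.
rewrite -ltnS in ij.
apply: (@le_trans _ _ (1 + \sum_(i < j.+1) `|8 * kap j%:R * A i|)).
  rewrite (bigD1 (Ordinal ij))//= addrCA lerDl.
  by rewrite addr_ge0// sumr_ge0.
by rewrite ler_peMl// ?ler1n// (le_trans ler01)// lag_den.
Qed.

Lemma approximant_good i j : (i <= j)%N ->
  good (Tn i) (A i) (lag j) (approximant j).
Proof.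
move=> ij.
by have [] := polygon_good M a0 ab k_split sfin M1_gt0 (ler0n _ j) (lag_gt0 j)
  (hm i) (lag_bound ij).
Qed.

Lemma approximant_mass i j t : (i <= j)%N -> 0 <= t <= Tn i ->
  \int[mu]_x (x * approximant j t x) = \int[mu]_x (x * cut j%:R fin x).
Proof.
move=> ij; have [_] := polygon_good M a0 ab k_split sfin M1_gt0 (ler0n _ j)
  (lag_gt0 j) (hm i) (lag_bound ij); exact.
Qed.

Lemma approximant0 j x : approximant j 0 x = cut j%:R fin x.
Proof.
by rewrite /approximant (@polygon_cell _ k bet _ _ (lag_gt0 j) 0%N) ?mul0r ?subrr ?mul0r
  ?addr0// mul1r lexx ltW// lag_gt0.
Qed.

Lemma A_ge0 i : 0 <= A i.
Proof.
have h := approximant_good (leqnn i).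
have [s sA] := good_bd h (introT andP (conj (lexx 0) (Tn0 i))).
exact: state_I_ge0 s sA.
Qed.

Lemma Cbound_ge0 i : 0 <= Cbound beta0 (A i).
Proof.
have := A_ge0 i; rewrite /Cbound => hA.
have c0 : 0 <= 16 * (beta0 + 2) by rewrite mulr_ge0// addr_ge0// ltW// (lt_trans _ b2).
apply: mulr_ge0; first exact: mulr_ge0.
by apply: mulr_ge0 => //; exact: mulr_ge0.
Qed.

Lemma tail_bound_small (e : R) : 0 < e -> exists2 n : nat, (0 < n)%N & tail_bound beta fin n%:R <= e.
Proof.
move=> e0; have e2 : 0 < e / 2 by rewrite divr_gt0.
have [n hn] := out_tail sfin e2; exists n.+1 => //.
by rewrite /tail_bound mulrC -ler_pdivlMr.
Qed.

Lemma tail_bound_ge0 r : 0 <= tail_bound beta fin r.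
Proof.
have [_ f0 _ _] := sfin; rewrite mulr_ge0//; apply: I_ge0 => x.
by rewrite mulr_ge0// out_ge0// Wt_ge0.
Qed.

Lemma inv_small (e : R) : 0 < e -> exists J : nat, forall j, (J <= j)%N -> j.+1%:R^-1 <= e.
Proof.
move=> e0; exists (Num.truncn e^-1) => j Jj.
rewrite -[leRHS]invrK lef_pV2 ?posrE ?invr_gt0// ltW//.
by rewrite (lt_le_trans (truncnS_gt _))// ler_nat.
Qed.

(** The initial data agree inside every cut that both truncations exceed, so that
    only the tails and the lags remain in the stability estimate. *)
Lemma approximant_cauchy i (d : R) : 0 < d -> exists J : nat, forall j l t,
  (J <= j)%N -> (J <= l)%N -> 0 <= t <= Tn i ->
  \int[mu]_x (wt x * `|approximant j t x - approximant l t x|) <= d.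
Proof.
move=> d0; set T := Tn i; set Ai := A i; set C := Cbound beta0 Ai.
set c := 16 * (beta0 + 1) * Ai.
have Ai0 : 0 <= Ai := A_ge0 i. have C0 : 0 <= C := Cbound_ge0 i.
have T0 : 0 <= T := Tn0 i.
have c0 : 0 <= c.
  rewrite /c; apply: mulr_ge0 => //.
  by rewrite mulr_ge0// addr_ge0// ltW// (lt_trans _ b2).
set E := expR (2 * c * T); have E0 : 0 <= E by exact: expR_ge0.
(* [K1] multiplies the tail and [K2] bounds what multiplies the lags in the
   stability estimate; first the cut [r], then the lags are chosen *)
pose K1 := E * (T * (c * 10)) + 8.
have K10 : 0 < K1.
  rewrite ltr_wpDl//; apply: mulr_ge0 => //.
  by apply: mulr_ge0 => //; apply: mulr_ge0.
have dK : 0 < d / (2 * K1) by rewrite divr_gt0// mulr_gt0.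
have [r r0 hr] := tail_bound_small dK.
pose tau := tail_bound beta fin r%:R.
have tau0 : 0 <= tau := tail_bound_ge0 _.
pose K2 := 2 * (E * (T * ((1 + r%:R) * C))) + 1.
have K3 : 0 <= E * (T * ((1 + r%:R) * C)).
  by do 3! [apply: mulr_ge0 => //].
have K20 : 0 < K2 by rewrite ltr_wpDl// mulr_ge0.
have dK2 : 0 < d / (2 * K2) by rewrite divr_gt0// mulr_gt0.
have [J1 hJ1] := inv_small dK2.
exists (maxn (maxn i r) J1) => j l t; rewrite !geq_max.
move=> /andP[/andP[ij rj] Jj] /andP[/andP[il rl] Jl] /andP[t0 tT].
have gj := approximant_good ij; have gl := approximant_good il.
have r1 : (1 : R) <= r%:R by rewrite ler1n.
have tin : 0 <= t <= Tn i by rewrite t0.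
have bj := bounded_statesW tT (good_bd gj); have bl := bounded_statesW tT (good_bd gl).
have aj := approx_solW tT (good_ap gj); have al := approx_solW tT (good_ap gl).
have ht s : 0 <= s <= t -> \int[mu]_x (out r%:R Wt x * approximant j s x) <= tau /\
    \int[mu]_x (out r%:R Wt x * approximant l s x) <= tau.
  move=> /andP[s0 st]; split; [apply: (good_tail gj)|apply: (good_tail gl)] => //;
    by rewrite s0 (le_trans st).
have st : \int[mu]_x (cut r%:R wt x * `|approximant j t x - approximant l t x|) <=
    expR (2 * c * t) *
    (\int[mu]_x (cut r%:R wt x * `|approximant j 0 x - approximant l 0 x|) +
     t * (c * (10 * tau) + (1 + r%:R) * C * (lag j + lag l))) :=
  approx_stab M t0 (ltW (lag_gt0 j)) (ltW (lag_gt0 l)) C0 (ler0n _ r) aj al bj bl ht.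
have [sj _] := good_bd gj tin; have [sl _] := good_bd gl tin.
have [tj tl] := ht t (introT andP (conj t0 (lexx t))).
have dd := dist_cut_tail M sj sl tj tl.
have e0 : \int[mu]_x (cut r%:R wt x * `|approximant j 0 x - approximant l 0 x|) = 0.
  rewrite -[RHS](I_0 mu); apply: I_eq => x; rewrite !approximant0 /cut.
  case: ifP => hx; last by rewrite mul0r.
  by rewrite !ifT ?subrr ?normr0 ?mulr0// (le_trans hx)// ler_nat.
rewrite e0 add0r in st.
have hE : expR (2 * c * t) * (t * (c * (10 * tau) + (1 + r%:R) * C * (lag j + lag l))) <=
    E * (T * (c * (10 * tau) + (1 + r%:R) * C * (lag j + lag l))).
  have p0 : 0 <= c * (10 * tau) + (1 + r%:R) * C * (lag j + lag l).
    apply: addr_ge0; first by apply: mulr_ge0 => //; apply: mulr_ge0.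
    apply: mulr_ge0; first exact: mulr_ge0.
    by rewrite addr_ge0// ltW// lag_gt0.
  apply: ler_pM => //; first exact: mulr_ge0.
    by rewrite ler_expR ler_wpM2l// mulr_ge0.
  by rewrite ler_wpM2r.
apply: le_trans dd (le_trans (lerD (le_trans st hE) (lexx _)) _).
have h1 : K1 * tau <= d / 2.
  have := ler_wpM2l (ltW K10) hr.
  by rewrite (_ : K1 * (d / (2 * K1)) = d / 2)//; field; rewrite gt_eqF.
have h2 : E * (T * ((1 + r%:R) * C)) * (lag j + lag l) <= d / 2.
  have hl : lag j + lag l <= 2 * (d / (2 * K2)).
    rewrite mulr_natl mulr2n; apply: lerD.
      exact: le_trans (lag_le j) (hJ1 _ Jj).
    exact: le_trans (lag_le l) (hJ1 _ Jl).
  apply: le_trans (ler_wpM2l K3 hl) _.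
  rewrite (_ : _ * (2 * (d / (2 * K2))) = (d / 2) * (2 * (E * (T * ((1 + r%:R) * C))) / K2)).
    rewrite ler_piMr ?divr_ge0 ?(ltW d0)//.
    by rewrite ler_pdivrMr// mul1r /K2 lerDl.
  by field; rewrite gt_eqF.
have -> : E * (T * (c * (10 * tau) + (1 + r%:R) * C * (lag j + lag l))) + 8 * tau =
   K1 * tau + E * (T * ((1 + r%:R) * C)) * (lag j + lag l) by rewrite /K1; ring.
by rewrite [leRHS](splitr d) lerD.
Qed.

Lemma pow_half_small (e : R) : 0 < e -> exists I : nat, forall i, (I <= i)%N ->
  2 * (2^-1 : R) ^+ i <= e.
Proof.
move=> e0.
have h : `|2^-1 : R| < 1 by rewrite gtr0_norm ?invr_gt0// invf_lt1// ltr1n.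
have /cvgrPdist_le/(_ _ e0)[I _ hI] := cvg_geometric (2 : R) h.
exists I => i Ii; have := hI i Ii; rewrite /= sub0r normrN ger0_norm//.
Qed.

Lemma mass_close f g : state f -> state g ->
  `|\int[mu]_x (x * f x) - \int[mu]_x (x * g x)| <= \int[mu]_x (wt x * `|f x - g x|).
Proof.
move=> /state_sstate sf /state_sstate sg.
have mid : mf1 (fun x : R => x) by exact: measurable_id.
have id4 := id_le4 M.
have sB := sstateB sf sg.
rewrite -I_B; [|exact: (sstate_ig sf mid id4)|exact: (sstate_ig sg mid id4)].
have e x : x * f x - x * g x = x * (f x - g x) by ring.
rewrite (_ : \int[mu]_x _ = \int[mu]_x (x * (f x - g x))); last exact: I_eq.
apply: I_abs_le; [exact: (sstate_ig sB mid id4)|exact: (sstate_wt M (sstate_abs sB))|].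
by move=> x; rewrite normrM ler_wpM2r// /wt lerDr.
Qed.

Lemma cut_close (e : R) : 0 < e -> exists N : nat, forall n, (N <= n)%N ->
  \int[mu]_x (wt x * `|cut n%:R fin x - fin x|) <= e.
Proof.
move=> e0; have e2 : 0 < e / 2 by rewrite divr_gt0.
have [N _ hN] := tail_bound_small e2; exists N => n Nn.
have [sc _] := cut_state n%:R sfin; have [_ f0 _ _] := sfin.
have ic := sstate_wt M (sstate_abs (sstateB (state_sstate sc) (state_sstate sfin))).
apply: (@le_trans _ _ (2 * tail_bound beta fin N%:R)); last first.
  by rewrite mulrC -ler_pdivlMr.
rewrite /tail_bound mulrA -I_Z; last exact: (out_ig _ sfin).
apply: I_le => //; first by apply: igZ; exact: (out_ig _ sfin).
move=> x; rewrite /cut /out; case: ifP => hn.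
  rewrite subrr normr0 mulr0; case: ifP => _; rewrite ?mul0r ?mulr0//.
  by rewrite !mulr_ge0// Wt_ge0.
rewrite ifF; last first.
  by apply/negbTE/negP => h; move/negP: hn; apply; apply: le_trans h _; rewrite ler_nat.
rewrite sub0r normrN (ger0_norm (f0 x)) mulrA ler_wpM2r//.
rewrite (_ : 2 * 2 = 4); last by ring.
exact: le_trans (ler_norm _) (wt_le4 M x).
Qed.

(** The limit of the polygons along a fast subsequence. Mass and initial datum pass
    to the limit because the mass is continuous for the weighted distance. *)
Theorem model_existence : exists f : R -> R -> R,
  [/\ mf2 (fun p : R * R => f p.1 p.2),
      forall i, bounded_states (Tn i) (A i) f /\
        approx_sol (Tn i) 0 (Cbound beta0 (A i)) f,
      forall i t, 0 <= t <= Tn i ->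
        \int[mu]_x (x * f t x) = M1 /\
        (forall r, 1 <= r -> \int[mu]_x (out r Wt x * f t x) <= tail_bound beta fin r) &
      {ae mu, forall x, f 0 x = fin x}].
Proof.
have h2 i : 0 < (2^-1 : R) ^+ i by rewrite exprn_gt0// invr_gt0.
have [J hJ] := choice (fun i => approximant_cauchy i (h2 i)).
(* a subsequence along which consecutive distances are summable *)
pose K i := (i + \sum_(l < i.+1) J l)%N.
have Ki i : (i <= K i)%N by rewrite leq_addr.
have JK i : (J i <= K i)%N by rewrite /K big_ord_recr/= addnA leq_addl.
have KS i : (K i <= K i.+1)%N.
  rewrite /K [in leqRHS]big_ord_recr/= addnA; apply: (leq_trans _ (leq_addr _ _)).
  by rewrite leq_add2r leqnSn.
pose u i := approximant (K i).
have du i i0 t : (i0 <= i)%N -> 0 <= t <= Tn i0 ->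
    \int[mu]_x (wt x * `|u i.+1 t x - u i t x|) <= 2^-1 ^+ i.
  move=> ii /andP[t0 tT]; apply: hJ => //.
    by apply: leq_trans (KS i).
  by rewrite t0 (le_trans tT)// Tn_nd.
(* an upper limit is measurable in both variables without any choice *)
pose f t x : R := if 0 < x then
    Num.max 0 (fine (limn_esup (fun i => (u i t x)%:E))) else 0.
have mu2 i : mf2 (fun p : R * R => u i p.1 p.2).
  have [sc _] := cut_state (K i)%:R sfin; have [mc _ _ _] := sc.
  by apply: (mf_polygon2 M (lag_gt0 _) mc).
have mff : mf2 (fun p : R * R => f p.1 p.2).
  apply: measurable_fun_ifT.
  - by apply: measurable_fun_ltr; [exact: measurable_cst|exact: measurable_snd].
  - apply: measurable_maxr; first exact: measurable_cst.
    apply: measurableT_comp; first exact: fine_measurable.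
    apply: measurable_fun_limn_esup => i.
    by apply/measurable_EFinP; exact: mu2.
  - exact: measurable_cst.
have f0 t x : 0 <= f t x by rewrite /f; case: ifP => // _; rewrite le_max lexx.
have fn t x : x <= 0 -> f t x = 0 by move=> x0; rewrite /f ltNge x0.
have mf1f t : mf1 (f t) by exact: (mf_sec1 t mff).
have gu i i0 : (i0 <= i)%N -> good (Tn i0) (A i0) (lag (K i)) (u i).
  by move=> ii; apply: approximant_good; exact: leq_trans (Ki i).
have fl i0 t : 0 <= t <= Tn i0 ->
    forall x l, (fun i => u i t x) @ \oo --> l -> f t x = l.
  move=> tin x l ul.
  have su i : (i0 <= i)%N -> state (u i t).
    by move=> ii; have [] := good_bd (gu i i0 ii) tin.
  have l0 : 0 <= l.
    rewrite -(cvg_lim _ ul)//; apply: limr_ge; first by apply/cvg_ex; exists l.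
    near=> i; have ii : (i0 <= i)%N by near: i; exact: nbhs_infty_ge.
    by have [_ p _ _] := su i ii; exact: p.
  rewrite /f; case: ltP => x0.
    have eul : (fun i => (u i t x)%:E) @ \oo --> l%:E.
      by apply: cvg_EFin => //; near=> i.
    rewrite is_cvg_limn_esupE; last by apply/cvg_ex; exists l%:E.
    by rewrite (cvg_lim _ eul)//= max_r.
  apply: (cvg_unique _ _ ul) => //.
  apply: cvg_near_cst; near=> i.
  have ii : (i0 <= i)%N by near: i; exact: nbhs_infty_ge.
  by have [_ _ p _] := su i ii; exact: p.
have fd i0 t i : (i0 <= i)%N -> 0 <= t <= Tn i0 ->
    ig mu (fun x => wt x * `|u i t x - f t x|) /\
    \int[mu]_x (wt x * `|u i t x - f t x|) <= 2 * 2^-1 ^+ i.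
  move=> ii tin; apply: (fast_limit M (u := fun i => u i t)).
  - move=> l il; apply: state_sstate.
    by have [] := good_bd (gu l i0 (leq_trans ii il)) tin.
  - by move=> l il; apply: (du l i0) => //; exact: leq_trans il.
  - exact: mf1f.
  - exact: (fl i0).
(* the limit is approximated as well as desired, uniformly in time, along
   indices as large as desired *)
have app i0 N (d : R) : 0 < d -> exists i, [/\ (i0 <= i)%N, (N <= i)%N, lag (K i) <= d &
    forall t, 0 <= t <= Tn i0 -> ig mu (fun x => wt x * `|u i t x - f t x|) /\
      \int[mu]_x (wt x * `|u i t x - f t x|) <= d].
  move=> d0; have [I1 h1] := pow_half_small d0; have [I2 hI2] := inv_small d0.
  exists (maxn (maxn N i0) (maxn I1 I2)); split.
  - by rewrite !leq_max leqnn orbT.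
  - by rewrite !leq_max leqnn.
  - apply: le_trans (lag_le _) _; apply: hI2; apply: leq_trans (Ki _).
    by rewrite !leq_max leqnn !orbT.
  - move=> t tin; have [||h3 h4] := fd i0 t (maxn (maxn N i0) (maxn I1 I2)).
    + by rewrite !leq_max leqnn orbT.
    + exact: tin.
    + split=> //; apply: le_trans h4 _; apply: h1.
      by rewrite !leq_max leqnn !orbT.
have bdf i0 : bounded_states (Tn i0) (A i0) f.
  move=> t tin; apply: (state_limit M (mf1f t) (f0 t) (fn t)).
  move=> d d0; have [i [ii _ _ hi]] := app i0 0%N d d0.
  have [su sA] := good_bd (gu i i0 ii) tin; have [h3 h4] := hi t tin.
  by exists (u i t).
have tailf i0 t r : 0 <= t <= Tn i0 -> 1 <= r ->
    \int[mu]_x (out r Wt x * f t x) <= tail_bound beta fin r.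
  move=> tin r1.
  have oW x : 0 <= out r Wt x <= Wt x by rewrite out_ge0 ?out_le// Wt_ge0.
  have mo : mf1 (out r Wt) by apply: mf_out; exact: mf_Wt.
  suff [] : ig mu (fun x => out r Wt x * f t x) /\
    \int[mu]_x (out r Wt x * f t x) <= tail_bound beta fin r by [].
  apply: (weight_limit M mo oW (mf1f t) (f0 t)) => d d0.
  have [i [ii _ _ hi]] := app i0 0%N d d0.
  have [su sA] := good_bd (gu i i0 ii) tin; have [h3 h4] := hi t tin.
  exists (u i t); split=> //.
  exact: (good_tail (gu i i0 ii)).
have T00 i0 : 0 <= (0 : R) <= Tn i0 by rewrite lexx Tn0.
exists f; split=> //.
- move=> i0; split=> //; apply: (approx_limit M (Tn0 i0) (Cbound_ge0 i0) (bdf i0)).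
  move=> d d0; have [i [ii _ hl hi]] := app i0 0%N d d0.
  exists (lag (K i)), (u i); split.
  + by rewrite ltW ?lag_gt0.
  + exact: (good_ap (gu i i0 ii)).
  + exact: (good_bd (gu i i0 ii)).
  + by move=> t tin; have [] := hi t tin.
- move=> i0 t tin; split; last by move=> r; exact: (tailf i0).
  have [sf _] := bdf i0 t tin.
  apply/eqP; rewrite -subr_eq0 -normr_le0; apply/ler_addgt0Pr => e e0; rewrite add0r.
  have e2 : 0 < e / 2 by rewrite divr_gt0.
  have [N hN] := cut_close e2.
  have [i [ii Ni hl hi]] := app i0 N _ e2; have [h3 h4] := hi t tin.
  have [su _] := good_bd (gu i i0 ii) tin.
  have [sc _] := cut_state (K i)%:R sfin.
  have m1 := mass_close su sf; have m2 := mass_close sc sfin.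
  have m3 := approximant_mass (leq_trans ii (Ki i)) tin; rewrite -m3 in m2.
  rewrite distrC in m1.
  apply: le_trans (ler_distD _ _ _) _; rewrite [leRHS](splitr e); apply: lerD.
    exact: le_trans m1 h4.
  exact: le_trans m2 (hN _ (leq_trans Ni (Ki i))).
- have [sf _] := bdf 0%N 0 (T00 0%N).
  have sd := sstate_abs (sstateB (state_sstate sf) (state_sstate sfin)).
  have iw := sstate_wt M sd.
  have I0 : \int[mu]_x (wt x * `|f 0 x - fin x|) <= 0.
    apply/ler_addgt0Pr => e e0; rewrite add0r.
    have e2 : 0 < e / 2 by rewrite divr_gt0.
    have [N hN] := cut_close e2.
    have [i [ii Ni hl hi]] := app 0%N N _ e2; have [h3 h4] := hi 0 (T00 0%N).
    have [sc _] := cut_state (K i)%:R sfin.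
    have ic := sstate_wt M (sstate_abs (sstateB (state_sstate sc) (state_sstate sfin))).
    apply: (@le_trans _ _ (\int[mu]_x (wt x * `|u i 0 x - f 0 x| +
        wt x * `|cut (K i)%:R fin x - fin x|))).
      apply: I_le => //; first exact: igD.
      move=> x; rewrite -mulrDr ler_wpM2l ?wt_ge0// {1}/u approximant0.
      by rewrite (distrC _ (f 0 x)) ler_distD.
    rewrite I_D// [leRHS](splitr e); apply: lerD => //.
    exact: hN (leq_trans Ni (Ki i)).
  have w0 x : 0 <= wt x * `|f 0 x - fin x| by rewrite mulr_ge0 ?wt_ge0.
  apply: ae_imp (I_eq0_ae iw w0 I0) => x /eqP.
  rewrite mulf_eq0 normr_eq0 subr_eq0 => /orP[|/eqP//].
  by rewrite gt_eqF// (lt_le_trans ltr01)// wt_ge1.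
Unshelve. all: by end_near.
Qed.

End ExistenceLimit.

(** * The equation integrated in time *)

Section Segments.
Context {R : realType}.
Local Notation mu := (@lebesgue_measure R).
Implicit Types (s t r v e : R) (G : R -> R).

(** Half-open on the right, so that integrals over adjacent segments add up. *)
Definition seg s t r : bool := (s <= r) && (r < t).

Lemma mf_seg s t : measurable_fun setT (seg s t : measurableTypeR R -> bool).
Proof.
by apply: measurable_and; [exact: measurable_fun_ler|exact: measurable_fun_ltr].
Qed.

Lemma mf_on_seg s t G : mf1 G -> mf1 (fun r => if seg s t r then G r else 0).
Proof. by move=> mG; apply: measurable_fun_ifT => //; exact: mf_seg. Qed.

Lemma seg_length s t : s <= t -> ig mu (fun r => if seg s t r then 1 else 0) /\
  \int[mu]_r (if seg s t r then 1 else 0) = t - s.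
Proof.
move=> st.
have e : (\int[mu]_r (if seg s t r then 1 else 0)%:E = (t - s)%:E)%E.
  transitivity (\int[mu]_r (\1_(`[s, t[) r)%:E)%E.
    apply: eq_integral => r _; congr EFin; rewrite indicE /seg.
    by rewrite mem_setE in_itv/=; case: ifP.
  rewrite integral_indic// setIT.
  rewrite [LHS](_ : _ = mu `[s, t[%classic)// lebesgue_measure_itv/= lte_fin.
  by move: st; rewrite le_eqVlt => /predU1P[->|->]; rewrite ?ltxx ?subrr// EFinB.
have [] := @ig_bound _ _ R mu (fun r => if seg s t r then 1 else 0) (t - s).
- exact: mf_on_seg.
- by move=> r; case: ifP.
- by rewrite e.
by move=> i _; split=> //; rewrite /Rintegral e.
Qed.

Lemma seg_bound s t v e G : mf1 G -> s <= t ->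
  (forall r, s <= r -> r < t -> `|G r - v| <= e) ->
  ig mu (fun r => if seg s t r then G r else 0) /\
  `|\int[mu]_r (if seg s t r then G r else 0) - (t - s) * v| <= (t - s) * e.
Proof.
move=> mG st hG; have [i1 e1] := seg_length st.
have iD : ig mu (fun r => if seg s t r then G r - v else 0).
  apply: (ig_le _ (igZ e i1)).
    by apply: mf_on_seg; exact: measurable_funB.
  move=> r; rewrite /seg; case: ifP => [/andP[sr rt]|_].
    by rewrite mulr1 hG.
  by rewrite normr0 mulr0.
have eG r : (if seg s t r then G r else 0) =
    (if seg s t r then G r - v else 0) + v * (if seg s t r then 1 else 0).
  by case: ifP => _; [rewrite mulr1 subrK|rewrite mulr0 addr0].
have iG : ig mu (fun r => if seg s t r then G r else 0).
  have := igD iD (igZ v i1); congr (_.-integrable _ _).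
  by apply/funext => r /=; rewrite eG.
split=> //.
have -> : \int[mu]_r (if seg s t r then G r else 0) =
    \int[mu]_r (if seg s t r then G r - v else 0) + v * (t - s).
  rewrite -e1 -I_Z// -I_D//; last exact: igZ.
  exact: I_eq.
rewrite (mulrC v) addrK.
apply: (@le_trans _ _ (\int[mu]_r (e * (if seg s t r then 1 else 0)))).
  apply: I_abs_le => //; first exact: igZ.
  move=> r; rewrite /seg; case: ifP => [/andP[sr rt]|_].
    by rewrite mulr1 hG.
  by rewrite normr0 mulr0.
by rewrite I_Z// e1 mulrC.
Qed.

Lemma seg_add s m t G :  s <= m -> m <= t ->
  ig mu (fun r => if seg s m r then G r else 0) ->
  ig mu (fun r => if seg m t r then G r else 0) ->
  \int[mu]_r (if seg s t r then G r else 0) =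
  \int[mu]_r (if seg s m r then G r else 0) + \int[mu]_r (if seg m t r then G r else 0).
Proof.
move=> sm mt i1 i2; rewrite -I_D//; apply: I_eq => r; rewrite /seg.
have [mr|rm] := leP m r.
  by rewrite (le_trans sm mr)/= add0r.
by rewrite (lt_le_trans rm mt) !andbT/= addr0.
Qed.

End Segments.

Lemma increment_le (R : realFieldType) (I d q K c : R) : `|I - d * q| <= K * (d * d) ->
  `|q| <= c -> 0 <= d -> I <= d * (c + K * d).
Proof.
move=> /ler_normlP[_ h1] /ler_normlP[_ h2] d0.
have := ler_wpM2l d0 h2; lra.
Qed.

Lemma increment_close (R : realFieldType) (I J d q K L : R) : `|I - d * q| <= K * (d * d) ->
  `|J - d * q| <= d * (L * d) -> `|I - J| <= d * ((K + L) * d).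
Proof.
move=> /ler_normlP[h1 h2] /ler_normlP[h3 h4]; apply/ler_normlP; split; lra.
Qed.

Section TimeIntegral.
Context {R : realType}.
Local Notation mu := (@lebesgue_measure R).
Variables (beta beta0 : R) (k : R * R -> R) (bet : R * (R * R) -> R).
Hypothesis M : breakage_model beta beta0 k bet.

Let b0 := beta_ge0 M.
Let b1 := beta_le1 M.
Let b2 := beta0_gt2 M.

Local Notation wt := (@wt R).
Local Notation Wt := (Wt beta).
Local Notation state := (state beta).
Local Notation sstate := (sstate beta).
Local Notation zet := (zet bet).
Local Notation Q := (Q k bet).
Implicit Types (f g u v phi : R -> R) (rho c A : R) (q : R * R).

Local Notation mR := (measurableTypeR R).
Local Notation bounded_states := (bounded_states beta).
Local Notation approx_sol := (approx_sol k bet).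

Implicit Types (F : R -> R -> R).

Lemma mf_Q phi F : mf1 phi -> mf2 (fun p : R * R => F p.1 p.2) ->
  mf1 (fun s => Q phi (F s)).
Proof.
move=> mphi mF.
pose H (p : mR * (mR * mR)) := zet phi p.2 * k p.2 * F p.1 p.2.1 * F p.1 p.2.2.
have mz : mf2 (fun q : R * R => zet phi q * k q).
  by apply: measurable_funM; [exact: (mf_zet M)|exact: (k_mf M)].
have m1 : mf3 (fun p : mR * (mR * mR) => F p.1 p.2.1).
  have mh : measurable_fun setT (fun p : mR * (mR * mR) => (p.1, p.2.1)).
    apply/measurable_fun_pairP; split => /=; first exact: measurable_fst.
    by apply: (measurableT_comp measurable_fst); exact: measurable_snd.
  exact: (measurableT_comp mF mh).
have m2 : mf3 (fun p : mR * (mR * mR) => F p.1 p.2.2).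
  have mh : measurable_fun setT (fun p : mR * (mR * mR) => (p.1, p.2.2)).
    apply/measurable_fun_pairP; split => /=; first exact: measurable_fst.
    exact: (measurableT_comp (@measurable_snd _ _ mR mR) (@measurable_snd _ _ mR (mR * mR)%type)).
  exact: (measurableT_comp mF mh).
have mH : mf3 H.
  apply: measurable_funM; last exact: m2.
  by apply: measurable_funM; [exact: (mf_snd mz)|exact: m1].
by apply: measurable_funM; [exact: measurable_cst|exact: (mf_intP mH)].
Qed.

(** Test the increment with its own sign and let the partition shrink. *)
Lemma approx_lip T C A F s t : 0 <= C -> approx_sol T 0 C F -> bounded_states T A F ->
  0 <= s -> s <= t -> t <= T ->
  \int[mu]_x (wt x * `|F t x - F s x|) <= (t - s) * (16 * (beta0 + 2) * (A * A)).
Proof.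
move=> C0 hF hb s0 st tT.
have ssF r : 0 <= r -> r <= T -> sstate (F r).
  by move=> r1 r2; have [/state_sstate] := hb r (introT andP (conj r1 r2)).
have sE r : s <= r -> r <= t -> sstate (fun x => F r x - F s x).
  move=> sr rt; apply: sstateB; apply: ssF => //.
  - exact: le_trans sr.
  - exact: le_trans tT.
  - exact: le_trans st tT.
apply: (dist_cut_le M); first exact: sE.
move=> n.
have [ft ftA] := hb t (introT andP (conj (le_trans s0 st) tT)).
have A0 := state_I_ge0 ft ftA.
have c20 : 0 <= 16 * (beta0 + 2) by rewrite mulr_ge0// addr_ge0// ltW// (lt_trans _ b2).
set c := 16 * (beta0 + 2) * (A * A).
have c0 : 0 <= c by apply: mulr_ge0 => //; exact: mulr_ge0.
pose D r := \int[mu]_x (cut n%:R wt x * `|F (s + r) x - F s x|).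
have ts0 : 0 <= t - s by rewrite subr_ge0.
have nC0 : 0 <= (1 + n%:R) * C by exact: mulr_ge0.
have icut u : sstate u -> ig mu (fun x => cut n%:R wt x * `|u x|).
  move=> su; apply: (sstate_ig (sstate_abs su) (c := 4)).
    by apply: mf_cut; exact: mf_wt.
  move=> x; rewrite ger0_norm ?cut_ge0 ?wt_ge0//.
  by apply: le_trans (cut_le _ (wt_ge0 _)) (le_trans (ler_norm _) (wt_le4 M x)).
have := @gronwall_refine _ D (t - s) 0 c ((1 + n%:R) * C) ts0 (lexx 0) c0 nC0.
rewrite mulr0 mul0r expR0 mul1r /D addr0.
have -> : \int[mu]_x (cut n%:R wt x * `|F s x - F s x|) = 0.
  by rewrite -[RHS](I_0 mu); apply: I_eq => x; rewrite subrr normr0 mulr0.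
have e : s + (t - s) = t by ring.
rewrite add0r e; apply.
- by move=> r _; apply: I_ge0 => x; rewrite mulr_ge0 ?cut_ge0 ?wt_ge0.
move=> r1 r2 r10 r12 r2t.
have r20 := le_trans r10 r12.
have p2 : s + r2 <= t by rewrite -lerBrDl.
have p1 : s + r1 <= s + r2 by rewrite lerD2l.
have q1 : s <= s + r1 by rewrite lerDl.
have q2 : s <= s + r2 by rewrite lerDl.
pose E x := F (s + r2) x - F (s + r1) x.
have sEE : sstate E.
  apply: sstateB; apply: ssF; try exact: le_trans p2 tT;
    try exact: le_trans p1 (le_trans p2 tT); exact: addr_ge0.
have [mE _ _] := sEE.
have tri : \int[mu]_x (cut n%:R wt x * `|F (s + r2) x - F s x|) <=
    \int[mu]_x (cut n%:R wt x * `|F (s + r1) x - F s x|) +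
    \int[mu]_x (cut n%:R wt x * `|E x|).
  have i1 := icut _ (sE _ q1 (le_trans p1 p2)).
  rewrite -I_D; [|exact: i1|exact: icut].
  apply: I_le; [exact: (icut _ (sE _ q2 p2))|by apply: igD => //; exact: icut|].
  move=> x; rewrite -mulrDr ler_wpM2l ?cut_ge0 ?wt_ge0//.
  by rewrite [leRHS]addrC; exact: ler_distD.
apply: (le_trans tri); rewrite lerD2l mul0r add0r.
have mphi : mf1 (dtest n%:R E) by exact: mf_dtest.
have hrho x : `|dtest n%:R E x| <= 1 + n%:R by exact: dtest_le_rho.
have h := hF _ _ _ _ mphi hrho (addr_ge0 s0 r10) p1 (le_trans p2 tT).
have [f2 f2A] := hb (s + r2) (introT andP (conj (addr_ge0 s0 r20) (le_trans p2 tT))).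
have hQ := Q_bound M mphi hrho (dtest_le_wt _ _) f2 f2A.
have eE : \int[mu]_x (cut n%:R wt x * `|E x|) =
   \int[mu]_x (dtest n%:R E x * (F (s + r2) x - F (s + r1) x)).
  by apply: I_eq => x; rewrite -(dtestM n%:R E).
rewrite eE; have dr : s + r2 - (s + r1) = r2 - r1 by ring.
rewrite dr addr0 in h.
have dr0 : 0 <= r2 - r1 by rewrite subr_ge0.
exact: (increment_le h hQ dr0).
Qed.

(** Both sides are additive over time intervals and differ by a quadratic amount on
    each of them, hence not at all. *)
Lemma approx_integral T C A F phi rho t : 0 <= C -> approx_sol T 0 C F ->
  bounded_states T A F -> mf2 (fun p : R * R => F p.1 p.2) ->
  mf1 phi -> (forall x, `|phi x| <= rho) -> 0 <= t <= T ->
  \int[mu]_x (phi x * (F t x - F 0 x)) =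
    \int[mu]_s (if seg 0 t s then Q phi (F s) else 0).
Proof.
move=> C0 hF hb mF mphi hrho /andP[t0 tT].
have rho0 : 0 <= rho by rewrite (le_trans _ (hrho 0)).
have mQ := mf_Q mphi mF.
have [ft ftA] := hb t (introT andP (conj t0 tT)).
have A0 := state_I_ge0 ft ftA.
have c20 : 0 <= 16 * (beta0 + 2) by rewrite mulr_ge0// addr_ge0// ltW// (lt_trans _ b2).
pose L := rho * (16 * (beta0 + 2)) * A * (16 * (beta0 + 2) * (A * A)).
have L0 : 0 <= L.
  rewrite /L; apply: mulr_ge0; last by apply: mulr_ge0 => //; exact: mulr_ge0.
  by apply: mulr_ge0 => //; exact: mulr_ge0.
have lipQ r s : 0 <= r -> r <= s -> s <= t ->
    `|Q phi (F r) - Q phi (F s)| <= L * (s - r).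
  move=> r0 rs st.
  have [fr frA] : state (F r) /\ \int[mu]_x (Wt x * F r x) <= A.
    by apply: hb; rewrite r0 (le_trans rs)// (le_trans st).
  have [fs fsA] : state (F s) /\ \int[mu]_x (Wt x * F s x) <= A.
    by apply: hb; rewrite (le_trans r0 rs) (le_trans st).
  rewrite distrC; apply: le_trans (Q_lip M mphi hrho fs fr fsA frA) _.
  rewrite /L -[leRHS]mulrA ler_wpM2l//; first by apply: mulr_ge0 => //; exact: mulr_ge0.
  by rewrite mulrC; apply: (approx_lip C0 hF hb) => //; exact: le_trans tT.
have segi r s : 0 <= r -> r <= s -> s <= t ->
    ig mu (fun x => if seg r s x then Q phi (F x) else 0) /\
    `|\int[mu]_x (if seg r s x then Q phi (F x) else 0) - (s - r) * Q phi (F s)| <=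
      (s - r) * (L * (s - r)).
  move=> r0 rs st; apply: seg_bound => // x rx xs.
  apply: le_trans (lipQ x s (le_trans r0 rx) (ltW xs) st) _.
  by rewrite ler_wpM2l// lerD2l lerN2.
pose Psi r := \int[mu]_x (phi x * (F r x - F 0 x)) -
   \int[mu]_s (if seg 0 r s then Q phi (F s) else 0).
have ssF r : 0 <= r -> r <= t -> sstate (F r).
  move=> r1 r2; have [/state_sstate] := hb r (introT andP (conj r1 (le_trans r2 tT))).
  by [].
have P0 : Psi 0 = 0.
  rewrite /Psi; have -> : \int[mu]_x (phi x * (F 0 x - F 0 x)) = 0.
    by rewrite -[RHS](I_0 mu); apply: I_eq => x; rewrite subrr mulr0.
  have -> : \int[mu]_s (if seg 0 0 s then Q phi (F s) else 0) = 0.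
    rewrite -[RHS](I_0 mu); apply: I_eq => x; rewrite /seg.
    by case: leP => //= x0; rewrite ltNge x0.
  by rewrite subrr.
pose D r := `|Psi r|.
have K0 : 0 <= rho * C + L by rewrite addr_ge0// mulr_ge0.
have := @gronwall_refine _ D t 0 0 (rho * C + L) t0 (lexx 0) (lexx 0) K0.
rewrite /D P0 normr0 !mulr0 addr0 mulr0 => hg.
have {hg} : `|Psi t| <= 0; last first.
  by rewrite normr_le0 subr_eq0 => /eqP.
apply: hg => // r s r0 rs st; rewrite mul0r !add0r.
have [i1 _] := segi 0 r (lexx 0) r0 (le_trans rs st).
have [i2 h2] := segi r s r0 rs st.
have h1 := hF phi rho r s mphi hrho r0 rs (le_trans st tT); rewrite addr0 in h1.
have s0 := le_trans r0 rs; have rt := le_trans rs st.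
have e : Psi s - Psi r = \int[mu]_x (phi x * (F s x - F r x)) -
    \int[mu]_x (if seg r s x then Q phi (F x) else 0).
  rewrite /Psi (seg_add r0 rs i1 i2).
  have -> : \int[mu]_x (phi x * (F s x - F 0 x)) =
     \int[mu]_x (phi x * (F s x - F r x)) + \int[mu]_x (phi x * (F r x - F 0 x)).
    have j1 := sstate_bd (sstateB (ssF s s0 st) (ssF r r0 rt)) mphi hrho.
    have j2 := sstate_bd (sstateB (ssF r r0 rt) (ssF 0 (lexx 0) t0)) mphi hrho.
    by rewrite -(I_D j1 j2); apply: I_eq => x; ring.
  by ring.
have tri : `|Psi s| <= `|Psi r| + `|Psi s - Psi r|.
  by rewrite -[in leLHS](subrK (Psi r) (Psi s)) addrC ler_normD.
apply: le_trans tri _; rewrite lerD2l e.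
exact: (increment_close h1 h2).
Qed.

End TimeIntegral.

(** * Propagation of superlinear moments *)

Section Uniqueness.
Context {R : realType}.
Local Notation mu := (@lebesgue_measure R).
Local Notation P := (mu \x mu)%E.
Variables (beta beta0 : R) (k : R * R -> R) (bet : R * (R * R) -> R).
Hypothesis M : breakage_model beta beta0 k bet.

Let b0 := beta_ge0 M.
Let b1 := beta_le1 M.
Let b2 := beta0_gt2 M.

Local Notation kap := (kap beta).
Local Notation wt := (@wt R).
Local Notation Wt := (Wt beta).
Local Notation state := (state beta).
Local Notation zet := (zet bet).
Local Notation gainw := (gainw bet).
Local Notation Q := (Q k bet).
Implicit Types (f g u v phi : R -> R) (rho c A : R) (q : R * R).

Local Notation mR := (measurableTypeR R).

Implicit Types (F : R -> R -> R) (th : R -> R).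

Lemma Q_rho phi rho A f : mf1 phi -> (forall x, `|phi x| <= rho) -> state f ->
  \int[mu]_x (Wt x * f x) <= A -> `|Q phi f| <= rho * (16 * (beta0 + 2)) * A * (4 * A).
Proof.
move=> mphi hr hs hA; have A0 := state_I_ge0 hs hA.
have r0 : 0 <= rho by rewrite (le_trans _ (hr 0)).
have s0 : state (fun=> 0 : R).
  split=> //; have := ig0 mu; congr (_.-integrable _ _).
  by apply/funext => x /=; rewrite mulr0.
have z2 : \int[mu]_x (Wt x * (fun=> 0 : R) x) <= A.
  rewrite (_ : \int[mu]_x _ = 0)//.
  by rewrite -[RHS](I_0 mu); apply: I_eq => x; rewrite mulr0.
have := Q_lip M mphi hr hs s0 hA z2.
have -> : Q phi (fun=> 0) = 0.
  rewrite /Q (_ : \int[P]_q _ = 0) ?mulr0//.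
  by rewrite -[RHS](I_0 P); apply: I_eq => q; rewrite mulr0.
rewrite subr0 => hle; apply: le_trans hle _.
apply: ler_wpM2l.
  by rewrite !mulr_ge0// addr_ge0// ltW// (lt_trans _ b2).
have [_ p _ _] := hs.
apply: le_trans (state_I_le4 hs (@mf_wt R) (wt_le4 M) hA).
rewrite le_eqVlt; apply/orP; left; apply/eqP/I_eq => x.
by rewrite subr0 ger0_norm.
Qed.

(** A cut superlinear weight can be increased only by the absence of the weight of
    a colliding particle beyond the cut. *)
Lemma Q_cut_conv th N A r f : mf1 th -> (forall z, 0 <= th z <= N) ->
  (forall z z', 0 < z -> z <= z' -> th z <= th z') -> state f ->
  \int[mu]_x (Wt x * f x) <= A ->
  Q (cut r (fun z => z * th z)) f <= 32 * N * A * \int[mu]_x (out r Wt x * f x).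
Proof.
move=> mth thN thm sf hA; have [f1 f0 fn fi] := sf.
have th0 z : 0 <= th z by have /andP[] := thN z.
have N0 : 0 <= N by rewrite (le_trans (th0 0))//; have /andP[] := thN 0.
set w := fun z => z * th z; set phi := cut r w.
have mw : mf1 w by exact: measurable_funM.
have mphi : mf1 phi by exact: mf_cut.
have hrho x : `|phi x| <= `|r| * N.
  rewrite /phi /cut /w; case: ifP => h; last by rewrite normr0 mulr_ge0.
  rewrite normrM (ger0_norm (th0 x)) ler_pM//; last by have /andP[] := thN x.
  exact: le_trans h (ler_norm r).
pose a x := 8 * N * (out r Wt x * f x); pose c x := kap x * f x.
have ia : ig mu a by apply: igZ; exact: (out_ig r sf).
have ic : ig mu c by exact: (sstate_kap M (state_sstate sf)).
have a_ge0 x : 0 <= a x.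
  apply: mulr_ge0; first by apply: mulr_ge0.
  by apply: mulr_ge0 => //; apply: out_ge0; exact: Wt_ge0.
have c_ge0 x : 0 <= c x by apply: mulr_ge0 => //; exact: kap_ge0.
have iac := ig_tensor ia ic; have ica := ig_tensor ic ia.
have iQ := Q_ig M mphi hrho (state_sstate sf).
have ow x : 0 < x -> 0 <= out r w x /\ 2 * (out r w x * (kap x * f x)) <= a x.
  move=> x0; rewrite /a /out /w; case: ifP => _.
    by rewrite lexx !mul0r !mulr0.
  split; first by rewrite mulr_ge0// ltW.
  rewrite (_ : 2 * _ = 2 * (x * kap x) * (th x * f x)); last by ring.
  rewrite (_ : 8 * _ * _ = 2 * (4 * Wt x) * (N * f x)); last by ring.
  apply: ler_pM.
  - by rewrite !mulr_ge0 ?kap_ge0// ltW.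
  - exact: mulr_ge0.
  - rewrite ler_pM2l//; apply: le_trans (kapwt_le_Wt b0 x).
    by rewrite mulrC ler_wpM2l ?kap_ge0// /wt gtr0_norm// lerDr.
  - by rewrite ler_wpM2r//; have /andP[] := thN x.
have pt q : zet phi q * k q * f q.1 * f q.2 <= a q.1 * c q.2 + c q.1 * a q.2.
  have [/andP[q1 q2]|/(k_supp M) ->] := boolP ((0 < q.1) && (0 < q.2)); last first.
    by rewrite mulr0 !mul0r addr_ge0// mulr_ge0.
  have hz : zet phi q <= out r w q.1 + out r w q.2.
    have hg : gainw phi q <= w q.1 + w q.2.
      apply: le_trans (bet_conv M mth th0 thm q1 q2); apply: I_le.
      - exact: (gain_ig M q mphi hrho).
      - apply: (ig_le _ (igZ (N * Num.max q.1 q.2) (bet_num_ig M q))).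
          by apply: measurable_funM => //; exact: (ig_mf (bet_num_ig M q)).
        move=> z; rewrite normrM [`|bet _|]ger0_norm ?(bet_ge0 M)//.
        have [z0|z0] := leP z 0; first by rewrite (bet_pos M)// !mulr0.
        have [zm|zm] := leP (Num.max q.1 q.2) z; first by rewrite (bet_max M)// !mulr0.
        rewrite ler_wpM2r ?(bet_ge0 M)// normrM mulrC (gtr0_norm z0) (ger0_norm (th0 z)).
        by apply: ler_pM => //; [exact: ltW|have /andP[] := thN z|exact: ltW].
      - move=> z; have [z0|z0] := leP z 0; first by rewrite (bet_pos M)// !mulr0.
        rewrite ler_wpM2r ?(bet_ge0 M)// /phi; apply: cut_le.
        by rewrite mulr_ge0// ltW.
    rewrite /zet; have := cut_out r w q.1; have := cut_out r w q.2.
    by rewrite -/phi; lra.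
  have [oa h1] := ow _ q1; have [ob h2] := ow _ q2.
  apply: (@le_trans _ _ ((out r w q.1 + out r w q.2) * (2 * kap q.1 * kap q.2) * f q.1 * f q.2)).
    rewrite ler_wpM2r// ler_wpM2r//.
    apply: (@le_trans _ _ ((out r w q.1 + out r w q.2) * k q)).
      by rewrite ler_wpM2r// (k_ge0 M).
    by rewrite ler_wpM2l ?addr_ge0// (k_le M).
  rewrite [leLHS](_ : _ = 2 * (out r w q.1 * (kap q.1 * f q.1)) * c q.2 +
      c q.1 * (2 * (out r w q.2 * (kap q.2 * f q.2)))); last by rewrite /c; ring.
  by rewrite lerD// ?ler_wpM2r// ler_wpM2l.
have hI : \int[P]_q (zet phi q * k q * f q.1 * f q.2) <=
    2 * (\int[mu]_x a x * \int[mu]_x c x).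
  apply: (@le_trans _ _ (\int[P]_q (a q.1 * c q.2 + c q.1 * a q.2))).
    by apply: I_le => //; exact: igD.
  rewrite (I_D iac ica) !I_tensor//.
  by rewrite [X in _ + X]mulrC mulr_natl mulr2n.
have c4 : \int[mu]_x c x <= 4 * A by exact: (state_kap_le M sf hA).
have a0 : 0 <= \int[mu]_x a x by apply: I_ge0.
have ea : \int[mu]_x a x = 8 * N * \int[mu]_x (out r Wt x * f x).
  by rewrite /a I_Z//; exact: (out_ig r sf).
rewrite /Q; apply: (@le_trans _ _ (\int[mu]_x a x * \int[mu]_x c x)).
  by rewrite mulrC ler_pdivrMr// mulrC.
apply: (le_trans (ler_wpM2l a0 c4)); rewrite ea le_eqVlt; apply/orP; left.
by apply/eqP; ring.
Qed.

Variables (fin : R -> R) (h : R -> R -> R) (A : R).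
Hypothesis sfin : state fin.
Hypothesis mh : mf2 (fun p : R * R => h p.1 p.2).
Hypothesis hst : forall s, state (h s) /\ \int[mu]_x (Wt x * h s x) <= A.

Let A0 : 0 <= A.
Proof. by have [s0 sA] := hst 0; exact: state_I_ge0 s0 sA. Qed.

(** Dominated convergence in time, applied to the tails. *)
Lemma seg_out_cvg c t : 0 <= c -> 0 <= t ->
  (forall n : nat, ig mu (fun s => if seg 0 t s then
     c * \int[mu]_x (out n.+1%:R Wt x * h s x) else 0)) /\
  (fun n : nat => \int[mu]_s (if seg 0 t s then
     c * \int[mu]_x (out n.+1%:R Wt x * h s x) else 0)) @ \oo --> (0 : R).
Proof.
move=> c0 t0.
pose F (n : nat) s := if seg 0 t s then c * \int[mu]_x (out n.+1%:R Wt x * h s x) else 0.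
have mF n : mf1 (F n).
  apply: mf_on_seg; apply: measurable_funM => //.
  have mG : mf2 (fun p : mR * mR => out n.+1%:R Wt p.2 * h p.1 p.2).
    apply: measurable_funM => //; apply: mf_snd; apply: mf_out; exact: mf_Wt.
  exact: (mf_intR mG).
have F0 n s : 0 <= F n s.
  rewrite /F; case: ifP => // _; apply: mulr_ge0 => //; apply: I_ge0 => x.
  by have [[_ p _ _] _] := hst s; rewrite mulr_ge0// out_ge0// Wt_ge0.
have [iseg _] := seg_length t0.
pose G s := c * A * (if seg 0 t s then 1 else 0).
have iG : ig mu G by exact: igZ.
have FG n s : `|F n s| <= G s.
  rewrite ger0_norm// /F /G; case: ifP => _; last by rewrite mulr0.
  rewrite mulr1 ler_wpM2l//; have [hs hA] := hst s; apply: le_trans hA.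
  have [_ p _ _] := hs.
  apply: I_le; [exact: out_ig|exact: (sstate_Wt (state_sstate hs))|].
  by move=> x; rewrite ler_wpM2r// out_le// Wt_ge0.
split; first by move=> n; exact: (ig_le (mF n) iG (FG n)).
have cz : (fun=> 0 : R) @ (\oo : set_system nat) --> (0 : R) by exact: cvg_cst.
suff : \int[mu]_s F n s @[n --> \oo] --> \int[mu]_s (0 : R) by rewrite I_0.
apply: (@I_dct _ _ R mu F (fun=> 0) G) => //.
  apply: aeW => s; rewrite /F; case: (seg 0 t s); last exact: cz.
  have [hs _] := hst s.
  have cc : (fun n : nat => c) @ \oo --> c by exact: cvg_cst.
  by have := cvgM cc (out_cvg hs); rewrite mulr0; exact.
by apply: aeW => s n; exact: FG.
Qed.

Variables (u : R -> R) (t : R).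
Hypothesis t0 : 0 <= t.
Hypothesis iu : ig mu u.
Hypothesis u0 : forall x, 0 <= u x.
Hypothesis un : forall x, x <= 0 -> u x = 0.
Hypothesis hu : forall phi rho, mf1 phi -> (forall x, `|phi x| <= rho) ->
  \int[mu]_x (phi x * (u x - fin x)) =
  \int[mu]_s (if seg 0 t s then Q phi (h s) else 0).

Let bd_ig phi rho : mf1 phi -> (forall x, `|phi x| <= rho) -> ig mu (fun x => phi x * u x).
Proof.
move=> mphi hrho; apply: (ig_le _ (igZ rho (ig_abs iu))).
  by apply: measurable_funM => //; exact: (ig_mf iu).
by move=> x; rewrite normrM ler_wpM2r.
Qed.

Lemma Q_seg_ig phi rho c : mf1 phi -> (forall x, `|phi x| <= rho) ->
  (forall s, `|Q phi (h s)| <= c) -> ig mu (fun s => if seg 0 t s then Q phi (h s) else 0).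
Proof.
move=> mphi hrho hc.
have hb r : 0 <= r -> r < t -> `|Q phi (h r) - 0| <= c by rewrite subr0.
by have [] := seg_bound (mf_Q M mphi mh) t0 hb.
Qed.

(** Letting the cut go to infinity in the equation tested with the cut weight: the
    error integrated in time vanishes. Only [h], a curve of states with uniform
    bounds that agrees with the solution at almost all times, enters it; the
    conclusion holds at the given time. *)
Lemma conv_transport th N : mf1 th -> (forall z, 0 <= th z <= N) ->
  (forall z z', 0 < z -> z <= z' -> th z <= th z') ->
  ig mu (fun x => x * th x * u x) /\
  \int[mu]_x (x * th x * u x) <= \int[mu]_x (x * th x * fin x).
Proof.
move=> mth thN thm.
have th0 z : 0 <= th z by have /andP[] := thN z.
have N0 : 0 <= N by rewrite (le_trans (th0 0))//; have /andP[] := thN 0.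
have [f1 f0 fn fi] := sfin.
set w := fun z => z * th z.
have mw : mf1 w by exact: measurable_funM.
have mu1 := ig_mf iu.
have iwf : ig mu (fun x => w x * fin x).
  apply: (sstate_ig (state_sstate sfin) mw (c := 4 * N)) => x.
  rewrite /w normrM (ger0_norm (th0 x)).
  rewrite (_ : 4 * N * Wt x = 4 * Wt x * N); last by ring.
  by apply: ler_pM => //; [exact: (id_le4 M)|have /andP[] := thN x].
set C := \int[mu]_x (w x * fin x).
have hrho (r : R) x : `|cut r w x| <= `|r| * N.
  rewrite /cut /w; case: ifP => hx; last by rewrite normr0 mulr_ge0.
  rewrite normrM (ger0_norm (th0 x)) ler_pM//; last by have /andP[] := thN x.
  exact: le_trans hx (ler_norm r).
have cu r x : 0 <= cut r w x * u x.
  have [x0|x0] := leP x 0; first by rewrite un// mulr0.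
  by rewrite mulr_ge0// cut_ge0// /w mulr_ge0// ltW.
have cle r x : cut r w x * fin x <= w x * fin x.
  have [x0|x0] := leP x 0; first by rewrite fn// !mulr0.
  by rewrite ler_wpM2r// cut_le// /w mulr_ge0// ltW.
have c320 : 0 <= 32 * N * A by rewrite !mulr_ge0.
have [ie ce] := seg_out_cvg c320 t0.
have key (n : nat) : \int[mu]_x (cut n.+1%:R w x * u x) <= C +
    \int[mu]_s (if seg 0 t s then 32 * N * A * \int[mu]_x (out n.+1%:R Wt x * h s x) else 0).
  have mphi : mf1 (cut n.+1%:R w) by exact: mf_cut.
  have hr := hrho n.+1%:R.
  have e := hu mphi hr.
  have i1 := bd_ig mphi hr; have i2 := sstate_bd (state_sstate sfin) mphi hr.
  have e' : \int[mu]_x (cut n.+1%:R w x * (u x - fin x)) =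
     \int[mu]_x (cut n.+1%:R w x * u x) - \int[mu]_x (cut n.+1%:R w x * fin x).
    by rewrite -(I_B i1 i2); apply: I_eq => x; rewrite mulrBr.
  have lf : \int[mu]_x (cut n.+1%:R w x * fin x) <= C by apply: I_le.
  have lQ : \int[mu]_s (if seg 0 t s then Q (cut n.+1%:R w) (h s) else 0) <=
      \int[mu]_s (if seg 0 t s then 32 * N * A * \int[mu]_x (out n.+1%:R Wt x * h s x) else 0).
    apply: I_le => //.
      apply: (Q_seg_ig mphi hr (c := `|n.+1%:R| * N * (16 * (beta0 + 2)) * A *  (4 * A))).
      by move=> s; have [hs hA] := hst s; exact: Q_rho.
    move=> s; case: ifP => // _; have [hs hA] := hst s.
    exact: Q_cut_conv.
  move: e lf lQ; rewrite e'.
  move: (\int[mu]_x (cut n.+1%:R w x * u x)) (\int[mu]_x (cut n.+1%:R w x * fin x)) => a b.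
  by move: (\int[mu]_s _) (\int[mu]_s _) => a' b' h1 h2 h3; lra.
apply: (@ig_exhaust _ _ R mu _ (fun n x => `|x| <= n.+1%:R)).
- exact: measurable_funM.
- move=> x; have [x0|x0] := leP x 0; first by rewrite un// mulr0.
  by rewrite !mulr_ge0// ltW.
- by move=> x m n mn hx; apply: le_trans hx _; rewrite ler_nat ltnS.
- by move=> x; exists (Num.truncn `|x|); rewrite ltW// truncnS_gt.
move=> n.
have e x : (if `|x| <= n.+1%:R then x * th x * u x else 0) = cut n.+1%:R w x * u x.
  by rewrite /cut; case: ifP; rewrite ?mul0r.
have ic (m : nat) : ig mu (fun x => cut m.+1%:R w x * u x).
  by apply: (bd_ig _ (hrho m.+1%:R)); exact: mf_cut.
split; first by under eq_fun do rewrite e; exact: ic.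
rewrite (_ : \int[mu]_x _ = \int[mu]_x (cut n.+1%:R w x * u x)); last exact: I_eq.
apply/ler_addgt0Pr => eps eps0.
have /cvgrPdist_le/(_ _ eps0)[m _ hm] := ce.
have {hm} := hm (maxn m n) (leq_maxl m n); rewrite /= sub0r normrN => hm.
have hm' := le_trans (ler_norm _) hm.
apply: (@le_trans _ _ (\int[mu]_x (cut (maxn m n).+1%:R w x * u x))).
  apply: I_le => // x; have [x0|x0] := leP x 0; first by rewrite un// !mulr0.
  rewrite ler_wpM2r// /cut; case: ifP => h1; last first.
    by case: ifP => // _; rewrite /w mulr_ge0// ltW.
  by rewrite ifT//; apply: le_trans h1 _; rewrite ler_nat ltnS leq_maxr.
by apply: le_trans (key _) _; rewrite lerD2l.
Qed.

(** The weight [|x| `^ beta] beyond [r], reached through bounded monotone weights. *)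
Lemma moment_transport r : 0 <= r ->
  let th := out r (fun x : R => `|x| `^ beta) in
  ig mu (fun x => x * th x * u x) /\
  \int[mu]_x (x * th x * u x) <= \int[mu]_x (x * th x * fin x).
Proof.
move=> r0 th; have [f1 f0 fn fi] := sfin.
have mpow : mf1 th by apply: mf_out; exact: mf_powabs.
have th0 z : 0 <= th z by apply: out_ge0; exact: powR_ge0.
have mxth : mf1 (fun x => x * th x) by exact: measurable_funM.
have xth4 x : `|x * th x| <= 4 * Wt x.
  rewrite /th /out; case: ifP => _; last exact: (idpow_le4 M).
  by rewrite mulr0 normr0 mulr_ge0// Wt_ge0.
(* bounded weights are needed to test, hence the exhaustion by minima *)
pose thn (n : nat) := out r (fun x : R => Num.min `|x| n%:R `^ beta).
have mthn n : mf1 (thn n).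
  apply: mf_out; apply: (measurableT_comp (measurable_powR beta)).
  apply: measurable_minr => //; exact: mf_absR.
have m0 (n : nat) (x : R) : 0 <= Num.min `|x| n%:R by rewrite le_min normr_ge0 ler0n.
have thN n z : 0 <= thn n z <= n%:R `^ beta.
  rewrite /thn /out; case: ifP => _; first by rewrite lexx powR_ge0.
  by rewrite powR_ge0/= ge0_ler_powR// ?nnegrE// ge_min lexx orbT.
have thm n z z' : 0 < z -> z <= z' -> thn n z <= thn n z'.
  move=> z0 zz; have z0' := lt_le_trans z0 zz.
  rewrite /thn /out; case: ifP => h1; case: ifP => h2 //.
  - by move: h1 h2; rewrite !gtr0_norm// => h1 h2; rewrite (le_trans zz) in h1.
  - rewrite ge0_ler_powR// ?nnegrE// !gtr0_norm//.
    by rewrite le_min !ge_min zz lexx orbT.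
have thle n z : thn n z <= th z.
  rewrite /thn /th /out; case: ifP => // _.
  by rewrite ge0_ler_powR// ?nnegrE// ge_min lexx.
have hn n := conv_transport (mthn n) (thN n) (@thm n).
apply: (@ig_exhaust _ _ R mu _ (fun n x => `|x| <= n%:R)).
- by apply: measurable_funM => //; exact: (ig_mf iu).
- move=> x; have [x0|x0] := leP x 0; first by rewrite un// mulr0.
  by rewrite !mulr_ge0// ltW.
- by move=> x m n mn hx; apply: le_trans hx _; rewrite ler_nat.
- by move=> x; exists (Num.truncn `|x|).+1; rewrite ltW// truncnS_gt.
move=> n; have [i1 l1] := hn n.
have pt x : 0 <= (if `|x| <= n%:R then x * th x * u x else 0) <= x * thn n x * u x.
  have [x0|x0] := leP x 0; first by rewrite un// !mulr0 if_same lexx.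
  have p y : 0 <= y -> 0 <= x * y * u x by move=> y0; rewrite !mulr_ge0// ltW.
  case: ifP => h1; last by rewrite lexx p//; have /andP[] := thN n x.
  rewrite p// /th /thn /out; case: ifP => _; first by rewrite !mulr0 mul0r lexx.
  by rewrite (min_idPl h1) lexx.
have i2 : ig mu (fun x => if `|x| <= n%:R then x * th x * u x else 0).
  apply: (ig_le _ i1).
    apply: measurable_fun_ifT => //; first exact: mf_ball.
    by apply: measurable_funM => //; exact: (ig_mf iu).
  by move=> x; have /andP[p1 p2] := pt x; rewrite ger0_norm.
split; first exact: i2.
apply: (@le_trans _ _ (\int[mu]_x (x * thn n x * u x))).
  by apply: I_le => // x; have /andP[] := pt x.
apply: (le_trans l1); apply: I_le.
- apply: (sstate_ig (state_sstate sfin) (c := 4)).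
    by apply: measurable_funM.
  move=> x; apply: le_trans (xth4 x); rewrite !normrM ler_wpM2l//.
  by rewrite !ger0_norm//; have /andP[] := thN n x.
- exact: (sstate_ig (state_sstate sfin) mxth xth4).
- move=> x; have [x0|x0] := leP x 0; first by rewrite fn// !mulr0.
  by rewrite ler_wpM2r// ler_wpM2l// ltW.
Qed.

End Uniqueness.

(** * Uniqueness *)

Lemma ae_and d (T : measurableType d) (R : realType) (nu : {measure set T -> \bar R})
    (A B : T -> Prop) : {ae nu, forall x, A x} -> {ae nu, forall x, B x} ->
  {ae nu, forall x, A x /\ B x}.
Proof. by move=> hA hB; exact: filterI hA hB. Qed.

Section Regularity.
Context {R : realType}.
Local Notation mu := (@lebesgue_measure R).
Variables (beta beta0 : R) (k : R * R -> R) (bet : R * (R * R) -> R).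
Hypothesis M : breakage_model beta beta0 k bet.

Let b0 := beta_ge0 M.
Let b1 := beta_le1 M.
Let b2 := beta0_gt2 M.

Local Notation wt := (@wt R).
Local Notation Wt := (Wt beta).
Local Notation state := (state beta).
Local Notation Q := (Q k bet).
Implicit Types (f g u v phi : R -> R) (rho c A : R) (q : R * R).

Local Notation bounded_states := (bounded_states beta).
Local Notation approx_sol := (approx_sol k bet).

Implicit Types (F : R -> R -> R).

Lemma approx_solC T C C' F : C <= C' -> approx_sol T 0 C F -> approx_sol T 0 C' F.
Proof.
move=> CC hF phi rho s t h1 h2 h3 h4 h5; apply: le_trans (hF _ _ _ _ h1 h2 h3 h4 h5) _.
have r0 : 0 <= rho by rewrite (le_trans _ (h2 0)).
apply: ler_wpM2r; last by rewrite ler_wpM2l.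
by apply: mulr_ge0; rewrite ?addr0 subr_ge0.
Qed.

Lemma bounded_statesA T A A' F : A <= A' -> bounded_states T A F -> bounded_states T A' F.
Proof. by move=> AA hF t /hF[h1 h2]; split=> //; exact: le_trans AA. Qed.

Lemma Cbound_le A A' : 0 <= A -> A <= A' -> Cbound beta0 A <= Cbound beta0 A'.
Proof.
move=> A0 AA; rewrite /Cbound.
have c0 : 0 <= 16 * (beta0 + 2) by rewrite mulr_ge0// addr_ge0// ltW// (lt_trans _ b2).
apply: ler_pM.
- exact: mulr_ge0.
- by apply: mulr_ge0 => //; exact: mulr_ge0.
- exact: ler_wpM2l.
- by apply: ler_wpM2l => //; exact: ler_pM.
Qed.

Variables (fin : R -> R) (h g : R -> R -> R) (A T : R).
Hypothesis sfin : state fin.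
Hypothesis mh : mf2 (fun p : R * R => h p.1 p.2).
Hypothesis hst : forall s, state (h s) /\ \int[mu]_x (Wt x * h s x) <= A.
Hypothesis T0 : 0 <= T.
Hypothesis mg : mf2 (fun p : R * R => g p.1 p.2).
Hypothesis gi : forall t, 0 <= t <= T -> ig mu (g t).
Hypothesis g0 : forall t x, 0 <= g t x.
Hypothesis gn : forall t x, x <= 0 -> g t x = 0.
Hypothesis gh : {ae mu, forall s, 0 < s < T -> h s = g s}.
Hypothesis hg : forall t phi rho, 0 <= t <= T -> mf1 phi -> (forall x, `|phi x| <= rho) ->
  \int[mu]_x (phi x * (g t x - fin x)) =
  \int[mu]_s (if seg 0 t s then Q phi (g s) else 0).

Let A0 : 0 <= A.
Proof. by have [s0 sA] := hst 0; exact: state_I_ge0 s0 sA. Qed.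

Let c20 : 0 <= 16 * (beta0 + 2).
Proof. by rewrite mulr_ge0// addr_ge0// ltW// (lt_trans _ b2). Qed.

(** Integrals in time ignore the exceptional times. *)
Lemma replace_curve t phi : mf1 phi -> 0 <= t <= T ->
  \int[mu]_s (if seg 0 t s then Q phi (g s) else 0) =
  \int[mu]_s (if seg 0 t s then Q phi (h s) else 0).
Proof.
move=> mphi /andP[t0 tT]; apply: I_ae_eq.
- by apply: mf_on_seg; exact: (mf_Q M mphi mg).
- by apply: mf_on_seg; exact: (mf_Q M mphi mh).
have n0 : {ae mu, forall s : R, s != 0}.
  exists [set 0]; split => //=; first by rewrite lebesgue_measure_set1.
  by move=> s /= /negP; rewrite negbK => /eqP.
apply: ae_imp (ae_and gh n0) => s [hs s0]; rewrite /seg; case: ifP => // /andP[s1 s2].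
by rewrite hs// lt_neqAle eq_sym s0 s1 (lt_le_trans s2).
Qed.

Definition solution_bound : R := \int[mu]_x fin x + T * (16 * (beta0 + 2) * (A * A)) +
  \int[mu]_x (x * out 0 (fun x : R => `|x| `^ beta) x * fin x).

Lemma solution_mom t : 0 <= t <= T -> forall r, 0 <= r ->
  let th := out r (fun x : R => `|x| `^ beta) in
  ig mu (fun x => x * th x * g t x) /\
  \int[mu]_x (x * th x * g t x) <= \int[mu]_x (x * th x * fin x).
Proof.
move=> tT r r0; have /andP[t0 _] := tT.
apply: (moment_transport M sfin mh hst t0 (gi tT) (g0 t) (@gn t) _ r0).
by move=> phi rho mphi hrho; rewrite (hg tT mphi hrho) replace_curve.
Qed.

(** The number is bounded by integrating the equation with the test [1], and the
    moment of order [1 + beta] by [solution_mom] without cut. *)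
Lemma solution_bounded : bounded_states T solution_bound g.
Proof.
move=> t tT; have /andP[t0 tT'] := tT.
have [f1 f0 fn fi] := sfin.
have [im lm] := solution_mom tT (lexx 0).
set th := out 0 _ in im lm.
have eW x : Wt x * g t x = g t x + x * th x * g t x.
  have [x0|x0] := leP x 0; first by rewrite gn// !mulr0 addr0.
  rewrite /Wt /th /out gtr0_norm// leNgt x0/= powRD1 ?(ltW x0)//.
  by rewrite mulrDl mul1r.
have iW : ig mu (fun x => Wt x * g t x).
  by have := igD (gi tT) im; congr (_.-integrable _ _); apply/funext => x /=; rewrite eW.
have st : state (g t) by split; [exact: (ig_mf (gi tT))|exact: g0|exact: gn|exact: iW].
split=> //.
rewrite (_ : \int[mu]_x _ = \int[mu]_x g t x + \int[mu]_x (x * th x * g t x)); last first.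
  by rewrite -(I_D (gi tT) im); apply: I_eq.
rewrite /solution_bound; apply: lerD => //.
pose one : R -> R := fun=> 1.
have m1 : mf1 one by exact: measurable_cst.
have r1 (x : R) : `|one x| <= 1 by rewrite normr1.
have w1 (x : R) : `|one x| <= wt x by rewrite normr1 wt_ge1.
have e := hg tT m1 r1; rewrite replace_curve// in e.
have hQ r : 0 <= r -> r < t -> `|Q one (h r) - 0| <= 16 * (beta0 + 2) * (A * A).
  by move=> _ _; rewrite subr0; have [hs hA] := hst r; exact: (Q_bound M m1 r1 w1 hs hA).
have [_ ] := seg_bound (mf_Q M m1 mh) t0 hQ; rewrite mulr0 !subr0 -e => hb.
have e2 : \int[mu]_x (one x * (g t x - fin x)) = \int[mu]_x g t x - \int[mu]_x fin x.
  rewrite -(I_B (gi tT) (sstate_1 (state_sstate sfin))).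
  by apply: I_eq => x; rewrite /one mul1r.
rewrite e2 in hb; rewrite -lerBlDl; apply: le_trans (ler_norm _) (le_trans hb _).
by rewrite ler_wpM2r// mulr_ge0// mulr_ge0.
Qed.

Lemma solution_tail t r : 1 <= r -> 0 <= t <= T ->
  \int[mu]_x (out r Wt x * g t x) <= tail_bound beta fin r.
Proof.
move=> r1 tT; have [st _] := solution_bounded tT.
have [_ lm] := solution_mom tT (le_trans ler01 r1).
exact: (out_moment M st sfin r1 lm).
Qed.

(** The equation between two times, now with states at all times. *)
Lemma solution_mean_value : mean_value k bet T 0 g.
Proof.
move=> phi rho s t v e mphi hrho s0 st tT hv.
have t0 := le_trans s0 st.
have tI : 0 <= t <= T by rewrite t0.
have sI : 0 <= s <= T by rewrite s0 (le_trans st).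
have mQ := mf_Q M mphi mg.
have hve r : s <= r -> r < t -> `|Q phi (g r) - v| <= e.
  by move=> sr rt; apply: hv; [exact: le_trans sr|rewrite subr0|exact: ltW].
have [i2 l2] := seg_bound mQ st hve.
have hb r : 0 <= r -> r < s ->
    `|Q phi (g r) - 0| <= rho * (16 * (beta0 + 2)) * solution_bound * (4 * solution_bound).
  move=> r0 rs; rewrite subr0.
  have [rg rA] : state (g r) /\ \int[mu]_x (Wt x * g r x) <= solution_bound.
    by apply: solution_bounded; rewrite r0 (le_trans (ltW rs))// (le_trans st).
  exact: (Q_rho M mphi hrho rg rA).
have [i1 _] := seg_bound mQ s0 hb.
have [gt _] := solution_bounded tI; have [gs _] := solution_bounded sI.
have j1 := sstate_bd (sstateB (state_sstate gt) (state_sstate sfin)) mphi hrho.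
have j2 := sstate_bd (sstateB (state_sstate gs) (state_sstate sfin)) mphi hrho.
rewrite (_ : \int[mu]_x (phi x * _) = \int[mu]_r (if seg s t r then Q phi (g r) else 0))//.
have := hg tI mphi hrho; rewrite (seg_add s0 st i1 i2) -(hg sI mphi hrho) => /eqP.
rewrite addrC -subr_eq -(I_B j1 j2) => /eqP <-.
by apply: I_eq => x; ring.
Qed.

(** At time zero the equation says that the difference pairs to zero with every
    test, in particular with its own sign. *)
Lemma solution_init : {ae mu, forall x, g 0 x = fin x}.
Proof.
have oI : 0 <= (0 : R) <= T by rewrite lexx.
have [gs _] := solution_bounded oI.
have sE := sstateB (state_sstate gs) (state_sstate sfin); have [mE _ _] := sE.
have iE := sstate_1 (sstate_abs sE).
pose phi := sgnf (fun x => g 0 x - fin x).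
have hp x : `|phi x| <= 1 by rewrite sgnf_norm.
have e := hg oI (mf_sgnf mE) hp.
have z : \int[mu]_x `|g 0 x - fin x| <= 0.
  rewrite le_eqVlt; apply/orP; left; apply/eqP.
  transitivity (\int[mu]_x (phi x * (g 0 x - fin x))).
    by apply: I_eq => x; rewrite /phi -(sgnfM (fun x => g 0 x - fin x)).
  rewrite e -[RHS](I_0 mu); apply: I_eq => s; rewrite /seg.
  by case: leP => //= s0; rewrite ltNge s0.
apply: ae_imp (I_eq0_ae iE (fun x => normr_ge0 _) z) => x /eqP.
by rewrite normr_eq0 subr_eq0 => /eqP.
Qed.

(** The stability estimate with no lags and with equal initial data leaves the tail
    of the initial datum, which is arbitrarily small. *)
Theorem model_uniqueness (f : R -> R -> R) (Af : R) : bounded_states T Af f ->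
  approx_sol T 0 (Cbound beta0 Af) f ->
  (forall t r, 0 <= t <= T -> 1 <= r ->
     \int[mu]_x (out r Wt x * f t x) <= tail_bound beta fin r) ->
  {ae mu, forall x, f 0 x = fin x} ->
  forall t, 0 <= t <= T -> {ae mu, forall x, g t x = f t x}.
Proof.
move=> bf af tf fin0 t tT; have /andP[t0 tT'] := tT.
have bg := solution_bounded.
have ag := mean_value_approx M (lexx 0) solution_mean_value bg.
have oI : 0 <= (0 : R) <= T by rewrite lexx.
have [f0s f0A] := bf _ oI; have [g0s g0A] := bg _ oI.
have Af0 := state_I_ge0 f0s f0A; have Ag0 := state_I_ge0 g0s g0A.
pose AA := Num.max Af solution_bound.
have fA : Af <= AA by rewrite le_max lexx.
have gA : solution_bound <= AA by rewrite le_max lexx orbT.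
have AA0 := le_trans Af0 fA.
pose C := Cbound beta0 AA.
have C0 : 0 <= C.
  rewrite /C /Cbound; apply: mulr_ge0; first exact: mulr_ge0.
  by apply: mulr_ge0 => //; exact: mulr_ge0.
have af' := approx_solW tT' (approx_solC (Cbound_le Af0 fA) af).
have ag' := approx_solW tT' (approx_solC (Cbound_le Ag0 gA) ag).
have bf' := bounded_statesW tT' (bounded_statesA fA bf).
have bg' := bounded_statesW tT' (bounded_statesA gA bg).
have [gt _] := bg _ tT; have [ft _] := bf _ tT.
have sE := sstateB (state_sstate ft) (state_sstate gt).
have iE := sstate_wt M (sstate_abs sE).
pose c := 16 * (beta0 + 1) * AA.
have c0 : 0 <= c.
  by rewrite /c !mulr_ge0// addr_ge0// ltW// (lt_trans _ b2).
have e0 : {ae mu, forall x, f 0 x = g 0 x}.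
  by apply: ae_imp (ae_and fin0 solution_init) => x [-> ->].
have key (r : R) : 1 <= r -> \int[mu]_x (wt x * `|f t x - g t x|) <=
    (expR (2 * c * t) * (t * (c * 10)) + 8) * tail_bound beta fin r.
  move=> r1; have r0 := le_trans ler01 r1.
  have hts s : 0 <= s <= t -> \int[mu]_x (out r Wt x * f s x) <= tail_bound beta fin r /\
     \int[mu]_x (out r Wt x * g s x) <= tail_bound beta fin r.
    move=> /andP[s0 st]; have sI : 0 <= s <= T by rewrite s0 (le_trans st).
    by split; [exact: tf|exact: solution_tail].
  have := approx_stab M t0 (lexx 0) (lexx 0) C0 r0 af' ag' bf' bg' hts.
  rewrite /= addr0 mulr0 addr0 -/c.
  have -> : \int[mu]_x (cut r wt x * `|f 0 x - g 0 x|) = 0.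
    have sE0 := sstateB (state_sstate f0s) (state_sstate g0s); have [mE0 _ _] := sstate_abs sE0.
    rewrite -[RHS](I_0 mu); apply: I_ae_eq => //.
      by apply: measurable_funM => //; apply: mf_cut; exact: mf_wt.
    by apply: ae_imp e0 => x ->; rewrite subrr normr0 mulr0.
  rewrite add0r => hs.
  have tI : 0 <= t <= t by rewrite t0 lexx.
  have [tf1 tg1] := hts t tI.
  apply: le_trans (dist_cut_tail M ft gt tf1 tg1) _.
  by rewrite [leRHS]mulrDl lerD2r; apply: le_trans hs _; rewrite !mulrA.
pose K := expR (2 * c * t) * (t * (c * 10)) + 8.
have K0 : 0 < K.
  by rewrite /K ltr_wpDl// mulr_ge0 ?expR_ge0// mulr_ge0// mulr_ge0.
have z : \int[mu]_x (wt x * `|f t x - g t x|) <= 0.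
  apply/ler_addgt0Pr => eps eps0; rewrite add0r.
  have eK : 0 < eps / K by rewrite divr_gt0.
  have [n n0 hn] := tail_bound_small sfin eK.
  apply: le_trans (key n%:R _) _; first by rewrite ler1n.
  by rewrite -/K mulrC -ler_pdivlMr.
apply: ae_imp (I_eq0_ae iE _ z) => x.
  move/eqP; rewrite mulf_eq0 => /orP[/eqP w0|].
    by have := wt_ge1 x; rewrite w0 ler10.
  by rewrite normr_eq0 subr_eq0 => /eqP.
by rewrite mulr_ge0// wt_ge0.
Qed.

End Regularity.

(** * Coefficients extended by zero *)

Section Coefficients.
Context {R : realType}.
Local Notation mu := (@lebesgue_measure R).
Local Notation mR := (measurableTypeR R).
Variables (alpha beta beta0 : R) (b bbar : R -> R -> R -> R).
Hypotheses (halpha : 0 <= alpha) (hab : alpha <= beta) (hbeta : beta <= 1).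
Hypothesis hb : daughter_distribution b.
Hypothesis hb_mass : forall x y, 0 < x -> 0 < y ->
  (\int[mu]_(z in `]0%R, (x + y)%R[) (z * b z x y)%:E = (x + y)%:E)%E.
Hypothesis hbbar : daughter_distribution bbar.
Hypothesis hb_split : forall z x y, 0 < z -> 0 < x -> 0 < y ->
  b z x y = bbar z x y * \1_(`]0, x[) z + bbar z y x * \1_(`]0, y[) z.
Hypothesis hbbar_mass : forall x y, 0 < x -> 0 < y ->
  (\int[mu]_(z in `]0%R, x[) (z * bbar z x y)%:E = x%:E)%E.
Hypothesis hbeta0 : 2 < beta0.
Hypothesis hb_number : forall x y, 0 < x -> 0 < y ->
  (\int[mu]_(z in `]0%R, (x + y)%R[) (b z x y)%:E <= beta0%:E)%E.

Lemma in_halfline (x : R) : halfline x = (0 < x) :> Prop.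
Proof. by rewrite /halfline/= in_itv/= andbT. Qed.

Lemma mhalf : measurable (halfline : set mR).
Proof. exact: measurable_itv. Qed.

Definition coll_kernel (q : R * R) : R :=
  if (0 < q.1) && (0 < q.2) then collision_kernel alpha beta q.1 q.2 else 0.

Definition ext3 (c : R -> R -> R -> R) (p : R * (R * R)) : R :=
  if [&& 0 < p.1, 0 < p.2.1 & 0 < p.2.2] then c p.1 p.2.1 p.2.2 else 0.

Definition coll_daughter : R * (R * R) -> R := ext3 b.

(** The pieces of the first of the two colliding particles. *)
Definition coll_fragment (p : R * (R * R)) : R := if p.1 < p.2.1 then ext3 bbar p else 0.

Lemma mf_pos1 : measurable_fun setT (fun x : mR => 0 < x).
Proof. exact: measurable_fun_ltr. Qed.

Lemma mf_ext3 c : daughter_distribution c -> mf3 (ext3 c).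
Proof.
move=> [mc _].
pose D : set (mR * mR * mR) := halfline `*` halfline `*` halfline.
have mD : measurable D.
  by apply: measurableX; [apply: measurableX|]; exact: mhalf.
have mcD : measurable_fun setT ((fun q : mR * mR * mR => c q.1.1 q.1.2 q.2) \_ D).
  by apply/(measurable_restrictT _ mD).
have ma : measurable_fun setT (fun p : mR * (mR * mR) => ((p.1, p.2.1), p.2.2)).
  apply/measurable_fun_pairP; split => /=; last first.
    exact: (measurableT_comp (@measurable_snd _ _ mR mR) (@measurable_snd _ _ mR (mR * mR)%type)).
  apply/measurable_fun_pairP; split => /=; first exact: measurable_fst.
  exact: (measurableT_comp (@measurable_fst _ _ mR mR) (@measurable_snd _ _ mR (mR * mR)%type)).
have := measurableT_comp mcD ma; congr measurable_fun.
apply/funext => -[z [x y]] /=; rewrite /patch /ext3 /=.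
case: ifPn => [|] h.
  have {h} : D ((z, x), y) by rewrite inE in h.
  by rewrite /D /= => -[[/=]]; rewrite !in_halfline => -> -> ->.
rewrite ifF//; apply/negbTE/negP => /and3P[z0 x0 y0]; move/negP: h; apply.
by rewrite inE /D/=; rewrite !in_halfline.
Qed.

Lemma mf_coll_fragment : mf3 coll_fragment.
Proof.
apply: measurable_fun_ifT => //; last exact: mf_ext3.
apply: measurable_fun_ltr; first exact: measurable_fst.
exact: (measurableT_comp (@measurable_fst _ _ mR mR) (@measurable_snd _ _ mR (mR * mR)%type)).
Qed.

Lemma ext3_ge0 c p : daughter_distribution c -> 0 <= ext3 c p.
Proof. by move=> [_ c0]; rewrite /ext3; case: ifP => // /and3P[]; exact: c0. Qed.

Lemma mf_section (F : R * (R * R) -> R) q : mf3 F -> mf1 (fun z => F (z, q)).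
Proof.
move=> mF; have mh : measurable_fun setT (fun z : mR => (z, q) : mR * (mR * mR)).
  exact/measurable_pair2.
exact: (measurableT_comp mF mh).
Qed.

Lemma coll_daughter_max z x y : Num.max x y <= z -> coll_daughter (z, (x, y)) = 0.
Proof.
move=> hz; rewrite /coll_daughter /ext3/=; case: ifP => // /and3P[z0 x0 y0].
move: hz; rewrite ge_max => /andP[xz yz].
rewrite hb_split// !indicE !mem_setE !in_itv/= z0/= !ltNge xz yz/=.
by rewrite !mulr0 addr0.
Qed.

Lemma coll_daughter_split z q : 0 < q.1 -> 0 < q.2 ->
  coll_daughter (z, q) = coll_fragment (z, q) + coll_fragment (z, (q.2, q.1)).
Proof.
case: q => x y /= x0 y0; rewrite /coll_daughter /coll_fragment /ext3/= x0 y0/=.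
have [z0|z0] := ltP 0 z; last by rewrite !if_same addr0.
rewrite /= hb_split// !indicE !mem_setE !in_itv/= z0/=.
by case: ltP => _; case: ltP => _; rewrite ?mulr1 ?mulr0.
Qed.

Lemma coll_daughter_int v q : 0 < q.1 -> 0 < q.2 ->
  (\int[mu]_z (v z * coll_daughter (z, q))%:E =
   \int[mu]_(z in `]0%R, (q.1 + q.2)%R[) (v z * b z q.1 q.2)%:E)%E.
Proof.
case: q => x y /= x0 y0; rewrite [RHS]integral_mkcond.
apply: eq_integral => z _; rewrite /patch mem_setE in_itv/=.
have [zxy|zxy] := ltP z (x + y).
  rewrite andbT /coll_daughter /ext3/= x0 y0 !andbT; case: ifP => //.
  by rewrite mulr0.
rewrite andbF coll_daughter_max ?mulr0//.
by rewrite ge_max !(le_trans _ zxy)// ?lerDl ?lerDr ltW.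
Qed.

Lemma coll_fragment_mass q : 0 < q.1 -> 0 < q.2 ->
  ig mu (fun z => z * coll_fragment (z, q)) /\ \int[mu]_z (z * coll_fragment (z, q)) = q.1.
Proof.
case: q => x y /= x0 y0.
have e : (\int[mu]_z (z * coll_fragment (z, (x, y)))%:E = x%:E)%E.
  rewrite -(hbbar_mass x0 y0) [RHS]integral_mkcond.
  apply: eq_integral => z _; rewrite /patch mem_setE in_itv/= /coll_fragment /ext3/= x0 y0 !andbT.
  by case: ltP => z0/=; case: ltP => // _; rewrite mulr0.
have [|||h1 h2] := @ig_bound _ _ R mu (fun z => z * coll_fragment (z, (x, y))) x.
- by apply: measurable_funM => //; apply: mf_section; exact: mf_coll_fragment.
- move=> z; rewrite /coll_fragment/=; case: ifP => _; last by rewrite mulr0.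
  rewrite /ext3/=; case: ifP => [/and3P[z0 _ _]|_]; last by rewrite mulr0.
  by apply: mulr_ge0; [exact: ltW|have [_ c0] := hbbar; exact: c0].
- by rewrite e.
by split=> //; rewrite /Rintegral e.
Qed.

(** Monotonicity of [th] is used on each parent separately, where [th z <= th x]. *)
Lemma coefficients_model : breakage_model beta beta0 coll_kernel coll_daughter.
Proof.
have hbeta' := le_trans halpha hab.
have suppb z q : ~~ ((0 < q.1) && (0 < q.2)) -> coll_daughter (z, q) = 0.
  by rewrite /coll_daughter /ext3/= => /negbTE ->; rewrite andbF.
have num q : ig mu (fun z => coll_daughter (z, q)) /\ \int[mu]_z coll_daughter (z, q) <= beta0.
  have [/andP[q1 q2]|hq] := boolP ((0 < q.1) && (0 < q.2)); last first.
    have e z := suppb z q hq.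
    split.
      by have := ig0 mu; congr (_.-integrable _ _); apply/funext => z /=; rewrite e.
    rewrite (_ : \int[mu]_z _ = 0); first by rewrite ltW// (lt_trans _ hbeta0).
    by rewrite -[RHS](I_0 mu); apply: I_eq => z.
  apply: ig_bound.
  - by apply: mf_section; exact: mf_ext3.
  - by move=> z; exact: ext3_ge0.
  have -> : (\int[mu]_z (coll_daughter (z, q))%:E =
      \int[mu]_(z in `]0%R, (q.1 + q.2)%R[) (b z q.1 q.2)%:E)%E.
    transitivity (\int[mu]_z ((fun=> 1 : R) z * coll_daughter (z, q))%:E)%E.
      by apply: eq_integral => z _; rewrite mul1r.
    rewrite (coll_daughter_int (fun=> 1) q1 q2).
    by apply: eq_integral => z _; rewrite mul1r.
  exact: hb_number.
split=> //.
- apply: measurable_fun_ifT => //.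
    by apply: measurable_and; [exact: (mf_fst mf_pos1)|exact: (mf_snd mf_pos1)].
  have mp r : mf1 (fun x : R => x `^ r) by exact: measurable_powR.
  apply: measurable_funD; apply: measurable_funM.
  + exact: (mf_fst (mp alpha)).
  + exact: (mf_snd (mp beta)).
  + exact: (mf_fst (mp beta)).
  + exact: (mf_snd (mp alpha)).
- move=> q; rewrite /coll_kernel; case: ifP => // _.
  by rewrite /collision_kernel addr_ge0// mulr_ge0// powR_ge0.
- by move=> q /negbTE; rewrite /coll_kernel => ->.
- move=> x y; rewrite /coll_kernel/= andbC; case: ifP => // _.
  by rewrite /collision_kernel addrC; congr (_ + _); rewrite mulrC.
- move=> q; rewrite /coll_kernel; case: ifP => [/andP[q1 q2]|_]; last first.
    by rewrite !mulr_ge0 ?(le_trans ler01 (kap_ge1 _ _)).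
  have h r x : 0 <= r <= beta -> 0 < x -> 0 <= x `^ r <= kap beta x.
    move=> hr x0; rewrite powR_ge0/= /kap gtr0_norm//.
    by apply: powR_le_mid => //; exact: ltW.
  rewrite /collision_kernel.
  have ha : 0 <= alpha <= beta by rewrite halpha.
  have hbb : 0 <= beta <= beta by rewrite hbeta' lexx.
  have /andP[p1 l1] := h _ _ ha q1; have /andP[p2 l2] := h _ _ ha q2.
  have /andP[p3 l3] := h _ _ hbb q1; have /andP[p4 l4] := h _ _ hbb q2.
  rewrite -mulrA mulr_natl mulr2n lerD// ler_pM//.
- exact: mf_ext3.
- by move=> q; exact: ext3_ge0.
- move=> z x y; have [/andP[x0 y0]|h] := boolP ((0 < x) && (0 < y)); last first.
    by rewrite !suppb//= andbC.
  by rewrite !coll_daughter_split//= addrC.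
- by move=> z q z0; rewrite /coll_daughter /ext3/= ltNge z0.
- by move=> z [x y]; exact: coll_daughter_max.
- by move=> q; have [] := num q.
- by move=> q; have [] := num q.
- move=> q q1 q2; rewrite /Rintegral (coll_daughter_int id q1 q2) hb_mass//.
- move=> th q mth th0 thm q1 q2.
  have [i1 e1] := coll_fragment_mass q1 q2.
  have [i2 e2] := @coll_fragment_mass (q.2, q.1) q2 q1.
  rewrite /= in e2.
  rewrite [leRHS](_ : _ = \int[mu]_z (th q.1 * (z * coll_fragment (z, q)) +
     th q.2 * (z * coll_fragment (z, (q.2, q.1))))); last first.
    by rewrite (I_D (igZ _ i1) (igZ _ i2)) !I_Z// e1 e2; congr (_ + _); rewrite mulrC.
  have bb0 p : 0 <= coll_fragment p by rewrite /coll_fragment; case: ifP => // _; exact: ext3_ge0.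
  have iD := igD (igZ (th q.1) i1) (igZ (th q.2) i2).
  have pt z : 0 <= z * th z * coll_daughter (z, q) <= th q.1 * (z * coll_fragment (z, q)) +
     th q.2 * (z * coll_fragment (z, (q.2, q.1))).
    have [z0|z0] := leP z 0.
      by rewrite /coll_fragment /coll_daughter /ext3/= ltNge z0/= !if_same !mulr0 addr0 lexx.
    apply/andP; split.
      apply: mulr_ge0; last exact: ext3_ge0.
      by apply: mulr_ge0 => //; exact: ltW.
    have one (c s t : R) : 0 < s -> 0 < t ->
        z * th z * coll_fragment (z, (s, t)) <= th s * (z * coll_fragment (z, (s, t))).
      move=> s0 t0; rewrite /coll_fragment/=; case: ifP => zs; last by rewrite !mulr0.
      rewrite mulrAC [leRHS]mulrC ler_wpM2l//; last by apply: thm => //; exact: ltW.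
      by apply: mulr_ge0; [exact: ltW|exact: ext3_ge0].
    rewrite coll_daughter_split// mulrDr; apply: lerD; last exact: one.
    by case: (q) q1 q2 => s t /= *; exact: one.
  apply: I_le => //.
    apply: (ig_le _ iD).
      apply: measurable_funM; first exact: measurable_funM.
      by apply: mf_section; exact: mf_ext3.
    by move=> z; have /andP[p1 p2] := pt z; rewrite ger0_norm.
  by move=> z; have /andP[] := pt z.
Qed.

Lemma coll_kernel_split q : coll_kernel q <=
  `|q.1| `^ alpha * `|q.2| `^ beta + `|q.1| `^ beta * `|q.2| `^ alpha.
Proof.
rewrite /coll_kernel; case: ifP => [/andP[q1 q2]|_].
  by rewrite !gtr0_norm.
by rewrite addr_ge0// mulr_ge0// powR_ge0.
Qed.

End Coefficients.

(** * Functions on the half-line *)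

Section HalfLine.
Context {R : realType}.
Local Notation mu := (@lebesgue_measure R).
Local Notation mR := (measurableTypeR R).
Implicit Types (h u phi : R -> R).

(** Integrals over the half-line become integrals over the line. *)
Definition halfext h (x : R) : R := if 0 < x then h x else 0.

Lemma patch_halfext h : h \_ halfline = halfext h.
Proof.
by apply/funext => x; rewrite /patch /halfext mem_setE in_itv/= andbT.
Qed.

Lemma halfline_ig h : mu.-integrable halfline (EFin \o h) <-> ig mu (halfext h).
Proof.
rewrite (integrable_mkcond _ mhalf).
by rewrite (_ : (EFin \o h) \_ halfline = EFin \o halfext h)// -patch_halfext restrict_EFin.
Qed.

Lemma halfline_int h : \int[mu]_(x in halfline) h x = \int[mu]_x halfext h x.
Proof. by rewrite Rintegral_mkcond patch_halfext. Qed.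

Lemma halfline_mf h : measurable_fun (halfline : set mR) h <-> mf1 (halfext h).
Proof. by rewrite -patch_halfext; exact: measurable_restrictT mhalf. Qed.

Lemma X_ig m h : X m h <-> ig mu (halfext (fun x => x `^ m * h x)).
Proof. exact: halfline_ig. Qed.

Lemma X0_ig h : X 0 h <-> ig mu (halfext h).
Proof.
rewrite X_ig; have -> // : halfext (fun x => x `^ 0 * h x) = halfext h.
by apply/funext => x; rewrite /halfext; case: ifP => // x0; rewrite powRr0 mul1r.
Qed.

Definition posext h : R -> R := halfext (fun x => Num.max (h x) 0).

Lemma mf_posext h : mf1 (halfext h) -> mf1 (posext h).
Proof.
move=> mh; have : mf1 (fun x : R => Num.max (halfext h x) 0) by apply: measurable_maxr.
congr measurable_fun; apply/funext => x; rewrite /posext /halfext; case: ifP => // _.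
by rewrite maxxx.
Qed.

Lemma posext_ge0 h x : 0 <= posext h x.
Proof. by rewrite /posext /halfext; case: ifP => // _; rewrite le_max lexx orbT. Qed.

Lemma posext_le0 h x : x <= 0 -> posext h x = 0.
Proof. by rewrite /posext /halfext ltNge => ->. Qed.

Lemma posext_ae h : {ae mu, forall x, 0 < x -> 0 <= h x} ->
  {ae mu, forall x, halfext h x = posext h x}.
Proof.
apply: ae_imp => x hx; rewrite /posext /halfext; case: ifP => // x0.
by rewrite max_l// hx.
Qed.

Lemma posext_mom m h : X m h -> mf1 (halfext h) -> {ae mu, forall x, 0 < x -> 0 <= h x} ->
  [/\ ig mu (fun x => `|x| `^ m * posext h x),
     \int[mu]_x (`|x| `^ m * posext h x) = moment m h &
     \int[mu]_x (`|x| `^ m * posext h x) = Xnorm m h].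
Proof.
move=> /X_ig iX mh h0.
have mp : mf1 (fun x => `|x| `^ m * posext h x).
  by apply: measurable_funM; [exact: mf_powabs|exact: mf_posext].
have e : {ae mu, forall x, halfext (fun x => x `^ m * h x) x = `|x| `^ m * posext h x}.
  apply: ae_imp (posext_ae h0) => x <-; rewrite /halfext; case: ifP => [x0|_]; last by rewrite mulr0.
  by rewrite gtr0_norm.
split.
- exact: (ig_ae_eq mp iX e).
- by rewrite /moment halfline_int; apply/esym/I_ae_eq => //; exact: (ig_mf iX).
- rewrite /Xnorm halfline_int; apply/esym/I_ae_eq => //.
    have : mf1 (fun x => `|x| `^ m * `|halfext h x|).
      apply: measurable_funM; first exact: mf_powabs.
      exact: measurableT_comp.
    congr measurable_fun; apply/funext => x; rewrite /halfext; case: ifP => [x0|_].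
      by rewrite gtr0_norm.
    by rewrite normr0 mulr0.
  apply: ae_imp (ae_and h0 (posext_ae h0)) => x [hx <-]; rewrite /halfext.
  case: ifP => [x0|_]; last by rewrite mulr0.
  by rewrite (gtr0_norm x0) (ger0_norm (hx x0)).
Qed.

Lemma posext_state beta h : X 0 h -> X (1 + beta) h ->
  {ae mu, forall x, 0 < x -> 0 <= h x} -> state beta (posext h).
Proof.
move=> hX hXb h0; have /X0_ig i0 := hX.
have mh := ig_mf i0.
have [i1 _ _] := posext_mom hX mh h0; have [i2 _ _] := posext_mom hXb mh h0.
split; [exact: mf_posext|exact: posext_ge0|exact: posext_le0|].
have := igD i1 i2; congr (_.-integrable _ _); apply/funext => x /=.
by rewrite powRr0 mul1r /Wt mulrDl mul1r.
Qed.

End HalfLine.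

Section Inner.
Context {R : realType}.
Local Notation mu := (@lebesgue_measure R).
Variables (alpha beta beta0 : R) (b : R -> R -> R -> R).
Hypothesis hb : daughter_distribution b.
Hypothesis hb_max : forall z x y, Num.max x y <= z -> coll_daughter b (z, (x, y)) = 0.
Hypothesis M : breakage_model beta beta0 (coll_kernel alpha beta) (coll_daughter b).

Local Notation coll_kernel := (coll_kernel alpha beta).
Local Notation coll_daughter := (coll_daughter b).
Local Notation zet := (zet coll_daughter).
Local Notation gainw := (gainw coll_daughter).
Local Notation Q := (Q coll_kernel coll_daughter).
Local Notation K := (collision_kernel alpha beta).
Implicit Types (u v phi psi : R -> R).

Lemma zeta_zet phi x y : 0 < x -> 0 < y ->
  (\int[mu]_(z in `]0%R, (x + y)%R[) (halfext phi z * b z x y)%:E =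
    \int[mu]_z (halfext phi z * coll_daughter (z, (x, y)))%:E)%E ->
  zeta b phi x y = zet (halfext phi) (x, y).
Proof.
move=> x0 y0 e; rewrite /zeta /zet /gainw /= {2 3}/halfext x0 y0; congr (_ - _ - _).
rewrite /Rintegral -e; congr fine; apply: eq_integral => z.
by rewrite mem_setE in_itv/= /halfext => /andP[-> _].
Qed.

Lemma zet_ae phi psi : mf1 (halfext phi) -> mf1 psi ->
  {ae mu, forall x, 0 < x -> phi x = psi x} ->
  forall q, gainw (halfext phi) q = gainw psi q.
Proof.
move=> m1 m2 e q; have mb : mf1 (fun z => coll_daughter (z, q)) := ig_mf (bet_num_ig M q).
apply: I_ae_eq; try exact: measurable_funM.
apply: ae_imp e => x hx; rewrite /halfext; case: ifPn => [x0|]; first by rewrite hx.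
by rewrite -leNgt => x0; rewrite (bet_pos M)// !mulr0.
Qed.

(** The iterated integral of the weak formulation depends on the classes of the test
    and of the state only; no integrability is required for this. *)
Lemma inner_eq u v phi psi : mf1 (halfext phi) -> mf1 psi -> mf1 (halfext u) -> mf1 v ->
  (forall x, x <= 0 -> v x = 0) ->
  {ae mu, forall x, 0 < x -> phi x = psi x} ->
  {ae mu, forall x, halfext u x = v x} ->
  (forall x y, 0 < x -> 0 < y -> zeta b phi x y = zet (halfext phi) (x, y)) ->
  \int[mu]_(x in halfline) \int[mu]_(y in halfline)
     (zeta b phi x y * K x y * u x * u y) =
  \int[mu]_x \int[mu]_y (zet psi (x, y) * coll_kernel (x, y) * v x * v y).
Proof.
move=> mphi mpsi mpu mv v0 ephi eu hz.
pose F q := zet (halfext phi) q * coll_kernel q * halfext u q.1 * halfext u q.2.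
pose G q := zet psi q * coll_kernel q * v q.1 * v q.2.
have mF : mf2 F by exact: (mf_coll M (mf_zet M mphi) mpu mpu).
have mG : mf2 G by exact: (mf_coll M (mf_zet M mpsi) mv mv).
transitivity (\int[mu]_x \int[mu]_y F (x, y)).
  rewrite halfline_int; apply: I_eq => x; rewrite {1}/halfext /F/=; case: ifPn => x0; last first.
    rewrite -[LHS](I_0 mu); apply: I_eq => y.
    by rewrite /coll_kernel/= (negbTE x0)/= mulr0 !mul0r.
  rewrite halfline_int; apply: I_eq => y; rewrite {1}/halfext; case: ifPn => y0; last first.
    by rewrite /coll_kernel/= (negbTE y0) andbF mulr0 !mul0r.
  by rewrite hz// /coll_kernel/= x0 y0 /halfext x0 y0.
change (\int[mu]_x \int[mu]_y F (x, y) = \int[mu]_x \int[mu]_y G (x, y)).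
apply: I_ae_eq; [exact: (mf_intR mF)|exact: (mf_intR mG)|].
apply: ae_imp (ae_and ephi eu) => x [px ux].
apply: I_ae_eq; [exact: mf_sec1|exact: mf_sec1|].
apply: ae_imp (ae_and ephi eu) => y [py uy].
rewrite /F /G /= ux uy.
have [/andP[x0 y0]|/(k_supp M) ->] := boolP ((0 < (x, y).1) && (0 < (x, y).2)); last first.
  by rewrite !mulr0 !mul0r.
by rewrite /zet (zet_ae mphi mpsi ephi) /= /halfext x0 y0 px// py.
Qed.

Lemma inner_Q psi rho v : mf1 psi -> (forall x, `|psi x| <= rho) -> state beta v ->
  \int[mu]_x \int[mu]_y (zet psi (x, y) * coll_kernel (x, y) * v x * v y) = 2 * Q psi v.
Proof.
move=> mpsi hrho sv; have i := Q_ig M mpsi hrho (state_sstate sv).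
by rewrite /Q mulrA divff// mul1r (I_prod12 i).
Qed.

End Inner.

(** * Initial data and time horizon *)

Section Initial.
Context {R : realType}.
Local Notation mu := (@lebesgue_measure R).
Variables (alpha beta beta0 : R) (fin : R -> R).
Hypotheses (halpha : 0 <= alpha) (hab : alpha <= beta) (hbeta : beta <= 1).
Hypothesis hbeta0 : 2 < beta0.
Local Notation state := (state beta).

Let hbeta' : 0 <= beta.
Proof. exact: le_trans hab. Qed.

Lemma state_halfext u : state u -> halfext u = u.
Proof.
move=> [_ _ un _]; apply/funext => x; rewrite /halfext; case: ifPn => //.
by rewrite -leNgt => /un.
Qed.

Lemma state_pow m u : 0 <= m <= 1 + beta -> state u ->
  ig mu (fun x => `|x| `^ m * u x).
Proof.
move=> hm su; apply: (sstate_ig (state_sstate su) (c := 1)); first exact: mf_powabs.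
by move=> x; rewrite mul1r ger0_norm ?powR_ge0//; exact: powR_le_mid.
Qed.

Lemma state_X m u : 0 <= m <= 1 + beta -> state u ->
  [/\ Xplus m u, moment m u = \int[mu]_x (`|x| `^ m * u x) &
      Xnorm m u = \int[mu]_x (`|x| `^ m * u x)].
Proof.
move=> hm su; have [u1 u0 un _] := su.
have ip := state_pow hm su.
have e x : halfext (fun x => x `^ m * u x) x = `|x| `^ m * u x.
  rewrite /halfext; case: ifPn => [x0|]; first by rewrite gtr0_norm.
  by rewrite -leNgt => /un ->; rewrite mulr0.
split.
- split; last by apply: aeW => x _; exact: u0.
  apply/X_ig; move: ip; congr (_.-integrable _ _).
  by apply/funext => x /=; rewrite e.
- by rewrite /moment halfline_int; apply: I_eq.
- rewrite /Xnorm halfline_int; apply: I_eq => x; rewrite -e /halfext.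
  by case: ifP => // _; rewrite ger0_norm.
Qed.

Lemma state_mom1 u : state u -> \int[mu]_x (`|x| `^ 1 * u x) = \int[mu]_x (x * u x).
Proof.
move=> [_ _ un _]; apply: I_eq => x; rewrite powRr1//.
by have [x0|x0] := leP x 0; [rewrite un// !mulr0|rewrite gtr0_norm].
Qed.

Lemma state_mom0 u : \int[mu]_x (`|x| `^ 0 * u x) = \int[mu]_x u x.
Proof. by apply: I_eq => x; rewrite powRr0 mul1r. Qed.

Hypothesis hfin0 : X 0 fin.
Hypothesis hfin1 : Xplus (1 + beta) fin.
Hypothesis hfin_mass : 0 < moment 1 fin.

Local Notation fh := (posext fin).

Let fpos : {ae mu, forall x, 0 < x -> 0 <= fin x}.
Proof. by have [_] := hfin1. Qed.

Let mfin : mf1 (halfext fin).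
Proof. by have /X0_ig/ig_mf := hfin0. Qed.

Lemma init_state : state fh.
Proof. by have [hX _] := hfin1; exact: posext_state. Qed.

Lemma init_ae : {ae mu, forall x, halfext fin x = fh x}.
Proof. exact: posext_ae. Qed.

Lemma init_moment m : 0 <= m <= 1 + beta ->
  moment m fin = \int[mu]_x (`|x| `^ m * fh x).
Proof.
move=> hm; have ip := state_pow hm init_state.
rewrite /moment halfline_int; apply: I_ae_eq.
- have : mf1 (fun x => `|x| `^ m * halfext fin x).
    by apply: measurable_funM => //; exact: mf_powabs.
  congr measurable_fun; apply/funext => x; rewrite /halfext; case: ifP => [x0|_].
    by rewrite gtr0_norm.
  by rewrite mulr0.
- exact: (ig_mf ip).
apply: ae_imp init_ae => x <-; rewrite /halfext; case: ifP => [x0|_].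
  by rewrite gtr0_norm.
by rewrite mulr0.
Qed.

Lemma init_M1 : moment 1 fin = \int[mu]_x (x * fh x).
Proof.
rewrite init_moment ?ler01 ?lerDl//=; exact: state_mom1 init_state.
Qed.

Lemma init_M0 : moment 0 fin = \int[mu]_x fh x.
Proof. by rewrite init_moment ?lexx ?addr_ge0//= state_mom0. Qed.

Lemma init_M0_gt0 : 0 < moment 0 fin.
Proof.
have [f1 f0 fn fi] := init_state.
rewrite ltNge; apply/negP; rewrite init_M0 => h0.
have i1 := sstate_1 (state_sstate init_state).
have z := I_eq0_ae i1 f0 h0.
move: hfin_mass; rewrite init_M1 (_ : \int[mu]_x _ = 0) ?ltxx//.
rewrite -[RHS](I_0 mu); apply: I_ae_eq => //.
  by apply: measurable_funM => //; exact: measurable_id.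
by apply: ae_imp z => x ->; rewrite mulr0.
Qed.

Local Notation lambda := (alpha + beta).
Local Notation Ts := (Tstar lambda beta0 fin).

(** The horizon is the explosion time of the comparison equation that starts from
    the initial number. *)
Lemma majorant_on (T : R) : 0 <= T -> (T%:E < Ts)%E ->
  exists m, majorant beta beta0 alpha fh T m.
Proof.
move=> T0' hT.
have l02 : 0 <= lambda <= 2 by rewrite addr_ge0//= -[2]/(1 + 1) lerD// (le_trans hab).
have M1p : 0 < moment 1 fin `^ lambda by exact: powR_gt0.
have c0 : 0 < (beta0 - 2) * moment 1 fin `^ lambda by rewrite mulr_gt0// subr_gt0.
have hl : lambda < 1 ->
    (1 - lambda) * ((beta0 - 2) * moment 1 fin `^ lambda) * T < moment 0 fin `^ (lambda - 1).
  move=> l1; move: hT; rewrite /Tstar leNgt l1/= lte_fin /T0 ltr_pdivlMr.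
    by rewrite mulrC !mulrA.
  by rewrite -mulrA mulr_gt0// subr_gt0.
have [m [m1 m2 m3]] := majorant_exists l02 c0 init_M0_gt0 T0' hl.
exists m; split; [by rewrite -init_M0|exact: m2|].
by rewrite -init_M1; exact: m3.
Qed.

(** Times exhausting the interval of existence from within, each with its majorant. *)
Lemma horizon : exists Tn : nat -> R, exists m : nat -> R -> R,
  [/\ forall i, 0 <= Tn i, forall i j, (i <= j)%N -> Tn i <= Tn j,
      forall i, ((Tn i)%:E < Ts)%E,
      forall t, time_co Ts t -> exists i, t < Tn i &
      forall i, majorant beta beta0 alpha fh (Tn i) (m i)].
Proof.
suff [Tn [h1 h2 h3 h4]] : exists Tn : nat -> R,
    [/\ forall i, 0 <= Tn i, forall i j, (i <= j)%N -> Tn i <= Tn j,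
      forall i, ((Tn i)%:E < Ts)%E &
      forall t, time_co Ts t -> exists i, t < Tn i].
  have [m hm] := choice (fun i => majorant_on (h1 i) (h3 i)).
  by exists Tn, m.
have [l1|l1] := leP 1 lambda.
  exists (fun i => i%:R); split=> //.
  - by move=> i j ij; rewrite ler_nat.
  - by move=> i; rewrite /Tstar l1 ltry.
  - by move=> t _; exists (Num.truncn t).+1; exact: truncnS_gt.
set tau := T0 lambda beta0 fin.
have tau0 : 0 < tau.
  rewrite /tau /T0 divr_gt0 ?powR_gt0 ?init_M0_gt0//.
  by rewrite !mulr_gt0 ?subr_gt0// powR_gt0.
have eT : Ts = tau%:E by rewrite /Tstar leNgt l1.
have inv0 i : 0 < (i.+1%:R : R)^-1 by rewrite invr_gt0.
(* the first time is zero, and every time before [tau] is exceeded *)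
exists (fun i => tau * (1 - i.+1%:R^-1)); split.
- by move=> i; rewrite mulr_ge0 ?(ltW tau0)// subr_ge0 invf_le1// ler1n.
- move=> i j ij; rewrite ler_pM2l// lerD2l lerN2 lef_pV2 ?posrE//.
  by rewrite ler_nat.
- by move=> i; rewrite eT lte_fin gtr_pMr// gtrBl.
move=> t [t0]; rewrite eT lte_fin => tt.
have d0 : 0 < 1 - t / tau by rewrite subr_gt0 ltr_pdivrMr// mul1r.
exists (Num.truncn (1 - t / tau)^-1).
rewrite mulrC -ltr_pdivrMr// ltrBrDl -ltrBrDr.
by rewrite -[ltRHS]invrK ltf_pV2 ?posrE ?invr_gt0//; exact: truncnS_gt.
Qed.

End Initial.

(** * From curves to weak solutions *)

Section FromCurve.
Context {R : realType}.
Local Notation mu := (@lebesgue_measure R).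
Local Notation mR := (measurableTypeR R).
Variables (alpha beta beta0 : R) (b : R -> R -> R -> R) (fin : R -> R).
Hypothesis hbeta' : 0 <= beta.
Hypothesis M : breakage_model beta beta0 (coll_kernel alpha beta) (coll_daughter b).
Hypothesis hz : forall (phi : R -> R) x y, 0 < x -> 0 < y ->
  zeta b phi x y = zet (coll_daughter b) (halfext phi) (x, y).
Hypothesis hfin0 : X 0 fin.
Hypothesis hfin1 : Xplus (1 + beta) fin.

Let b2 := beta0_gt2 M.

Local Notation coll_kernel := (coll_kernel alpha beta).
Local Notation coll_daughter := (coll_daughter b).
Local Notation Q := (Q coll_kernel coll_daughter).
Local Notation K := (collision_kernel alpha beta).
Local Notation kap := (kap beta).
Local Notation Wt := (Wt beta).
Local Notation state := (state beta).
Local Notation fh := (posext fin).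
Local Notation bounded_states := (bounded_states beta).
Local Notation approx_sol := (approx_sol coll_kernel coll_daughter).
Implicit Types (u v phi psi : R -> R).

Variables (T : \bar R) (f : R -> R -> R) (Tn A C : nat -> R).
Hypothesis hTn : forall t, time_co T t -> exists i, t < Tn i.
Hypothesis mf2f : mf2 (fun p : R * R => f p.1 p.2).
Hypothesis bf : forall i, bounded_states (Tn i) (A i) f.
Hypothesis C0 : forall i, 0 <= C i.
Hypothesis af : forall i, approx_sol (Tn i) 0 (C i) f.
Hypothesis f_mass : forall i t, 0 <= t <= Tn i -> \int[mu]_x (x * f t x) = moment 1 fin.
Hypothesis f_init : {ae mu, forall x, f 0 x = fh x}.

Let r01 : (0 : R) <= 0 <= 1 + beta.
Proof. by rewrite lexx addr_ge0. Qed.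
Let r11 : (0 : R) <= 1 <= 1 + beta.
Proof. by rewrite ler01 lerDl. Qed.
Let rb1 : (0 : R) <= 1 + beta <= 1 + beta.
Proof. by rewrite lexx addr_ge0. Qed.

Lemma curve_state t : time_co T t -> state (f t).
Proof.
move=> tT; have [i ti] := hTn tT; have [t0 _] := tT.
by have [] := bf (introT andP (conj t0 (ltW ti))).
Qed.

(** The curve is Lipschitz for the weighted distance, hence strongly continuous. *)
Lemma curve_continuous l : X0_dual l -> {within time_co T, continuous (fun t => l (f t))}.
Proof.
move=> [ladd [c hc]]; apply/subspace_continuousP => t tT.
have [i ti] := hTn tT; have [t0 _] := tT.
set L := 16 * (beta0 + 2) * (A i * A i).
have L0 : 0 <= L.
  have [s0 sA] := bf (introT andP (conj t0 (ltW ti))).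
  have A0 := state_I_ge0 s0 sA.
  by rewrite /L !mulr_ge0// addr_ge0// ltW// (lt_trans _ b2).
have lip r s : 0 <= r -> r <= s -> s <= Tn i -> Xnorm 0 (fun x => (-1) * f r x + f s x) <= L * (s - r).
  move=> r0 rs sT.
  have [fr _] := bf (introT andP (conj r0 (le_trans rs sT))).
  have [fs _] := bf (introT andP (conj (le_trans r0 rs) sT)).
  have sE := sstateB (state_sstate fs) (state_sstate fr).
  have [_ _ frn _] := fr; have [_ _ fsn _] := fs.
  rewrite mulrC; apply: le_trans (approx_lip M (C0 i) (af (i := i)) (@bf i) r0 rs sT).
  rewrite /Xnorm halfline_int.
  rewrite (_ : \int[mu]_x _ = \int[mu]_x `|f s x - f r x|); last first.
    apply: I_eq => x; rewrite /halfext; case: ifPn => [x0|].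
      by rewrite powRr0 mul1r mulN1r addrC.
    by rewrite -leNgt => x0; rewrite frn// fsn// subrr normr0.
  apply: I_le; [exact: sstate_1 (sstate_abs sE)|exact: (sstate_wt M (sstate_abs sE))|].
  by move=> x; rewrite ler_peMl// wt_ge1.
have lB r s : 0 <= r -> r <= s -> s <= Tn i -> `|l (f s) - l (f r)| <= `|c| * (L * (s - r)).
  move=> r0 rs sT.
  have [fr _] := bf (introT andP (conj r0 (le_trans rs sT))).
  have [fs _] := bf (introT andP (conj (le_trans r0 rs) sT)).
  have [[Xr _] _ _] := state_X r01 fr; have [[Xs _] _ _] := state_X r01 fs.
  have -> : l (f s) - l (f r) = l (fun x => (-1) * f r x + f s x).
    by rewrite ladd// mulN1r addrC.
  have XD : X 0 (fun x => (-1) * f r x + f s x).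
    apply/X0_ig; move: Xr Xs => /X0_ig Xr /X0_ig Xs.
    have := igD (igZ (-1) Xr) Xs; congr (_.-integrable _ _).
    by apply/funext => x /=; rewrite /halfext; case: ifP => // _; rewrite mulr0 addr0.
  apply: le_trans (hc _ XD) _.
  have n0 : 0 <= Xnorm 0 (fun x => (-1) * f r x + f s x).
    rewrite /Xnorm halfline_int; apply: I_ge0 => x; rewrite /halfext; case: ifP => // _.
    by rewrite mulr_ge0// powR_ge0.
  apply: (@le_trans _ _ (`|c| * Xnorm 0 (fun x => (-1) * f r x + f s x))).
    by rewrite ler_wpM2r// ler_norm.
  by rewrite ler_wpM2l// lip.
apply/cvgrPdist_le => e e0; rewrite near_withinE.
have D0 : 0 < `|c| * L + 1 by rewrite ltr_wpDl// mulr_ge0.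
apply/nbhs_ballP; exists (Num.min (Tn i - t) (e / (`|c| * L + 1))).
  by rewrite /= lt_min subr_gt0 ti divr_gt0.
move=> s; rewrite /ball/= lt_min => /andP[h1 h2] [s0 _].
have sT : s <= Tn i.
  by have := ltW h1; rewrite distrC => /(le_trans (ler_norm _)); rewrite lerD2r.
have h3 : `|c| * (L * `|t - s|) <= e.
  have := ltW h2; rewrite ler_pdivlMr// => h; apply: le_trans h.
  by rewrite mulrA mulrC ler_wpM2l// lerDl.
apply: le_trans h3.
have [st|ts] := leP s t.
  by rewrite [`|t - s|]ger0_norm ?subr_ge0//; apply: lB => //; exact: ltW.
by rewrite distrC [`|t - s|]distrC [`|s - t|]gtr0_norm ?subr_gt0//; apply: lB => //; exact: ltW.
Qed.

(** The double collision integral is bounded by the square of a moment, uniformly in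
    time. *)
Lemma curve_triple t : time_oo T t ->
  ((mu \x mu) \x mu)%E.-integrable (`]0, t[ `*` halfline `*` halfline)
    (fun q : R * R * R => (K q.1.2 q.2 * f q.1.1 q.1.2 * f q.1.1 q.2)%:E).
Proof.
move=> [t0 tT]; have [i ti] := hTn (conj (ltW t0) tT).
have st s : seg 0 t s -> state (f s) /\ \int[mu]_x (Wt x * f s x) <= A i.
  by move=> /andP[s0 s1]; apply: bf; rewrite s0 (le_trans (ltW s1))// ltW.
pose F (q : mR * mR * mR) : R := if seg 0 t q.1.1 then
   coll_kernel (q.1.2, q.2) * f q.1.1 q.1.2 * f q.1.1 q.2 else 0.
have mF : measurable_fun setT F.
  have s1 := @measurable_fst _ _ (mR * mR)%type mR.
  have s2 := @measurable_snd _ _ (mR * mR)%type mR.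
  have s11 := measurableT_comp (@measurable_fst _ _ mR mR) s1.
  have s12 := measurableT_comp (@measurable_snd _ _ mR mR) s1.
  apply: measurable_fun_ifT => //; first exact: (measurableT_comp (mf_seg 0 t) s11).
  apply: measurable_funM; first apply: measurable_funM.
  - have h : measurable_fun setT (fun q : mR * mR * mR => (q.1.2, q.2)).
      by apply/measurable_fun_pairP; split.
    exact: (measurableT_comp (k_mf M) h).
  - have h : measurable_fun setT (fun q : mR * mR * mR => (q.1.1, q.1.2)).
      by apply/measurable_fun_pairP; split.
    exact: (measurableT_comp mf2f h).
  - have h : measurable_fun setT (fun q : mR * mR * mR => (q.1.1, q.2)).
      by apply/measurable_fun_pairP; split.
    exact: (measurableT_comp mf2f h).
pose H (p : mR * mR) : R := if seg 0 t p.1 then 2 * (4 * A i) * (kap p.2 * f p.1 p.2) else 0.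
have mH : measurable_fun setT H.
  apply: measurable_fun_ifT => //; first exact: (mf_fst (mf_seg 0 t)).
  apply: measurable_funM => //; apply: measurable_funM => //.
  exact: (mf_snd (mf_kap beta)).
have k0 x : 0 <= kap x by rewrite (le_trans ler01 (kap_ge1 _ _)).
have sec s x : seg 0 t s -> ig mu (fun y => coll_kernel (x, y) * f s x * f s y) /\
    \int[mu]_y `|coll_kernel (x, y) * f s x * f s y| <= 2 * (4 * A i) * (kap x * f s x).
  move=> /st [fs fA]; have [f1 f0 fn _] := fs.
  have ik := sstate_kap M (state_sstate fs).
  have m1 : mf1 (fun y => coll_kernel (x, y) * f s x * f s y).
    apply: measurable_funM => //; apply: measurable_funM => //.
    exact: (mf_sec1 x (k_mf M)).
  have le1 y : `|coll_kernel (x, y) * f s x * f s y| <= 2 * (kap x * f s x) * (kap y * f s y).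
    rewrite ger0_norm; last by rewrite !mulr_ge0// (k_ge0 M).
    rewrite [leRHS](_ : _ = 2 * kap x * kap y * f s x * f s y); last by ring.
    by rewrite ler_wpM2r// ler_wpM2r// (k_le M (x, y)).
  have i1 : ig mu (fun y => coll_kernel (x, y) * f s x * f s y) by apply: (ig_le m1 (igZ _ ik) le1).
  split=> //.
  apply: (@le_trans _ _ (\int[mu]_y (2 * (kap x * f s x) * (kap y * f s y)))).
    by apply: I_le => //; [exact: ig_abs|exact: igZ].
  rewrite I_Z// [leRHS](_ : _ = 2 * (kap x * f s x) * (4 * A i)); last by ring.
  by rewrite ler_wpM2l ?mulr_ge0//; exact: (state_kap_le M fs fA).
have i2 : ig (mu \x mu)%E H.
  have [iseg _] := seg_length (ltW t0).
  apply: (@ig_prod12 _ _ _ _ R mu mu H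
    (fun s => 2 * (4 * A i) * (4 * A i) * (if seg 0 t s then 1 else 0))) => //.
  - move=> s; rewrite /H/=; case hs: (seg 0 t s); last exact: ig0.
    have [fs _] := st s hs.
    by apply: igZ; exact: (sstate_kap M (state_sstate fs)).
  - exact: igZ.
  - move=> s; rewrite /H/=; case hs: (seg 0 t s); last first.
      rewrite mulr0 (_ : \int[mu]_x _ = 0)//.
      by rewrite -[RHS](I_0 mu); apply: I_eq => x; rewrite normr0.
    have [fs fA] := st s hs.
    have [_ f0 _ _] := fs; have A0 := state_I_ge0 fs fA.
    rewrite (_ : \int[mu]_x _ = \int[mu]_x (2 * (4 * A i) * (kap x * f s x))); last first.
      by apply: I_eq => x; rewrite ger0_norm// !mulr_ge0.
    rewrite I_Z; last exact: (sstate_kap M (state_sstate fs)).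
    by rewrite mulr1 ler_wpM2l ?mulr_ge0//; exact: (state_kap_le M fs fA).
have iF : ig ((mu \x mu) \x mu)%E F.
  apply: (@ig_prod12 _ _ _ _ R (prod_sfin mu mu) mu F H) => //.
  - move=> [s x]; rewrite /F/=; case hs: (seg 0 t s); last exact: ig0.
    by have [] := sec s x hs.
  - move=> [s x]; rewrite /F /H/=; case hs: (seg 0 t s).
      by have [] := sec s x hs.
    rewrite (_ : \int[mu]_y _ = 0)//.
    by rewrite -[RHS](I_0 mu); apply: I_eq => y; rewrite normr0.
have mD : measurable (`]0, t[ `*` halfline `*` halfline : set (mR * mR * mR)).
  apply: measurableX; last exact: mhalf.
  by apply: measurableX; [exact: measurable_itv|exact: mhalf].
have := integrableS measurableT mD (@subsetT _ _) iF.
apply: eq_integrable => // q /set_mem [[h1 h2] h3].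
move: h1 h2 h3; rewrite !in_halfline /= in_itv/=.
case: q => -[s x] y /= /andP[s0 s1] x0 y0.
by rewrite /F/= /seg (ltW s0) s1 /coll_kernel/= x0 y0.
Qed.

(** Truncation at the essential bound gives a test that is bounded everywhere. *)
Lemma Linfty_trunc phi : Linfty phi -> exists psi : R -> R, exists rho : R,
  [/\ mf1 psi, forall x, `|psi x| <= rho & {ae mu, forall x, 0 < x -> phi x = psi x}].
Proof.
move=> [/halfline_mf mphi [c hc]].
exists (fun x => Num.max (- `|c|) (Num.min `|c| (halfext phi x))), `|c|; split.
- by apply: measurable_maxr => //; exact: measurable_minr.
- move=> x; rewrite ler_norml le_max lexx/= ge_max ge_min lexx/=.
  by rewrite andbT (le_trans _ (normr_ge0 c))// oppr_le0.
apply: ae_imp hc => x hx x0; rewrite /halfext x0; have := hx x0.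
move=> /le_trans/(_ (ler_norm c)); rewrite ler_norml => /andP[h1 h2].
by rewrite (min_idPr h2) (max_idPr h1).
Qed.

Lemma init_pairing phi psi rho u v : mf1 (halfext phi) -> mf1 psi -> (forall x, `|psi x| <= rho) ->
  {ae mu, forall x, 0 < x -> phi x = psi x} ->
  mf1 (halfext u) -> {ae mu, forall x, halfext u x = v x} -> mf1 v ->
  \int[mu]_(x in halfline) (phi x * (u x - fin x)) = \int[mu]_x (psi x * (v x - fh x)).
Proof.
move=> mphi mpsi hrho e mpu uv mv.
have [_ _ fhn _] := init_state hfin0 hfin1; have [mfh _ _ _] := init_state hfin0 hfin1.
have mfin : mf1 (halfext fin) by have /X0_ig/ig_mf := hfin0.
rewrite halfline_int; apply: I_ae_eq.
- have : mf1 (fun x => halfext phi x * (halfext u x - halfext fin x)).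
    by apply: measurable_funM => //; exact: measurable_funB.
  congr measurable_fun; apply/funext => x; rewrite /halfext; case: ifP => // _.
  by rewrite mul0r.
- by apply: measurable_funM => //; exact: measurable_funB.
apply: ae_imp (ae_and e (ae_and uv (init_ae hfin1))) => x [px [ux fx]].
rewrite -ux -fx /halfext; case: ifP => [x0|_]; last by rewrite subrr mulr0.
by rewrite px.
Qed.

(** All classes are replaced by their everywhere defined representatives, and the
    integral over the open interval by one over a half-open segment. *)
Lemma curve_identity t phi : time_oo T t -> Linfty phi ->
  \int[mu]_(x in halfline) (phi x * (f t x - fin x)) =
  2^-1 * \int[mu]_(s in `]0, t[) \int[mu]_(x in halfline)
           \int[mu]_(y in halfline) (zeta b phi x y * K x y * f s x * f s y).
Proof.
move=> [t0 tT] lphi; have [psi [rho [mpsi hrho e]]] := Linfty_trunc lphi.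
have mphi : mf1 (halfext phi) by have [/halfline_mf] := lphi.
have [i ti] := hTn (conj (ltW t0) tT).
have tI : 0 <= t <= Tn i by rewrite !ltW.
have [ft _] := bf tI; have [mft _ _ _] := ft.
have eft : halfext (f t) = f t := state_halfext ft.
have oI : 0 <= (0 : R) <= Tn i by rewrite lexx (le_trans (ltW t0))// ltW.
have [f0s _] := bf oI; have [mf0 _ _ _] := f0s.
have [mfh _ _ _] := init_state hfin0 hfin1.
rewrite (@init_pairing phi psi rho (f t) (f t))//; last 2 first.
  by rewrite eft.
  by rewrite eft; apply: aeW.
transitivity (\int[mu]_x (psi x * (f t x - f 0 x))).
  apply: I_ae_eq; try by apply: measurable_funM => //; exact: measurable_funB.
  by apply: ae_imp f_init => x ->.
rewrite (approx_integral M (C0 i) (af (i := i)) (@bf i) mf2f mpsi hrho tI).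
have mQ := mf_Q M mpsi mf2f.
rewrite [X in _ = _ * X]Rintegral_mkcond.
have e2 s : ((fun s => \int[mu]_(x in halfline) \int[mu]_(y in halfline)
    (zeta b phi x y * K x y * f s x * f s y)) \_ `]0, t[) s =
    if (0 < s) && (s < t) then 2 * Q psi (f s) else 0.
  rewrite /patch mem_setE in_itv/=; case: ifP => // /andP[s0 st].
  have [fs _] : state (f s) /\ \int[mu]_x (Wt x * f s x) <= A i.
    by apply: bf; rewrite (ltW s0) (le_trans (ltW st))// ltW.
  have [mfs _ fsn _] := fs; have efs := state_halfext fs.
  rewrite -(inner_Q M mpsi hrho fs).
  apply: (inner_eq M mphi mpsi _ mfs fsn e).
  - by rewrite efs.
  - by rewrite efs; exact: aeW.
  - by move=> x y; exact: hz.
have hb r : 0 <= r -> r < t -> `|Q psi (f r) - 0| <= rho * (16 * (beta0 + 2)) * A i * (4 * A i).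
  move=> r0 rt; rewrite subr0.
  have [fr rA] : state (f r) /\ \int[mu]_x (Wt x * f r x) <= A i.
    by apply: bf; rewrite r0 (le_trans (ltW rt))// ltW.
  exact: (Q_rho M mpsi hrho fr rA).
have [iQ _] := seg_bound mQ (ltW t0) hb.
rewrite [X in _ = _ * X](_ : _ = \int[mu]_s (2 * (if seg 0 t s then Q psi (f s) else 0))); last first.
  rewrite [LHS](_ : _ = \int[mu]_s (if (0 < s) && (s < t) then 2 * Q psi (f s) else 0)); last first.
    by apply: I_eq => s; rewrite e2.
  apply: I_ae_eq.
  - apply: measurable_fun_ifT => //; last exact: measurable_funM.
    by apply: measurable_and; [exact: measurable_fun_ltr|exact: measurable_fun_ltr].
  - by apply: measurable_funM => //; exact: mf_on_seg.
  exists [set 0]; split => //=; first by rewrite lebesgue_measure_set1.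
  move=> s /=; apply: contra_notP => /eqP s0; rewrite /seg lt_neqAle eq_sym s0/=.
  by case: ifP => // _; rewrite mulr0.
by rewrite (I_Z _ iQ) mulrA mulVf// mul1r.
Qed.

Lemma curve_solution : (forall i, ((Tn i)%:E < T)%E) ->
  [/\ weak_solution K b fin T f, mass_conserving fin T f &
     forall t, time_oo T t -> Linfty_time t%:E (1 + beta) (X (1 + beta)) f].
Proof.
move=> TnT.
have mass t : time_co T t -> moment 1 (f t) = moment 1 fin.
  move=> tT; have [i ti] := hTn tT; have [t0 _] := tT.
  have [_ -> _] := state_X r11 (curve_state tT).
  rewrite (state_mom1 (curve_state tT)) (f_mass (i := i))//.
  by rewrite t0 ltW.
split.
- split.
  + have := measurable_funS measurableT (@subsetT _ (time_co T `*` halfline)) mf2f.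
    by [].
  + split; last by move=> t tT; have [] := state_X r01 (curve_state tT).
    split; last exact: curve_continuous.
    by move=> t tT; have [[]] := state_X r01 (curve_state tT).
  + exists (moment 1 fin); apply: aeW => t [t0 tT].
    have tc : time_co T t by split=> //; exact: ltW.
    have [h1 h2 h3] := state_X r11 (curve_state tc); split; first exact: h1.
    by rewrite h3 -h2 mass.
  + exact: curve_triple.
  + exact: curve_identity.
- move=> t tT; split; last exact: mass.
  by have [[]] := state_X r11 (curve_state tT).
move=> t [t0 tT]; have [i ti] := hTn (conj (ltW t0) tT).
exists (A i); apply: aeW => s [s0]; rewrite lte_fin => st.
have [fs fA] : state (f s) /\ \int[mu]_x (Wt x * f s x) <= A i.
  by apply: bf; rewrite (ltW s0) (le_trans (ltW st))// ltW.
have [[h1 _] _ h3] := state_X rb1 fs; split=> //; rewrite h3.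
have [_ f0 _ _] := fs.
apply: le_trans fA; apply: I_le; [exact: (state_pow rb1 fs)|exact: (sstate_Wt (state_sstate fs))|].
by move=> x; rewrite ler_wpM2r// lerDr.
Qed.

End FromCurve.

(** * From weak solutions to curves *)

Section FromSolution.
Context {R : realType}.
Local Notation mu := (@lebesgue_measure R).
Local Notation mR := (measurableTypeR R).
Variables (alpha beta beta0 : R) (b : R -> R -> R -> R) (fin : R -> R).
Hypothesis hbeta' : 0 <= beta.
Hypothesis M : breakage_model beta beta0 (coll_kernel alpha beta) (coll_daughter b).
Hypothesis hz : forall (phi : R -> R) x y, 0 < x -> 0 < y ->
  zeta b phi x y = zet (coll_daughter b) (halfext phi) (x, y).
Hypothesis hfin0 : X 0 fin.
Hypothesis hfin1 : Xplus (1 + beta) fin.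

Let b2 := beta0_gt2 M.

Local Notation coll_kernel := (coll_kernel alpha beta).
Local Notation coll_daughter := (coll_daughter b).
Local Notation zet := (zet coll_daughter).
Local Notation Q := (Q coll_kernel coll_daughter).
Local Notation K := (collision_kernel alpha beta).
Local Notation Wt := (Wt beta).
Local Notation state := (state beta).
Local Notation fh := (posext fin).
Implicit Types (u v phi psi : R -> R).

Lemma test_dual phi rho : mf1 phi -> (forall x, `|phi x| <= rho) ->
  X0_dual (fun h => \int[mu]_(x in halfline) (phi x * h x)).
Proof.
move=> mphi hrho.
have ip h : X 0 h -> ig mu (fun x => phi x * halfext h x).
  move=> /X0_ig i; apply: (ig_le _ (igZ rho (ig_abs i))).
    by apply: measurable_funM => //; exact: (ig_mf i).
  by move=> x; rewrite normrM ler_wpM2r.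
have e h : \int[mu]_(x in halfline) (phi x * h x) = \int[mu]_x (phi x * halfext h x).
  by rewrite halfline_int; apply: I_eq => x; rewrite /halfext; case: ifP => // _; rewrite mulr0.
split.
  move=> a h1 h2 X1 X2; rewrite !e -(I_Z a (ip _ X1)) -(I_D (igZ a (ip _ X1)) (ip _ X2)).
  by apply: I_eq => x; rewrite /halfext; case: ifP => _; ring.
exists rho => h hX; have i := ip h hX; move/X0_ig: hX => hX.
rewrite e /Xnorm halfline_int.
rewrite [X in _ <= rho * X](_ : _ = \int[mu]_x `|halfext h x|); last first.
  apply: I_eq => x; rewrite /halfext; case: ifP => _; last by rewrite normr0.
  by rewrite powRr0 mul1r.
rewrite -(I_Z rho (ig_abs hX)); apply: I_abs_le => //; first exact: igZ (ig_abs hX).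
by move=> x; rewrite normrM ler_wpM2r.
Qed.

Variables (T : \bar R) (g : R -> R -> R) (T1 : R).
Hypothesis wg : weak_solution K b fin T g.
Hypothesis lg : forall t, time_oo T t -> Linfty_time t%:E (1 + beta) (X (1 + beta)) g.
Hypothesis T10 : 0 < T1.
Hypothesis T1T : (T1%:E < T)%E.

Let tc t : 0 <= t <= T1 -> time_co T t.
Proof.
move=> /andP[t0 tT]; split=> //.
by apply: le_lt_trans T1T; rewrite lee_fin.
Qed.

Let gX t : 0 <= t <= T1 -> X 0 (g t) /\ {ae mu, forall x, 0 < x -> 0 <= g t x}.
Proof. by move=> /tc tT; case: wg => _ [_ h] _ _ _; have [] := h t tT. Qed.

Let gmf t : 0 <= t <= T1 -> mf1 (halfext (g t)).
Proof. by move=> /gX[/X0_ig/ig_mf]. Qed.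

Definition nnpatch : R * R -> R :=
  (fun q : R * R => g q.1 q.2) \_ (`[0, T1] `*` halfline).

(** The datum itself is taken at time zero, where the class of [g] is identified later
    by continuity. *)
Definition nnrep (s x : R) : R := if s <= 0 then fh x else Num.max (nnpatch (s, x)) 0.

Lemma mf_nnrep : mf2 (fun p : R * R => nnrep p.1 p.2).
Proof.
have mD : measurable (`[0, T1] `*` halfline : set (mR * mR)).
  by apply: measurableX; [exact: measurable_itv|exact: mhalf].
have mg : mf2 nnpatch.
  apply/(measurable_restrictT _ mD).
  case: wg => m _ _ _ _; apply: (measurable_funS _ _ m).
    apply: measurableX; last exact: mhalf.
    rewrite (_ : time_co T = [set t | (t%:E < T)%E] `&` [set t | 0 <= t]); last first.
      by apply/seteqP; split=> t [].
    apply: measurableI; last first.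
      rewrite (_ : [set t | 0 <= t] = `[0, +oo[%classic); first exact: measurable_itv.
      by apply/seteqP; split=> t /=; rewrite in_itv/= andbT.
    rewrite -[X in measurable X]setTI.
    by apply: measurable_lte.
  move=> [t x] [/= ht hx]; split=> //=; apply: tc.
  by move: ht; rewrite in_itv.
have [mfh _ _ _] := init_state hfin0 hfin1.
apply: measurable_fun_ifT.
- by apply: measurable_fun_ler; [exact: measurable_fst|exact: measurable_cst].
- exact: (mf_snd mfh).
- apply: measurable_maxr => //.
Qed.

Lemma nnrepE s : 0 < s <= T1 -> nnrep s = posext (g s).
Proof.
move=> /andP[s0 sT]; apply/funext => x; rewrite /nnrep leNgt s0/=.
rewrite /nnpatch /patch /posext /halfext.
have [x0|x0] := ltP 0 x.
  by rewrite mem_set//=; split; rewrite /= ?in_halfline// in_itv/= (ltW s0).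
rewrite memNset ?maxxx//= => -[_] /=; rewrite in_halfline => x0'.
by move: x0; rewrite leNgt x0'.
Qed.

Lemma nnrep_ge0 s x : 0 <= nnrep s x.
Proof.
rewrite /nnrep; case: ifP => _; first exact: posext_ge0.
by rewrite le_max lexx orbT.
Qed.

Lemma nnrep_le0 s x : x <= 0 -> nnrep s x = 0.
Proof.
move=> x0; rewrite /nnrep; case: ifP => _; first exact: posext_le0.
rewrite /nnpatch /patch memNset ?maxxx//= => -[_] /=.
by rewrite in_halfline => x0'; move: x0; rewrite leNgt x0'.
Qed.

Lemma nnrep_ig t : 0 <= t <= T1 -> ig mu (nnrep t).
Proof.
move=> /andP[t0 tT]; move: t0; rewrite le_eqVlt => /predU1P[<-|t0].
  have := sstate_1 (state_sstate (init_state hfin0 hfin1)).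
  by congr (_.-integrable _ _); apply/funext => x; rewrite /= /nnrep lexx.
have tI : 0 <= t <= T1 by rewrite (ltW t0).
rewrite nnrepE ?t0//; have [hX h0] := gX tI.
have [i _ _] := posext_mom hX (gmf tI) h0.
by move: i; congr (_.-integrable _ _); apply/funext => x /=; rewrite powRr0 mul1r.
Qed.

(** The moment of order [1 + beta] is bounded by assumption, and the number by weak
    continuity on a compact interval. *)
Lemma nnrep_bound : exists2 A, 0 <= A &
  {ae mu, forall s, 0 < s < T1 -> state (nnrep s) /\ \int[mu]_x (Wt x * nnrep s x) <= A}.
Proof.
pose one : R -> R := fun=> 1.
have mone : mf1 one by exact: measurable_cst.
have one1 (x : R) : `|one x| <= 1 by rewrite normr1.
have cl : {within `[0, T1], continuous (fun t => \int[mu]_(x in halfline) (1 * g t x))}.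
  case: wg => _ [[_ wc] _] _ _ _.
  apply: continuous_subspaceW (wc _ (test_dual mone one1)).
  by move=> t /=; rewrite in_itv/=; exact: tc.
have [c _ hc] := EVT_max (ltW T10) cl.
set B0 := \int[mu]_(x in halfline) (1 * g c x) in hc.
have [C hC] := lg (conj T10 T1T).
exists (`|B0| + `|C|); first exact: addr_ge0.
apply: ae_imp hC => s hs sI; have /andP[s0 sT] := sI.
have sI' : 0 <= s <= T1 by rewrite !ltW.
have [hXb hn] := hs (conj s0 sT).
have [hX h0] := gX sI'.
rewrite nnrepE; last by rewrite s0 (ltW sT).
split; first exact: posext_state.
have [i1 e1 _] := posext_mom hX (gmf sI') h0.
have [i2 _ e2] := posext_mom hXb (gmf sI') h0.
rewrite [leLHS](_ : _ = \int[mu]_x (`|x| `^ 0 * posext (g s) x) +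
    \int[mu]_x (`|x| `^ (1 + beta) * posext (g s) x)); last first.
  by rewrite -(I_D i1 i2); apply: I_eq => x; rewrite powRr0 /Wt mulrDl.
apply: lerD; last by rewrite e2 (le_trans hn)// ler_norm.
rewrite e1; apply: le_trans (ler_norm B0); have := hc s; rewrite in_itv/= => /(_ sI').
apply: le_trans; rewrite le_eqVlt; apply/orP; left; apply/eqP.
by rewrite /moment !halfline_int; apply: I_eq => x; rewrite /halfext; case: ifP => // _; rewrite powRr0.
Qed.

(** Exceptional times carry the zero state, so that bounds hold at all times. *)
Lemma tame_curve A : 0 <= A ->
  {ae mu, forall s, 0 < s < T1 -> state (nnrep s) /\ \int[mu]_x (Wt x * nnrep s x) <= A} ->
  exists h : R -> R -> R, [/\ mf2 (fun p : R * R => h p.1 p.2),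
    forall s, state (h s) /\ \int[mu]_x (Wt x * h s x) <= A &
    {ae mu, forall s, 0 < s < T1 -> h s = nnrep s}].
Proof.
move=> A0 hA.
pose W s := (\int[mu]_x (Wt x * nnrep s x)%:E)%E.
have mWg : mf2 (fun p : mR * mR => Wt p.2 * nnrep p.1 p.2).
  by apply: measurable_funM; [exact: (mf_snd (mf_Wt beta))|exact: mf_nnrep].
have W0 x : 0 <= Wt x by rewrite (le_trans ler01 (Wt_ge1 _ _)).
have mW : measurable_fun setT (W : mR -> \bar R).
  apply: (@measurable_fun_fubini_tonelli_F _ _ mR mR R mu (fun p => (Wt p.2 * nnrep p.1 p.2)%:E)).
    exact/measurable_EFinP.
  by move=> p; rewrite lee_fin mulr_ge0// nnrep_ge0.
exists (fun s x => if (W s <= A%:E)%E then nnrep s x else 0); split.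
- apply: measurable_fun_ifT => //; last exact: mf_nnrep.
  apply: measurable_fun_lee; last exact: measurable_cst.
  exact: (measurableT_comp mW measurable_fst).
- move=> s; case: (boolP (W s <= A%:E)%E) => [hW|_]; last first.
    split.
      split=> //; have := ig0 mu; congr (_.-integrable _ _).
      by apply/funext => x /=; rewrite mulr0.
    rewrite (_ : \int[mu]_x _ = 0)//.
    by rewrite -[RHS](I_0 mu); apply: I_eq => x; rewrite mulr0.
  have ms : mf1 (nnrep s) by exact: (mf_sec1 s mf_nnrep).
  have [||iW lW] := @ig_bound _ _ R mu (fun x => Wt x * nnrep s x) A _ _ hW.
  + by apply: measurable_funM => //; exact: mf_Wt.
  + by move=> x; rewrite mulr_ge0// nnrep_ge0.
  by split=> //; split=> //; [exact: nnrep_ge0|exact: nnrep_le0].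
apply: ae_imp hA => s hs sI; have [[_ _ _ i] l] := hs sI.
have lW : (W s <= A%:E)%E.
  apply: (@le_trans _ _ (\int[mu]_x (Wt x * nnrep s x))%:E); last by rewrite lee_fin.
  by rewrite (I_EFin i).
by apply/funext => x; rewrite lW.
Qed.

Lemma nnrep_identity h A t phi rho : mf2 (fun p : R * R => h p.1 p.2) ->
  (forall s, state (h s) /\ \int[mu]_x (Wt x * h s x) <= A) ->
  {ae mu, forall s, 0 < s < T1 -> h s = nnrep s} ->
  0 <= t <= T1 -> mf1 phi -> (forall x, `|phi x| <= rho) ->
  \int[mu]_x (phi x * (nnrep t x - fh x)) =
  \int[mu]_s (if seg 0 t s then Q phi (nnrep s) else 0).
Proof.
move=> mh hst hg tI mphi hrho; have /andP[t0 tT] := tI.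
have mg := mf_nnrep.
move: t0; rewrite le_eqVlt => /predU1P[<-|t0].
  transitivity (\int[mu]_x (0 : R)).
    by apply: I_eq => x; rewrite /nnrep lexx subrr mulr0.
  apply: I_eq => s; rewrite /seg.
  by case: leP => //= s0; rewrite ltNge s0.
rewrite (replace_curve M mh mg hg mphi tI).
have [hX h0] := gX tI; have mgt := gmf tI.
have gE s : 0 < s -> s < t -> nnrep s = posext (g s).
  by move=> s0 st; rewrite nnrepE// s0 (le_trans (ltW st)).
have mphi' : mf1 (halfext phi) by apply: measurable_fun_ifT => //; exact: mf_pos1.
have lphi : Linfty phi.
  by split; [exact/halfline_mf|exists rho; exact: aeW].
have eqphi : {ae mu, forall x, 0 < x -> phi x = phi x} by exact: aeW.
have tT' : time_oo T t by split=> //; have [] := tc tI.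
have mgr : mf1 (nnrep t) by exact: (mf_sec1 t mg).
case: wg => _ _ _ _ /(_ t phi tT' lphi).
rewrite (init_pairing hfin0 hfin1 mphi' mphi hrho eqphi mgt (v := nnrep t))//; last first.
  by rewrite nnrepE ?t0//; exact: posext_ae.
move=> ->.
pose J s := \int[mu]_x \int[mu]_y (zet phi (x, y) * coll_kernel (x, y) * nnrep s x * nnrep s y).
have mJ : mf1 J.
  pose F (p : (mR * mR) * mR) := zet phi (p.1.2, p.2) * coll_kernel (p.1.2, p.2) *
     nnrep p.1.1 p.1.2 * nnrep p.1.1 p.2.
  have mF : measurable_fun setT F.
    have s1 := @measurable_fst _ _ (mR * mR)%type mR.
    have s2 := @measurable_snd _ _ (mR * mR)%type mR.
    have s11 := measurableT_comp (@measurable_fst _ _ mR mR) s1.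
    have s12 := measurableT_comp (@measurable_snd _ _ mR mR) s1.
    have q1 : measurable_fun setT (fun q : mR * mR * mR => (q.1.2, q.2)).
      by apply/measurable_fun_pairP; split.
    have q2 : measurable_fun setT (fun q : mR * mR * mR => (q.1.1, q.1.2)).
      by apply/measurable_fun_pairP; split.
    have q3 : measurable_fun setT (fun q : mR * mR * mR => (q.1.1, q.2)).
      by apply/measurable_fun_pairP; split.
    apply: measurable_funM; last exact: (measurableT_comp mg q3).
    apply: measurable_funM; last exact: (measurableT_comp mg q2).
    apply: measurable_funM; last exact: (measurableT_comp (k_mf M) q1).
    exact: (measurableT_comp (mf_zet M mphi) q1).
  have mG : mf2 (fun p : mR * mR => \int[mu]_y F (p, y)).
    exact: (@mf_int2 _ _ (mR * mR)%type mR R mu F mF).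
  exact: (mf_intR mG).
rewrite Rintegral_mkcond.
have e2 s : ((fun s => \int[mu]_(x in halfline) \int[mu]_(y in halfline)
    (zeta b phi x y * K x y * g s x * g s y)) \_ `]0, t[) s =
    if (0 < s) && (s < t) then J s else 0.
  rewrite /patch mem_setE in_itv/=; case: ifP => [/andP[s0 st]|_]; last by [].
  have sI : 0 <= s <= T1 by rewrite (ltW s0) (le_trans (ltW st)).
  have [sX sp] := gX sI.
  apply: (inner_eq M mphi' mphi (gmf sI) _ (@nnrep_le0 s) eqphi).
  - exact: (mf_sec1 s mg).
  - by rewrite gE//; exact: posext_ae.
  - by move=> x y; exact: hz.
have mQ := mf_Q M mphi mh.
have hb r : 0 <= r -> r < t -> `|Q phi (h r) - 0| <= rho * (16 * (beta0 + 2)) * A * (4 * A).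
  by move=> _ _; rewrite subr0; have [hr hA] := hst r; exact: (Q_rho M mphi hrho hr hA).
have [iQ _] := seg_bound mQ (ltW t0) hb.
transitivity (2^-1 * \int[mu]_s (2 * (if seg 0 t s then Q phi (h s) else 0))); last first.
  by rewrite (I_Z _ iQ) mulrA mulVf// mul1r.
congr (_ * _).
transitivity (\int[mu]_s (if (0 < s) && (s < t) then J s else 0)).
  by apply: I_eq => s; rewrite e2.
apply: I_ae_eq.
- apply: measurable_fun_ifT => //.
  by apply: measurable_and; [exact: measurable_fun_ltr|exact: measurable_fun_ltr].
- by apply: measurable_funM => //; exact: mf_on_seg.
have n0 : {ae mu, forall s : R, s != 0}.
  exists [set 0]; split => //=; first by rewrite lebesgue_measure_set1.
  by move=> s /= /negP; rewrite negbK => /eqP.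
apply: ae_imp (ae_and hg n0) => s [hs s0]; rewrite /seg lt_neqAle eq_sym s0/=.
case: ifP => [/andP[p1 p2]|_]; last by rewrite mulr0.
have sI : 0 < s < T1 by rewrite lt_neqAle eq_sym s0 p1 (lt_le_trans p2).
by rewrite /J -hs//; have [sh _] := hst s; exact: (inner_Q M mphi hrho sh).
Qed.

(** The equation at small times and weak continuity at zero, with the sign of the
    difference as test. *)
Lemma solution_initial h A : mf2 (fun p : R * R => h p.1 p.2) ->
  (forall s, state (h s) /\ \int[mu]_x (Wt x * h s x) <= A) ->
  {ae mu, forall s, 0 < s < T1 -> h s = nnrep s} ->
  {ae mu, forall x, halfext (g 0) x = fh x}.
Proof.
move=> mh hst hg.
have sfh := init_state hfin0 hfin1; have ifh := sstate_1 (state_sstate sfh).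
have oI : 0 <= (0 : R) <= T1 by rewrite lexx ltW.
have [X0g h0] := gX oI; have /X0_ig i0 := X0g.
pose E x := halfext (g 0) x - fh x.
have iE : ig mu E by exact: igB.
pose phi := sgnf E.
have mphi : mf1 phi by apply: mf_sgnf; exact: (ig_mf iE).
have hphi x : `|phi x| <= 1 by rewrite sgnf_norm.
pose l u := \int[mu]_(x in halfline) (phi x * u x).
have lE u : l u = \int[mu]_x (phi x * halfext u x).
  by rewrite /l halfline_int; apply: I_eq => x; rewrite /halfext; case: ifP => // _; rewrite mulr0.
have bi u : ig mu u -> ig mu (fun x => phi x * u x).
  move=> i; apply: (ig_le _ (ig_abs i)).
    by apply: measurable_funM => //; exact: (ig_mf i).
  by move=> x; rewrite normrM ler_piMl.
set c := 1 * (16 * (beta0 + 2)) * A * (4 * A).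
have hQ r : `|Q phi (h r)| <= c.
  by have [hr hA] := hst r; exact: (Q_rho M mphi hphi hr hA).
have c0 : 0 <= c by exact: le_trans (hQ 0).
have key t : 0 < t -> t <= T1 -> `|l (g t) - \int[mu]_x (phi x * fh x)| <= t * c.
  move=> t0 tT; have tI : 0 <= t <= T1 by rewrite ltW.
  have [tX tp] := gX tI; have /X0_ig it := tX.
  have e := nnrep_identity mh hst hg tI mphi hphi.
  rewrite (replace_curve M mh mf_nnrep hg mphi tI) in e.
  have hb r : 0 <= r -> r < t -> `|Q phi (h r) - 0| <= c by rewrite subr0.
  have [_] := seg_bound (mf_Q M mphi mh) (ltW t0) hb.
  rewrite mulr0 !subr0 -e; congr (`|_| <= _).
  rewrite lE -(I_B (bi _ it) (bi _ ifh)).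
  apply: I_ae_eq.
  - apply: measurable_funM => //; apply: measurable_funB.
      exact: (mf_sec1 t mf_nnrep).
    exact: (ig_mf ifh).
  - by apply: measurable_funB; [exact: (ig_mf (bi _ it))|exact: (ig_mf (bi _ ifh))].
  by apply: ae_imp (posext_ae tp) => x ->; rewrite nnrepE ?t0// mulrBr.
have lc : {within time_co T, continuous (fun t => l (g t))}.
  by case: wg => _ [[_ wc] _] _ _ _; exact: (wc _ (test_dual mphi hphi)).
have z : `|l (g 0) - \int[mu]_x (phi x * fh x)| <= 0.
  apply/ler_addgt0Pr => e e0; rewrite add0r.
  have e2 : 0 < e / 2 by rewrite divr_gt0.
  have /subspace_continuousP/(_ 0 (tc oI))/cvgrPdist_le/(_ _ e2) := lc.
  rewrite near_withinE => /nbhs_ballP[d /= d0 hd].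
  have c10 : 0 < c + 1 by rewrite ltr_wpDl.
  (* a positive time, small enough for the weak continuity and for [key] *)
  pose t := Num.min T1 (Num.min (d / 2) (e / 2 / (c + 1))).
  have t0 : 0 < t by rewrite !lt_min T10 !divr_gt0.
  have tT : t <= T1 by rewrite ge_min lexx.
  have td : t < d.
    apply: (@le_lt_trans _ _ (d / 2)); first by rewrite !ge_min lexx !orbT.
    by rewrite ltr_pdivrMr// mulr_natr mulr2n ltrDl.
  have tcE : t * c <= e / 2.
    have : t <= e / 2 / (c + 1) by rewrite !ge_min lexx !orbT.
    rewrite ler_pdivlMr//; apply: le_trans.
    by rewrite ler_wpM2l ?(ltW t0)// lerDl.
  have tI : 0 <= t <= T1 by rewrite ltW.
  have h1 := hd t; rewrite /ball/= sub0r normrN (gtr0_norm t0) in h1.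
  have {}h1 := h1 td (tc tI).
  have h2 := le_trans (key t t0 tT) tcE.
  rewrite [leRHS](splitr e); apply: le_trans (ler_distD (l (g t)) _ _) _.
  exact: lerD.
have e1 : \int[mu]_x `|E x| = l (g 0) - \int[mu]_x (phi x * fh x).
  rewrite lE -(I_B (bi _ i0) (bi _ ifh)); apply: I_eq => x.
  by rewrite -mulrBr /phi -(sgnfM E).
have z' : \int[mu]_x `|E x| <= 0 by rewrite e1 (le_trans (ler_norm _)).
apply: ae_imp (I_eq0_ae (ig_abs iE) (fun x => normr_ge0 _) z') => x /eqP.
by rewrite normr_eq0 subr_eq0 => /eqP.
Qed.

End FromSolution.

(** * Well-posedness *)

Theorem corollary1p7 (R : realType) (alpha beta beta0 p Bp : R)
    (b bbar : R -> R -> R -> R) (fin : R -> R)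
    (halpha : 0 <= alpha) (hab : alpha <= beta) (hbeta : beta <= 1)
    (hb : daughter_distribution b)
    (hb_mass : forall x y, 0 < x -> 0 < y ->
       (\int[lebesgue_measure]_(z in `]0%R, (x + y)%R[) (z * b z x y)%:E
          = (x + y)%:E)%E)
    (hb_supp : forall z x y, 0 < x -> 0 < y -> x + y < z -> b z x y = 0)
    (hbbar : daughter_distribution bbar)
    (hb_split : forall z x y, 0 < z -> 0 < x -> 0 < y ->
       b z x y = bbar z x y * \1_(`]0, x[) z + bbar z y x * \1_(`]0, y[) z)
    (hbbar_mass : forall x y, 0 < x -> 0 < y ->
       (\int[lebesgue_measure]_(z in `]0%R, x[) (z * bbar z x y)%:E = x%:E)%E)
    (hbbar_supp : forall z x y, 0 < x -> 0 < y -> x < z -> bbar z x y = 0)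
    (hbeta0 : 2 < beta0)
    (hb_number : forall x y, 0 < x -> 0 < y ->
       (\int[lebesgue_measure]_(z in `]0%R, (x + y)%R[) (b z x y)%:E
          <= beta0%:E)%E)
    (hp1 : 1 < p) (hp2 : p < 2) (hBp : 0 < Bp)
    (hbbar_p : forall x y, 0 < x -> 0 < y ->
       (\int[lebesgue_measure]_(z in `]0%R, x[) (bbar z x y `^ p)%:E
          <= (Bp / 2 * x `^ (1 - p))%:E)%E)
    (hfin0 : X 0 fin) (hfin1 : Xplus (1 + beta) fin)
    (hfin_mass : 0 < moment 1 fin) :
  let lambda := alpha + beta in
  let T := Tstar lambda beta0 fin in
  let sol (f : R -> R -> R) :=
    [/\ weak_solution (collision_kernel alpha beta) b fin T f,
        mass_conserving fin T f &
        forall t, time_oo T t -> Linfty_time t%:E (1 + beta) (X (1 + beta)) f] in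
  exists f : R -> R -> R, sol f /\
    forall g : R -> R -> R, sol g -> forall t, time_co T t ->
      {ae lebesgue_measure, forall x : R, 0 < x -> g t x = f t x}.

Proof.
move=> lambda T sol.
have hbeta' : 0 <= beta by exact: le_trans hab.
have M := coefficients_model halpha hab hbeta hb hb_mass hbbar hb_split hbbar_mass hbeta0 hb_number.
have hz (phi : R -> R) x y : 0 < x -> 0 < y ->
    zeta b phi x y = zet (coll_daughter b) (halfext phi) (x, y).
  move=> x0 y0; apply: zeta_zet => //.
  by rewrite (coll_daughter_int hb_split (halfext phi) (q := (x, y))).
have sfh := init_state hfin0 hfin1.
have eM1 := init_M1 halpha hab hfin0 hfin1.
have M1p : 0 < \int[lebesgue_measure]_x (x * posext fin x) by rewrite -eM1.
have [Tn [m [Tn0 Tn_nd TnT hTn hm]]] := horizon halpha hab hbeta hbeta0 hfin0 hfin1 hfin_mass.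
have [f [mf2f bf f_mass f0]] :=
  model_existence M halpha hab (@coll_kernel_split R alpha beta) sfh M1p Tn0 Tn_nd hm.
pose A i := Abound beta (posext fin) (Tn i) (m i).
have bA i : bounded_states beta (Tn i) (A i) f by have [] := bf i.
have aA i : approx_sol (coll_kernel alpha beta) (coll_daughter b) (Tn i) 0 (Cbound beta0 (A i)) f by have [] := bf i.
have Cp i : 0 <= Cbound beta0 (A i).
  have [s0 sA] := bA i 0 (introT andP (conj (lexx 0) (Tn0 i))).
  have A0 := state_I_ge0 s0 sA.
  have c20 : 0 <= 16 * (beta0 + 2) by rewrite mulr_ge0// addr_ge0// ltW// (lt_trans _ hbeta0).
  by rewrite /Cbound; apply: mulr_ge0; apply: mulr_ge0 => //; exact: mulr_ge0.
have mass i t : 0 <= t <= Tn i -> \int[lebesgue_measure]_x (x * f t x) = moment 1 fin.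
  by move=> ti; have [-> _] := f_mass i t ti; rewrite eM1.
exists f; split.
  exact: (curve_solution hbeta' M hz hfin0 hfin1 hTn mf2f bA Cp aA mass f0 TnT).
move=> g [wg _ lg] t tT.
have [i ti] := hTn t tT; have [t0 _] := tT.
have Tp : 0 < Tn i by exact: le_lt_trans ti.
have tI : 0 <= t <= Tn i by rewrite t0 ltW.
have [B B0 hB] := nnrep_bound wg lg Tp (TnT i).
have [h [mh hst hg]] := tame_curve hfin0 hfin1 wg (TnT i) B0 hB.
have tail s r : 0 <= s <= Tn i -> 1 <= r -> 
    \int[lebesgue_measure]_x (out r (Wt beta) x * f s x) <= tail_bound beta (posext fin) r.
  by move=> sI r1; have [_] := f_mass i s sI; exact.
have eg := model_uniqueness M sfh mh hst (ltW Tp) (mf_nnrep hfin0 hfin1 wg (TnT i))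
  (nnrep_ig hfin0 hfin1 wg (TnT i)) (nnrep_ge0 fin g (Tn i)) (@nnrep_le0 R fin g (Tn i)) hg
  (fun s phi rho sI mphi hrho => nnrep_identity M hz hfin0 hfin1 wg (TnT i) mh hst hg sI mphi hrho)
  (bA i) (aA i) tail f0 tI.
move: t0; rewrite le_eqVlt => /predU1P[t0|t0].
  have h0 := solution_initial M hz hfin0 hfin1 wg Tp (TnT i) mh hst hg.
  rewrite -t0; apply: ae_imp (ae_and h0 f0) => x [h1 h2] x0.
  by rewrite h2 -h1 /halfext x0.
have gp : {ae lebesgue_measure, forall x, 0 < x -> 0 <= g t x}.
  by case: wg => _ [_ hX] _ _ _; have [] := hX t tT.
apply: ae_imp (ae_and eg (posext_ae gp)) => x [h1 h2] x0.
by rewrite -h1 nnrepE ?t0 ?(ltW ti)// -h2 /halfext x0.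
Qed.
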